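(* Let $T>0$, $D\in\mathbb N$, $H\in(0,\tfrac12)$, $N\in\mathbb N$ with $N\ge 1$, and let $\alpha,\beta,a,b>0$ be arbitrary tuning parameters. Let $m,n,\xi_0,\dots,\xi_n$ and the kernel $\widehat G_H$ be given by the quadrature construction described in the context (with $\xi_0<\xi_n$), and set $r_{-,N}:=(\xi_n/\xi_0)^{1/n}$. Let $$\mathbf X_t=\rho(t)\mathbf X_0+\int_0^tG_H(t-s)\mathbf b(s)\,\mathrm ds+\int_0^tG_H(t-s)\boldsymbol\Sigma(s)\,\mathrm d\mathbf B_s,$$ $$\widehat{\mathbf X}_t=\rho(t)\mathbf X_0+\int_0^t\widehat G_H(t-s)\mathbf b(s)\,\mathrm ds+\int_0^t\widehat G_H(t-s)\boldsymbol\Sigma(s)\,\mathrm d\mathbf B_s,\qquad t\in[0,T].$$ Then $$\mathbb E\big[\|\mathbf X_T-\widehat{\mathbf X}_T\|^2\big]\le C_Tc_H^2\bigg[\frac{T^3}{(\frac32-H)^2}a^{3-2H}e^{-\frac{2\alpha}{A_-}\sqrt N}+\frac{3}{2H^2}b^{-2H}e^{-\frac{2\alpha}{A_-}\sqrt N}+\frac{5\pi^3}{12}\frac{T^{2H}}{H}\frac{n^2}{m^{2H}}\Big(\frac{r_{-,N}-1}{2}\Big)^{4m+2}\bigg].$$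
   Context: Kernel: $G_H(t)=\dfrac{t^{H-\frac12}}{\Gamma(H+\frac12)}$ for $t>0$. Constants: $c_H:=\dfrac{1}{\Gamma(H+\frac12)\Gamma(\frac12-H)}$, $A_-:=\Big(\dfrac1H+\dfrac1{\frac32-H}\Big)^{1/2}$. (One has $G_H(t)=c_H\int_0^\infty e^{-\gamma t}\gamma^{-H-\frac12}\,\mathrm d\gamma$.) Process data: $\mathbf B$ is a standard $D$-dimensional Brownian motion; $\mathbf X_0$ is an $\mathbb R^D$-valued initial random variable independent of $\mathbf B$; $\rho(t)=e^{-\kappa t}$ for a fixed constant $\kappa>0$; $\mathbf b\in L^\infty([0,T];\mathbb R^D)$ and $\boldsymbol\Sigma\in L^\infty([0,T];\mathbb R^{D\times D})$ are deterministic. The constant is $$C_T=2T\|\mathbf b\|_{L^\infty(0,T)}^2+2\|\boldsymbol\Sigma\|_{L^\infty(0,T)}^2,$$ where the $L^\infty$ norms use the Euclidean norm on $\mathbb R^D$ and the Frobenius norm on $\mathbb R^{D\times D}$. Gaussian quadrature: for a finite interval $[u,v]$, $u<v$, and a continuous positive weight $w$ on $[u,v]$, the $m$-point Gaussian quadrature rule with respect to $w$ is the unique set of nodes $x_1,\dots,x_m\in(u,v)$ and positive weights $\eta_1,\dots,\eta_m$ with $\int_u^vp(x)w(x)\,\mathrm dx=\sum_{k=1}^m\eta_kp(x_k)$ for every polynomial $p$ of degree at most $2m-1$. Construction: $m,n$ are positive integers obtained by rounding, $m\approx\frac{\beta}{A_-}\sqrt N$, $n\approx\frac{A_-}{\beta}\sqrt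 N$, $mn\approx N$ (the rounding convention is unspecified; the estimate is claimed for whichever positive integers $m,n$ result). Put $$\xi_0:=a\exp\Big(-\frac{\alpha}{(\frac32-H)A_-}\sqrt N\Big),\quad \xi_n:=b\exp\Big(\frac{\alpha}{HA_-}\sqrt N\Big),\quad \xi_j:=\xi_0\Big(\frac{\xi_n}{\xi_0}\Big)^{j/n},\ j=0,\dots,n.$$ On each $[\xi_j,\xi_{j+1}]$, $j=0,\dots,n-1$, take the $m$-point Gaussian quadrature rule with respect to $w_H(\gamma)=c_H\gamma^{-H-\frac12}$; relabel all resulting nodes and weights as $(\gamma_i,\omega_i)_{i=1}^{mn}$. Add the zero node $\gamma_0:=0$, $\omega_0:=c_H\int_0^{\xi_0}\gamma^{-H-\frac12}\,\mathrm d\gamma=\frac{c_H}{\frac12-H}\xi_0^{\frac12-H}$. Then $$\widehat G_H(t):=\sum_{i=0}^{mn}\omega_ie^{-\gamma_it}.$$ *)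

(* Defs.v *)
From HB Require Import structures.
From mathcomp Require Import all_boot all_order all_algebra.
From mathcomp Require Import all_classical all_reals all_analysis.

Set Implicit Arguments.
Unset Strict Implicit.
Unset Printing Implicit Defensive.

Import Order.TTheory GRing.Theory Num.Theory.
Import numFieldNormedType.Exports.

Local Open Scope classical_set_scope.
Local Open Scope ring_scope.

(* Euclidean norm of a column vector, Frobenius norm of a matrix (the library
   norm `|A| on matrices is the max-norm). *)
Definition frobnorm (R : realType) (p q : nat) (A : 'M[R]_(p, q)) : R :=
  Num.sqrt (\sum_i \sum_j A i j ^+ 2).

(* ||f||_{L^oo(0,T)}; extending f by 0 outside [0,T] does not change it. *)
Definition Linfty_norm (R : realType) (p q : nat) (T : R)
    (f : R -> 'M[R]_(p, q)) : \bar R :=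
  Lnorm (@lebesgue_measure R) +oo%E
    (EFin \o ((fun s => frobnorm (f s)) \_ `[0, T])).

Definition in_Linfty (R : realType) (p q : nat) (T : R)
    (f : R -> 'M[R]_(p, q)) : Prop :=
  (forall i j, measurable_fun `[0, T] (fun s => f s i j)) /\
  (Linfty_norm T f < +oo)%E.

Section Probability.
Context (d : measure_display) (Om : measurableType d) (R : realType).
Variable P : probability Om R.

Definition random_vector (D : nat) (Z : Om -> 'cV[R]_D) : Prop :=
  forall i, measurable_fun [set: Om] (fun w => Z w i 0).

Definition sigma_of (I : Type) (J : set I) (Z : I -> Om -> R) :
    set (set Om) :=
  <<s [set E | exists i (A : set R), [/\ J i, measurable A & E = Z i @^-1` A]] >>.

Definition independent_classes (F G : set (set Om)) : Prop :=
  forall E E', F E -> G E' -> (P (E `&` E') = P E * P E')%E.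

(* Product rule over the whole family: taking some A i to be the full line
   gives it for all subfamilies. *)
Definition independent_rvs (I : finType) (Z : I -> Om -> R) : Prop :=
  forall A : I -> set R, (forall i, measurable (A i)) ->
    P (\bigcap_(i in [set: I]) (Z i @^-1` A i)) =
    (\prod_(i : I) P (Z i @^-1` A i))%E.

(* Time ranges over R, but only t >= 0 is constrained. The increments over
   disjoint intervals and their coordinates are jointly independent, since the
   increment over [s,t] has law N(0, (t - s) I_D). *)
Definition brownian_motion (D : nat) (B : R -> Om -> 'cV[R]_D) : Prop :=
  [/\ forall t, 0 <= t -> random_vector (B t),
      {ae P, forall w, B 0 w = 0},
      forall (p : nat) (t : nat -> R), 0 <= t 0%N ->
        (forall k, (k < p)%N -> t k <= t k.+1) ->
        independent_rvs (fun (ki : 'I_p * 'I_D) w =>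
          (B (t ki.1.+1) w - B (t ki.1) w) ki.2 0),
      forall (s t : R) (i : 'I_D), 0 <= s -> s < t ->
        forall A : set R, measurable A ->
        P ((fun w => (B t w - B s w) i 0) @^-1` A) =
        normal_prob 0 (Num.sqrt (t - s)) A
    & {ae P, forall w, forall i,
        {within `[0, +oo[, continuous (fun t => B t w i 0)}}].

Definition independent_of_process (D : nat) (X0 : Om -> 'cV[R]_D)
    (B : R -> Om -> 'cV[R]_D) : Prop :=
  independent_classes
    (sigma_of [set: 'I_D] (fun i w => X0 w i 0))
    (sigma_of [set ti : R * 'I_D | 0 <= ti.1]
              (fun ti w => B ti.1 w ti.2 0)).

Record step_integrand (D : nat) (t : R) := StepIntegrand {
  step_size : nat ;
  step_time : nat -> R ;
  step_value : nat -> 'M[R]_D ;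
  step_time0 : step_time 0%N = 0 ;
  step_time_size : step_time step_size = t ;
  step_time_mono : forall k, (k < step_size)%N ->
                     step_time k <= step_time k.+1
}.

Definition step_fun (D : nat) (t : R) (phi : step_integrand D t) (s : R) :
    'M[R]_D :=
  \sum_(k < step_size phi)
    (\1_(`]step_time phi k, step_time phi k.+1]) s : R) *: step_value phi k.

Definition step_integral (D : nat) (t : R) (phi : step_integrand D t)
    (B : R -> Om -> 'cV[R]_D) (w : Om) : 'cV[R]_D :=
  \sum_(k < step_size phi)
    step_value phi k *m
    (B (step_time phi k.+1) w - B (step_time phi k) w).

(* The Ito integral over [0,t] of a deterministic integrand f in L^2(0,t), as
   the L^2(P)-limit of the integrals of step integrands that converge to f in
   L^2(0,t). By the Ito isometry this determines W up to a null set. *)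
Definition is_ito_integral (D : nat) (B : R -> Om -> 'cV[R]_D) (t : R)
    (f : R -> 'M[R]_D) (W : Om -> 'cV[R]_D) : Prop :=
  random_vector W /\
  exists phi : nat -> step_integrand D t,
    (\int[@lebesgue_measure R]_(s in `[0%R, t])
       ((frobnorm (f s - step_fun (phi q) s)) ^+ 2)%:E @[q --> \oo]
     --> 0)%E /\
    ('E_P[(fun w => frobnorm (W w - step_integral (phi q) B w) ^+ 2)%R]
       @[q --> \oo] --> 0)%E.

Definition is_volterra_process (D : nat) (T : R) (B : R -> Om -> 'cV[R]_D)
    (X0 : Om -> 'cV[R]_D) (rho G : R -> R) (b : R -> 'cV[R]_D)
    (Sigma : R -> 'M[R]_D) (X : R -> Om -> 'cV[R]_D) : Prop :=
  forall t, 0 <= t <= T ->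
    random_vector (X t) /\
    exists2 W : Om -> 'cV[R]_D,
      is_ito_integral B t (fun s => G (t - s) *: Sigma s) W &
      {ae P, forall w, X t w =
        rho t *: X0 w
        + \col_i (\int[@lebesgue_measure R]_(s in `[0, t])
                    (G (t - s) * b s i 0))
        + W w}.

End Probability.

Section Kernel.
Variable R : realType.
Implicit Types (H alpha a b : R) (m n N : nat).

Definition Gamma (x : R) : R :=
  \int[@lebesgue_measure R]_(t in `]0, +oo[) (t `^ (x - 1) * expR (- t)).

Definition kernelG H (t : R) : R := t `^ (H - 2^-1) / Gamma (H + 2^-1).

Definition cH H : R := (Gamma (H + 2^-1) * Gamma (2^-1 - H))^-1.

Definition A_minus H : R := Num.sqrt (H^-1 + (3 / 2 - H)^-1).

Definition wH H (gamma : R) : R := cH H * gamma `^ (- H - 2^-1).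

Definition xi_first H alpha a N : R :=
  a * expR (- (alpha / ((3 / 2 - H) * A_minus H) * Num.sqrt N%:R)).

Definition xi_last H alpha b N : R :=
  b * expR (alpha / (H * A_minus H) * Num.sqrt N%:R).

Definition grid (xi0 xin : R) n (j : nat) : R :=
  xi0 * (xin / xi0) `^ (j%:R / n%:R).

Definition grid_ratio (xi0 xin : R) n : R := (xin / xi0) `^ (n%:R^-1).

(* size p <= 2m is deg p <= 2m - 1. *)
Definition is_gauss_rule m (u v : R) (w : R -> R) (x eta : 'I_m -> R) :
    Prop :=
  [/\ injective x,
      forall k, u < x k < v,
      forall k, 0 < eta k
    & forall p : {poly R}, (size p <= 2 * m)%N ->
        \int[@lebesgue_measure R]_(y in `[u, v]) (p.[y] * w y) =
        \sum_(k < m) eta k * p.[x k]].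

(* The node-weight pairs (gamma_i, omega_i), i = 0, ..., mn, starting with the
   zero node. *)
Definition quad_nodes H (xi0 : R) m n (x eta : 'I_n -> 'I_m -> R) :
    seq (R * R) :=
  (0, \int[@lebesgue_measure R]_(gamma in `[0, xi0]) wH H gamma) ::
  [seq (x j k, eta j k) | j <- enum 'I_n, k <- enum 'I_m].

Definition exp_kernel (nodes : seq (R * R)) (t : R) : R :=
  \sum_(go <- nodes) go.2 * expR (- (go.1 * t)).

Definition C_const (D : nat) (T : R) (b : R -> 'cV[R]_D)
    (Sigma : R -> 'M[R]_D) : R :=
  2 * T * fine (Linfty_norm T b) ^+ 2 + 2 * fine (Linfty_norm T Sigma) ^+ 2.

End Kernel.

(* Main.v *)
Require Import Defs.
From HB Require Import structures.
From mathcomp Require Import all_boot all_order all_algebra.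
From mathcomp Require Import all_classical all_reals all_analysis.
From mathcomp Require Import measurable_realfun ess_sup_inf.
From mathcomp Require Import zify ring lra.

(* The error splits into a deterministic drift part and a stochastic part. By
   Cauchy-Schwarz and the Ito isometry both are controlled by the squared
   L^2(0,T) norm of G - Ghat, which gives the factor C_T.

   For t > 0, (G - Ghat)(t) is the sum of three pieces, and (x + y + z)^2 <=
   3 (x^2 + y^2 + z^2) makes it enough to estimate each of them in L^2(0,T).
   On ]0, xi_0] one uses 0 <= 1 - exp(-gamma t) <= gamma t. On [xi_n, +oo[ one
   splits gamma^(-H-1/2) as gamma^(-H/2-1/2) gamma^(-H/2), applies
   Cauchy-Schwarz in gamma, and then Tonelli. On [xi_j, xi_(j+1)] the rule is
   exact on the Taylor polynomial of degree 2m - 1 of gamma |-> exp(-gamma t) at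
   the midpoint, whose remainder is nonnegative, so integral and rule differ by
   at most the supremum of the remainder times the mass of w_H. Squaring,
   integrating the resulting t^(4m) exp(-2 xi_j t) and using
   2 binomial(4m, 2m) <= 2^(4m) gives (3/2) ((r - 1)/2)^(4m+2) T^(2H) / m^(2H)
   for each j. The final constant 9/2 is below 5 pi^3 / (12 H). *)

Set Implicit Arguments.
Unset Strict Implicit.
Unset Printing Implicit Defensive.

Import Order.TTheory GRing.Theory Num.Theory.
Import numFieldNormedType.Exports.

Local Open Scope classical_set_scope.
Local Open Scope ring_scope.

(** * Cauchy-Schwarz, Taylor bounds and elementary integrals *)

(** Two obstacles shape the argument. The Ito integrals of the two processes are L^2 limits along
    unrelated sequences of step integrands, with unrelated partitions. No common refinement is
    formed: a step function is rewritten over intervals ]0, tau], for which Brownian positions and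
    indicators have the same Gram matrix min(tau_p, tau_q). The inequality |A + C|^2 <= (1 + e)
    |A|^2 + (1 + 1/e) |C|^2 then carries the isometry to the limits, with constant 1 after e -> 0.

    The cell estimate has to be the same for all j. The grid is geometric, so a cell has length
    proportional to its left end u, and expanding at the midpoint still leaves the decaying factor
    exp(-u t). Integrating the squared error in t then cancels all powers of u except u^(-2H). This
    one is traded for T^(2H) / m^(2H) by y^(-2H) <= 1 + 1/y at y = u t / m: u t is of order m where
    t^(4m) exp(-2 u t) peaks, and only factorials remain to be computed instead of values of
    Gamma. *)

Lemma sqr_le_of_scaled_sum (R : realType) (x A B : R) : 0 <= x -> 0 <= A -> 0 <= B ->
  (forall l, 0 < l -> 2 * x <= l * A + l^-1 * B) -> x ^+ 2 <= A * B.
Proof.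
move=> x0 A0 B0 h.
have [->|xn] := eqVneq x 0; first by rewrite expr0n mulr_ge0.
have xp : 0 < x by rewrite lt_neqAle eq_sym xn.
have [A00|An] := eqVneq A 0.
  (* With [A = 0] this [l] makes the right-hand side smaller than [x], against [2 * x] on the
     left. *)
  have /h : 0 < (B + x) / x by rewrite divr_gt0// ltr_wpDl.
  rewrite A00 mulr0 add0r invf_div => hh; exfalso.
  have : x / (B + x) * B < x.
    rewrite mulrAC ltr_pdivrMr ?ltr_wpDl//; nra.
  lra.
have Ap : 0 < A by rewrite lt_neqAle eq_sym An.
(* This [l] turns the first summand into [x] itself, so that the second must be at least [x]. *)
have /h : 0 < x / A by rewrite divr_gt0.
rewrite divfK// invf_div => hh.
have : x <= A / x * B by lra.
by rewrite mulrAC ler_pdivlMr// expr2.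
Qed.

(** By uniqueness of Lebesgue measure: [|c|] times its image under [phi] has the right value on
    half-open intervals. For negative [c] the preimage of ]u, v] is closed on the left and open on
    the right, hence the two cases. *)
Lemma ge0_integral_affine (R : realType) (c e : R) (f : R -> \bar R) :
  c != 0 -> measurable_fun [set: R] f -> (forall x, (0 <= f x)%E) ->
  (\int[@lebesgue_measure R]_x f (c * x + e)%R =
   (`|c|^-1)%:E * \int[@lebesgue_measure R]_x f x)%E.
Proof.
move=> c0 mf f0.
pose phi : R -> measurableTypeR R := fun x => c * x + e.
have mphi : measurable_fun [set: R] phi.
  by apply: measurable_funD => //; exact: measurable_funM.
have nc : 0 < `|c| by rewrite normr_gt0.
pose nu := mscale (NngNum (normr_ge0 c)) (pushforward (@lebesgue_measure R) phi).
have E : forall A, measurable A -> @lebesgue_measure R A = nu mphi A.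
  move=> A mA; apply: lebesgue_measure_unique => // _ [[u v]] _ <-.
  rewrite [RHS](_ : _ = (`|c|%:E * @lebesgue_measure R (phi @^-1` `]u, v]))%E)//.
  rewrite /phi.
  have [cp|cn|/eqP/esym] := ltgtP 0 c; last by rewrite eq_sym (negbTE c0).
  - rewrite (_ : _ @^-1` _ = `](u - e) / c, (v - e) / c]%classic); last first.
      apply/seteqP; split => x /=; rewrite !in_itv/= ltr_pdivrMr// ler_pdivlMr//;
      by rewrite ltrBlDr lerBrDr mulrC.
    rewrite !lebesgue_measure_itv/= !lte_fin ltr_pM2r ?invr_gt0// ltrD2r gtr0_norm//.
    case: ifPn => _; last by rewrite mule0.
    by rewrite -!EFinB -EFinM; congr EFin; field; rewrite gt_eqF.
  - rewrite (_ : _ @^-1` _ = `[(v - e) / c, (u - e) / c[%classic); last first.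
      apply/seteqP; split => x /=; rewrite !in_itv/= ltr_ndivlMr// ler_ndivrMr//;
      by rewrite ltrBlDr lerBrDr mulrC andbC.
    rewrite !lebesgue_measure_itv/= !lte_fin ltr_nM2r ?invr_lt0// ltrD2r ltr0_norm//.
    case: ifPn => _; last by rewrite mule0.
    by rewrite -!EFinB -EFinM; congr EFin; field; rewrite lt_eqF.
rewrite [in RHS](eq_measure_integral (nu mphi)); last by move=> A mA _; exact: E.
rewrite ge0_integral_mscale// ge0_integral_pushforward// preimage_setT /= muleA.
by rewrite -EFinM mulVf ?mul1e// gt_eqF.
Qed.

(** Integrate 2 f g <= l f^2 + g^2 / l for every l > 0 and optimise in l afterwards. Finiteness of
    the integral of f g comes from the case l = 1. *)
Lemma ge0_cauchy_schwarz d (T : measurableType d) (R : realType)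
    (mu : {measure set T -> \bar R}) (D : set T) (f g : T -> R) (A B : R) :
  measurable D -> measurable_fun D f -> measurable_fun D g ->
  (forall x, D x -> 0 <= f x) -> (forall x, D x -> 0 <= g x) ->
  (\int[mu]_(x in D) (f x ^+ 2)%:E <= A%:E)%E ->
  (\int[mu]_(x in D) (g x ^+ 2)%:E <= B%:E)%E ->
  (\int[mu]_(x in D) (f x * g x)%:E <= (Num.sqrt (A * B))%:E)%E.
Proof.
move=> mD mf mg f0 g0 fA gB.
have A0 : 0 <= A.
  by rewrite -lee_fin (le_trans _ fA)// integral_ge0// => x _; rewrite lee_fin sqr_ge0.
have B0 : 0 <= B.
  by rewrite -lee_fin (le_trans _ gB)// integral_ge0// => x _; rewrite lee_fin sqr_ge0.
have I0 : (0 <= \int[mu]_(x in D) (f x * g x)%:E)%E.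
  by apply: integral_ge0 => x Dx; rewrite lee_fin mulr_ge0// ?f0 ?g0.
have key l : 0 < l ->
    (\int[mu]_(x in D) (f x * g x)%:E <= ((l * A + l^-1 * B) / 2)%:E)%E.
  move=> l0.
  have mf2 : measurable_fun D (fun x => (f x ^+ 2)%:E).
    by apply/measurable_EFinP; exact: measurable_funX.
  have mg2 : measurable_fun D (fun x => (g x ^+ 2)%:E).
    by apply/measurable_EFinP; exact: measurable_funX.
  have l2 : 0 <= l / 2 by rewrite divr_ge0// ltW.
  have l2' : 0 <= l^-1 / 2 by rewrite divr_ge0// invr_ge0 ltW.
  apply: (@le_trans _ _ (\int[mu]_(x in D)
     ((l / 2)%:E * (f x ^+ 2)%:E + (l^-1 / 2)%:E * (g x ^+ 2)%:E)))%E.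
    apply: ge0_le_integral => //.
    - by move=> x Dx; rewrite lee_fin mulr_ge0// ?f0 ?g0.
    - by apply/measurable_EFinP; exact: measurable_funM.
    - by apply: emeasurable_funD; exact: measurable_funeM.
    - move=> x Dx; rewrite -!EFinM -EFinD lee_fin.
      have := sqr_ge0 (l * f x - g x).
      rewrite -(@pmulr_rge0 _ l^-1) ?invr_gt0// => h.
      have {}h : 0 <= l * f x ^+ 2 + l^-1 * g x ^+ 2 - 2 * (f x * g x).
        rewrite [X in _ <= X](_ : _ = l^-1 * (l * f x - g x) ^+ 2)//.
        by field; rewrite gt_eqF.
      lra.
  rewrite ge0_integralD//=; last 4 first.
  - by move=> x _; rewrite -EFinM lee_fin mulr_ge0// sqr_ge0.
  - exact: measurable_funeM.
  - by move=> x _; rewrite -EFinM lee_fin mulr_ge0// sqr_ge0.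
  - exact: measurable_funeM.
  rewrite ge0_integralZl//; last by move=> x _; rewrite lee_fin sqr_ge0.
  rewrite ge0_integralZl//; last by move=> x _; rewrite lee_fin sqr_ge0.
  rewrite (_ : ((l * A + l^-1 * B) / 2)%:E =
     (l / 2)%:E * A%:E + (l^-1 / 2)%:E * B%:E)%E; last first.
    by rewrite -!EFinM -EFinD; congr EFin; ring.
  by apply: leeD; apply: lee_wpmul2l => //; rewrite lee_fin.
have Ifin : (\int[mu]_(x in D) (f x * g x)%:E)%E \is a fin_num.
  by rewrite ge0_fin_numE// (le_lt_trans (key 1 ltr01))// ltry.
rewrite -(fineK Ifin) lee_fin -(ger0_norm (fine_ge0 I0)) -sqrtr_sqr.
rewrite ler_wsqrtr//; apply: sqr_le_of_scaled_sum => //; first exact: fine_ge0.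
by move=> l /key; rewrite -[leLHS](fineK Ifin) lee_fin; lra.
Qed.

Lemma monomial_fact_deriv (R : realType) (n : nat) (y : R) :
  n.+1`!%:R^-1 * (n.+1%:R * y ^+ n) = y ^+ n / n`!%:R.
Proof.
have f0 : n`!%:R != 0 :> R by rewrite pnatr_eq0 -lt0n fact_gt0.
have n0 : n.+1%:R != 0 :> R by rewrite pnatr_eq0.
by rewrite factS natrM invfM mulrACA mulVf// mul1r mulrC.
Qed.

Lemma is_derive_monomial (R : realType) (k y : R) (n : nat) :
  is_derive y 1 (fun z : R => k * z ^+ n.+1) (k * (n.+1%:R * y ^+ n)).
Proof.
rewrite (_ : (fun z : R => k * z ^+ n.+1) = (k *: ((@id R) ^+ n.+1))); last first.
  by apply/funext => z; rewrite [RHS]/(k * ((@id R) ^+ n.+1) z) exprfctE.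
apply: (is_derive_eq (is_deriveZ k (is_deriveX n.+1 (is_derive_id y (1 : R))))).
by rewrite /GRing.scale/= mulr1.
Qed.

Definition exp_taylor (R : realType) (n : nat) (y : R) : R :=
  \sum_(k < n) y ^+ k / k`!%:R.

Lemma is_derive_exp_taylor (R : realType) (n : nat) (y : R) :
  is_derive y 1 (@exp_taylor R n.+1) (exp_taylor n y).
Proof.
elim: n => [|n IH].
  rewrite (_ : exp_taylor 1 = cst 1).
    by rewrite /exp_taylor big_ord0; exact: is_derive_cst.
  by apply/funext => z; rewrite /exp_taylor big_ord1 expr0 divr1.
rewrite (_ : exp_taylor n.+2 =
  exp_taylor n.+1 + (fun z => n.+1`!%:R^-1 * z ^+ n.+1)); last first.
  by apply/funext => z; rewrite /exp_taylor big_ord_recr/= fctE mulrC.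
rewrite (_ : exp_taylor n.+1 y = exp_taylor n y + n.+1`!%:R^-1 * (n.+1%:R * y ^+ n)).
  apply: is_deriveD; exact: is_derive_monomial.
rewrite /exp_taylor big_ord_recr/=; congr (_ + _).
by rewrite monomial_fact_deriv.
Qed.

(** Taylor's estimate without intermediate points: each [rho n.+1] is the primitive of [rho n]
    vanishing at 0, so a two-sided bound on [rho 0] is integrated n times, through monotonicity of
    [rho n.+1] and of [h]. The application takes for [rho n] the n-th remainder of the
    exponential. *)
Lemma iterated_primitive_bound (R : realType) (rho : nat -> R -> R) (M C : R) :
  (forall n (y : R), is_derive y 1 (rho n.+1) (rho n y)) ->
  (forall n, rho n.+1 0 = 0) ->
  (forall z, 0 <= z <= M -> 0 <= rho 0%N z <= C) ->
  forall n z, 0 <= z <= M -> 0 <= rho n z <= C * (z ^+ n / n`!%:R).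
Proof.
move=> drho rho0 rhoC; elim => [|n IH] z /andP[z0 zM].
  by rewrite expr0 divr1 mulr1 rhoC// z0.
have der1 (y : R) : (rho n.+1)^`()%classic y = rho n y.
  by rewrite derive1E; exact: derive_val.
pose h (y : R) := C * (y ^+ n.+1 / n.+1`!%:R) - rho n.+1 y.
have dh (y : R) : is_derive y 1 h (C * (y ^+ n / n`!%:R) - rho n y).
  rewrite (_ : h = (fun y => (C / n.+1`!%:R) * y ^+ n.+1) - rho n.+1); last first.
    by apply/funext => w; rewrite /h !fctE; ring.
  rewrite (_ : C * (y ^+ n / n`!%:R) = (C / n.+1`!%:R) * (n.+1%:R * y ^+ n)).
    apply: is_deriveB; exact: is_derive_monomial.
  by rewrite -mulrA monomial_fact_deriv.
have dh1 (y : R) : h^`()%classic y = C * (y ^+ n / n`!%:R) - rho n y.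
  by rewrite derive1E; exact: derive_val.
apply/andP; split.
  rewrite -(rho0 n).
  apply: (@ger0_derive1_le_cc _ (rho n.+1) 0 z); rewrite ?in_itv/= ?lexx ?z0 //.
  - move=> y; rewrite in_itv/= => /andP[y0 yz].
      have yM : 0 <= y <= M by rewrite (ltW y0) (le_trans (ltW yz)).
    by rewrite der1; have /andP[] := IH y yM.
  - apply: derivable_within_continuous => y _; exact: ex_derive.
rewrite -subr_ge0 -/(h z).
have -> : 0 = h 0 by rewrite /h rho0 expr0n/= mul0r mulr0 subr0.
apply: (@ger0_derive1_le_cc _ h 0 z); rewrite ?in_itv/= ?lexx ?z0 //.
- move=> y; rewrite in_itv/= => /andP[y0 yz].
  have yM : 0 <= y <= M by rewrite (ltW y0) (le_trans (ltW yz)).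
  by rewrite dh1 subr_ge0; have /andP[] := IH y yM.
- apply: derivable_within_continuous => y _; exact: ex_derive.
Qed.

(** An even number of terms makes the remainder nonnegative on both sides of 0. For negative [y] the
    reflected remainder is multiplied by (-1)^n, which restores the chain of primitives on the
    positive half-line; at n = 2m the sign disappears. *)
Lemma expR_taylor_even (R : realType) (m : nat) (y C : R) :
  `|y| <= C ->
  0 <= expR y - exp_taylor (2 * m) y <= expR C * (y ^+ (2 * m) / (2 * m)`!%:R).
Proof.
move=> yC.
have C0 : 0 <= C by rewrite (le_trans _ yC).
have t0 n : @exp_taylor R n.+1 0 = 1.
  rewrite /exp_taylor big_ord_recl /= expr0 divr1 big1 ?addr0// => i _.
  by rewrite expr0n/= mul0r.
have [y0|y0] := leP 0 y.
  pose rho n (z : R) := expR z - exp_taylor n z.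
  have := @iterated_primitive_bound R rho C (expR C) _ _ _ (2 * m)%N y.
  apply.
  - move=> n z; rewrite /rho.
    have d1 := @is_derive_exp_taylor R n z.
    rewrite [X in is_derive _ _ X _](_ : _ = expR - exp_taylor n.+1); last by [].
    exact: is_deriveB.
  - by move=> n; rewrite /rho expR0 t0 subrr.
  - move=> z /andP[z0 zC]; rewrite /rho /exp_taylor big_ord0 subr0 expR_ge0/=.
    by rewrite ler_expR.
  - by rewrite y0 -(ger0_norm y0).
pose rho n (z : R) := (-1) ^+ n * (expR (- z) - exp_taylor n (- z)).
have := @iterated_primitive_bound R rho C (expR C) _ _ _ (2 * m)%N (- y).
have s1 : (-1) ^+ (2 * m) = 1 :> R by rewrite exprM sqrrN !expr1n.
have -> : rho (2 * m)%N (- y) = expR y - exp_taylor (2 * m) y.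
  by rewrite /rho s1 mul1r opprK.
have -> : (- y) ^+ (2 * m) = y ^+ (2 * m) by rewrite exprNn s1 mul1r.
apply.
- move=> n z; rewrite /rho.
  have d1 : is_derive z 1 (fun z => expR (- z)) (- expR (- z)).
    apply: is_derive_eq; rewrite /GRing.scale/=; ring.
  have d0 := @is_derive_exp_taylor R n (- z).
  have d2 : is_derive z 1 (fun z => exp_taylor n.+1 (- z)) (- exp_taylor n (- z)).
    apply: is_derive_eq; rewrite /GRing.scale/=; ring.
  rewrite [X in is_derive _ _ X _](_ : _ = (-1) ^+ n.+1 *:
    ((fun z => expR (- z)) - (fun z => exp_taylor n.+1 (- z)))); last by [].
  apply: is_derive_eq; rewrite /GRing.scale/= exprS; ring.
- by move=> n; rewrite /rho oppr0 expR0 t0 subrr mulr0.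
- move=> z /andP[z0 zC]; rewrite /rho /exp_taylor big_ord0 subr0 expr0 mul1r expR_ge0/=.
  by rewrite ler_expR; lra.
- by rewrite oppr_ge0 (ltW y0) -(ltr0_norm y0).
Qed.


(** [F] is an explicit antiderivative: differentiating the truncated exponential drops its top term,
    and only that term survives against the derivative of exp(-s t). The value at [T] is nonpositive
    and is discarded, so the bound is the full integral over the half-line. *)
Lemma integral_pow_expR (R : realType) (k : nat) (s T : R) : 0 < s -> 0 < T ->
  (\int[@lebesgue_measure R]_(t in `[0%R, T]) (t ^+ k * expR (- (s * t)))%:E
   <= (k`!%:R / s ^+ k.+1)%:E)%E.
Proof.
move=> s0 T0.
pose F (t : R) := - (k`!%:R / s ^+ k.+1) * (expR (- (s * t)) * exp_taylor k.+1 (s * t)).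
have dF (t : R) : is_derive t 1 F (t ^+ k * expR (- (s * t))).
  have d0 := @is_derive_exp_taylor R k (s * t).
  have dm : is_derive t 1 (fun t : R => s * t) s.
    apply: (is_derive_eq (is_deriveZ s (is_derive_id t (1 : R)))).
    by rewrite /GRing.scale/= mulr1.
  have dn : is_derive t 1 (fun t : R => - (s * t)) (- s).
    exact: is_deriveN.
  have d1 : is_derive t 1 (fun t => expR (- (s * t))) (- s * expR (- (s * t))).
    by apply: is_derive_eq; rewrite /GRing.scale/= mulrC.
  have d2 : is_derive t 1 (fun t => exp_taylor k.+1 (s * t)) (s * exp_taylor k (s * t)).
    by apply: is_derive_eq; rewrite /GRing.scale/= mulrC.
  rewrite /F [X in is_derive _ _ X _](_ : _ = - (k`!%:R / s ^+ k.+1) *: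
    ((fun t => expR (- (s * t))) * (fun t => exp_taylor k.+1 (s * t)))); last by [].
  apply: is_derive_eq; rewrite /GRing.scale/=.
  have -> : exp_taylor k.+1 (s * t) = exp_taylor k (s * t) + (s * t) ^+ k / k`!%:R.
    by rewrite /exp_taylor big_ord_recr.
  have f0 : k`!%:R != 0 :> R by rewrite pnatr_eq0 -lt0n fact_gt0.
  have sk : s ^+ k != 0 by rewrite expf_neq0// gt_eqF.
  rewrite exprMn exprS; move: f0 sk; set a := k`!%:R; set b := s ^+ k => a0 b0.
  by field; rewrite a0 b0 gt_eqF.
have cF : continuous F.
  by move=> t; apply/differentiable_continuous/derivable1_diffP; exact: ex_derive.
rewrite (@continuous_FTC2 _ _ F)//.
- have t0 : @exp_taylor R k.+1 (s * 0) = 1.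
    rewrite mulr0 /exp_taylor big_ord_recl /= expr0 divr1 big1 ?addr0// => i _.
    by rewrite expr0n/= mul0r.
  rewrite -EFinB lee_fin /F t0 mulr0 oppr0 expR0 !mulr1 opprK gerDr mulNr oppr_le0.
  rewrite mulr_ge0// ?divr_ge0 ?exprn_ge0 ?(ltW s0)// mulr_ge0 ?expR_ge0//.
  by apply: sumr_ge0 => i _; rewrite divr_ge0// exprn_ge0// mulr_ge0// ltW.
- apply: continuous_subspaceT => t; apply: cvgM.
    exact: exprn_continuous.
  apply: continuous_comp; last exact: continuous_expR.
  by apply: cvgN; apply: cvgM; [exact: cvg_cst|exact: cvg_id].
- split.
  + by move=> t _; exact: ex_derive.
  + by apply: cvg_at_right_filter; exact: cF.
  + by apply: cvg_at_left_filter; exact: cF.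
- by move=> t _; rewrite derive1E; exact: derive_val.
Qed.

Lemma continuous_powR_gt0 (R : realType) (p x : R) : 0 < x ->
  {for x, continuous (fun y : R => y `^ p)}.
Proof.
move=> x0; apply/differentiable_continuous/derivable1_diffP.
by apply: derivable_powR; rewrite in_itv/= x0.
Qed.

(** For p < 1 the integrand is unbounded at 0, so the fundamental theorem is applied on intervals
    [a n, b] exhausting ]0, b], and monotone convergence is compared with the limit of the explicit
    values. *)
Lemma integral_powR_0r (R : realType) (p b : R) : 0 < p -> 0 < b ->
  (\int[@lebesgue_measure R]_(x in `]0%R, b]) (x `^ (p - 1))%:E = (b `^ p / p)%:E)%E.
Proof.
move=> p0 b0.
(* The denominators start at 2, so that [a n] is strictly below [b] already for n = 0. *)
pose a (n : nat) : R := b / n.+2%:R.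
have a0 n : 0 < a n by rewrite divr_gt0.
have ab n : a n < b.
  by rewrite /a ltr_pdivrMr// ltr_pMr// (ltr_nat _ 1).
have U : \bigcup_n `[a n, b]%classic = `]0, b]%classic.
  apply/seteqP; split => [x [n _]|x] /=; rewrite !in_itv/=.
    by move=> /andP[ax ->]; rewrite (lt_le_trans (a0 n)).
  move=> /andP[x0 xb].
  exists (Num.truncn (b / x)) => //=; rewrite in_itv/= xb andbT /a.
  rewrite ler_pdivrMr// mulrC -ler_pdivrMr//.
  by rewrite (le_trans (ltW (Num.Theory.truncnS_gt _)))// ler_nat.
have nd : {homo (fun n => `[a n, b]%classic) : n m / (n <= m)%N >-> (n <= m)%O}.
  move=> n k nk; apply/subsetPset => x/=; rewrite !in_itv/= => /andP[ax ->].
  by rewrite (le_trans _ ax)// /a ler_pM2l// lef_pV2 ?posrE// ler_nat !ltnS.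
have mp D : measurable_fun D (fun x : R => (x `^ (p - 1))%:E).
  by apply/measurable_EFinP; apply: measurable_funTS; exact: measurable_powR.
have : (\int[@lebesgue_measure R]_(x in `[a n, b]) (x `^ (p - 1))%:E)%E @[n --> \oo] -->
    (\int[@lebesgue_measure R]_(x in \bigcup_n `[a n, b]%classic) (x `^ (p - 1))%:E)%E.
  apply: ge0_nondecreasing_set_cvg_integral => //.
    by move=> i; exact: mp.
  by move=> i x _; rewrite lee_fin powR_ge0.
rewrite U => cv.
have E n : (\int[@lebesgue_measure R]_(x in `[a n, b]) (x `^ (p - 1))%:E =
   (b `^ p / p - a n `^ p / p)%:E)%E.
  rewrite (@continuous_FTC2 _ _ (fun x => x `^ p / p)) ?EFinB//.
  - apply: derivable_within_continuous => x; rewrite in_itv/= => /andP[ax _].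
    by apply: derivable_powR; rewrite in_itv/= (lt_le_trans (a0 n)).
  - have cF x : 0 < x -> {for x, continuous (fun y : R => y `^ p / p)}.
      by move=> x0; apply: cvgM; [exact: continuous_powR_gt0|exact: cvg_cst].
    split.
    + move=> x; rewrite in_itv/= => /andP[ax _].
      apply: derivableM => //; apply: derivable_powR.
      by rewrite in_itv/= (lt_trans (a0 n)).
    + by apply: cvg_at_right_filter; exact: cF.
    + by apply: cvg_at_left_filter; exact: cF.
  - move=> x; rewrite in_itv/= => /andP[ax _].
    have x0 : 0 < x by rewrite (lt_trans (a0 n)).
    have d0 := @is_derive1_powR R p x x0.
    rewrite derive1E.
    have d1 : is_derive x 1 (fun y : R => y `^ p / p) (x `^ (p - 1)).
      rewrite [X in is_derive _ _ X _](_ : _ = p^-1 *: (fun y : R => y `^ p)).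
        by apply: is_derive_eq; rewrite /GRing.scale/= mulKf// gt_eqF.
      by apply/funext => y; transitivity (p^-1 * y `^ p); rewrite // mulrC.
    exact: derive_val.
have cv2 : (b `^ p / p - a n `^ p / p)%:E @[n --> \oo] --> (b `^ p / p)%:E.
  apply: cvg_EFin; first by near=> n.
  rewrite -[X in _ --> X]subr0; apply: cvgB; first exact: cvg_cst.
  rewrite -[X in _ --> X](mul0r p^-1); apply: cvgM; last exact: cvg_cst.
  have ca : a n @[n --> \oo] --> (0 : R).
    rewrite -(mulr0 b); apply: cvgM; first exact: cvg_cst.
    by have := @cvg_harmonic R; rewrite -(cvg_shiftS).
  (* [powR_cvg0] is a right-hand limit at 0; positivity of every [a n] makes it applicable. *)
  apply: (@cvg_comp _ _ _ a (fun x => x `^ p) _ _ _ _ (powR_cvg0 p0)).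
  move=> A nA.
  have h : \forall n \near \oo, 0 < a n -> A (a n) := ca _ nA.
  by apply: filterS h => n h; apply: h; exact: a0.
move: cv; under eq_fun do rewrite E.
by move=> cv; rewrite -(cvg_lim _ cv)// -(cvg_lim _ cv2).
Unshelve. all: by end_near.
Qed.

(** The antiderivative -(x^(-q) / q) vanishes at infinity; this limit is read off from that of x^q
    at 0 through x -> 1/x. *)
Lemma integral_powR_ry (R : realType) (q a : R) : 0 < q -> 0 < a ->
  (\int[@lebesgue_measure R]_(x in `[a, +oo[) (x `^ (- q - 1))%:E = (a `^ (- q) / q)%:E)%E.
Proof.
move=> q0 a0.
have cF x : 0 < x -> {for x, continuous (fun y : R => - (y `^ (- q) / q))}.
  move=> x0; apply: cvgN; apply: cvgM; last exact: cvg_cst.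
  exact: continuous_powR_gt0.
rewrite (@ge0_continuous_FTC2y _ _ (fun x => - (x `^ (- q) / q)) _ 0).
- by rewrite sub0e EFinN oppeK.
- by move=> x _; exact: powR_ge0.
- apply/continuous_within_itvcyP; split.
    move=> x; rewrite in_itv/= andbT => ax.
    by apply: continuous_powR_gt0; exact: lt_trans ax.
  by apply: cvg_at_right_filter; exact: continuous_powR_gt0.
- rewrite -oppr0; apply: cvgN; rewrite -(mul0r q^-1); apply: cvgM; last exact: cvg_cst.
  apply: (@cvg_trans _ ((x^-1 `^ q) @[x --> +oo])).
    apply: near_eq_cvg; near=> x; rewrite powRN -powR_inv1; last by near: x; exact: nbhs_pinfty_ge.
    by rewrite powRAC powR_inv1// powR_ge0.
  apply: (@cvg_comp _ _ _ (fun x : R => x^-1) (fun x => x `^ q) _ _ _ _ (powR_cvg0 q0)).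
  have c0 : x^-1 @[x --> +oo] --> (0 : R).
    apply/gtr0_cvgV0; last exact: cvg_id.
    exact: nbhs_pinfty_gt.
  move=> A nA.
  have h1 : \forall x \near +oo%R, (0 : R) < x^-1 -> A x^-1 := c0 _ nA.
  have h2 : \forall x \near +oo%R, (0 : R) < x by exact: nbhs_pinfty_gt.
  by apply: filterS2 h1 h2 => x h x0; apply: h; rewrite invr_gt0.
- move=> x ax; apply: derivableN; apply: derivableM => //; apply: derivable_powR.
  by rewrite in_itv/= (lt_trans a0).
- by apply: cvg_at_right_filter; exact: cF.
- move=> x; rewrite in_itv/= andbT => ax.
  have x0 : 0 < x by rewrite (lt_trans a0).
  have d0 := @is_derive1_powR R (- q) x x0.
  rewrite derive1E.
  have d1 : is_derive x 1 (fun y : R => - (y `^ (- q) / q)) (x `^ (- q - 1)).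
    rewrite [X in is_derive _ _ X _](_ : _ = (- q^-1) *: (fun y : R => y `^ (- q))).
      by apply: is_derive_eq; rewrite /GRing.scale/= mulrA mulrNN mulVf ?mul1r// gt_eqF.
    apply/funext => y; transitivity ((- q^-1) * y `^ (- q)) => //.
    by rewrite mulNr mulrC.
  exact: derive_val.
Unshelve. all: by end_near.
Qed.

(** The central entry of row 2k is the sum of the two equal middle entries of row 2k - 1, and these
    are two terms of a sum equal to 2^(2k - 1). With the factor 2 on the left the inequality fails
    at k = 0. *)
Lemma central_bin_le (k : nat) : (0 < k)%N -> (2 * 'C(2 * k, k) <= 2 ^ (2 * k))%N.
Proof.
case: k => // k _.
have e : (2 * k.+1 = (2 * k).+2)%N by rewrite mulnS add2n.
have b1 : 'C((2 * k).+1, k.+1) = 'C((2 * k).+1, k).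
  by rewrite -bin_sub; [congr binomial; lia|lia].
rewrite e binS b1 addnn -mul2n mulnA expnS.
rewrite -mulnA leq_pmul2l//.
have := expnDn 1 1 (2 * k).+1.
have h1 : (k < (2 * k).+2)%N by lia.
have h2 : (k.+1 < (2 * k).+2)%N by lia.
rewrite (bigD1 (Ordinal h1))//= (bigD1 (Ordinal h2))/=; last first.
  by rewrite -val_eqE/= eqn_leq ltnn.
rewrite !exp1n !muln1 b1 add1n => ->.
by rewrite addnA addnn mul2n leq_addr.
Qed.

(** * Brownian increments and the Ito isometry *)

Lemma ge0_integralZl_EFinM d (T : measurableType d) (R : realType)
    (mu : {measure set T -> \bar R}) (D : set T) (f : T -> R) (k : R) :
  measurable D -> measurable_fun D f -> (forall x, D x -> 0 <= f x) -> 0 <= k ->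
  (\int[mu]_(x in D) (k * f x)%:E = k%:E * \int[mu]_(x in D) (f x)%:E)%E.
Proof.
move=> mD mf f0 k0; rewrite -ge0_integralZl//.
exact/measurable_EFinP.
Qed.

Lemma ge0_integralD_EFinD d (T : measurableType d) (R : realType)
    (mu : {measure set T -> \bar R}) (D : set T) (f g : T -> R) :
  measurable D -> measurable_fun D f -> measurable_fun D g ->
  (forall x, D x -> 0 <= f x) -> (forall x, D x -> 0 <= g x) ->
  (\int[mu]_(x in D) (f x + g x)%:E =
   \int[mu]_(x in D) (f x)%:E + \int[mu]_(x in D) (g x)%:E)%E.
Proof.
move=> mD mf mg f0 g0; rewrite -ge0_integralD//; exact/measurable_EFinP.
Qed.

(** Integration by parts on [0, n + 1], where x p(x) is the derivative of -s^2 p(x): the boundary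
    term vanishes in the limit, the remaining integral of p tends to 1/2 by symmetry, and evenness
    doubles the result. *)
Lemma integral_normal_pdf_sqr (R : realType) (s : R) : 0 < s ->
  (\int[@lebesgue_measure R]_x (x ^+ 2 * normal_pdf 0 s x)%:E = (s ^+ 2)%:E)%E.
Proof.
move=> s0.
have sn0 : s != 0 by rewrite gt_eqF.
have pE x : normal_pdf 0 s x = normal_peak s * expR (- (x ^+ 2) / (s ^+ 2 *+ 2)).
  by rewrite normal_pdfE// /normal_fun subr0.
have cp : continuous (normal_pdf 0 s) by exact: continuous_normal_pdf.
have sym x : normal_pdf 0 s (- x) = normal_pdf 0 s x by rewrite !pE sqrrN.
have dp (x : R) : is_derive x 1 (normal_pdf 0 s) (- (x / s ^+ 2) * normal_pdf 0 s x).
  have d1 : is_derive x 1 (fun x : R => - (x ^+ 2) / (s ^+ 2 *+ 2)) (- (x / s ^+ 2)).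
    have := is_derive_monomial (- (s ^+ 2 *+ 2)^-1) x 1.
    rewrite (_ : - (s ^+ 2 *+ 2)^-1 * _ = - (x / s ^+ 2)); last by field.
    by rewrite (_ : (fun z => _) = (fun x : R => - (x ^+ 2) / (s ^+ 2 *+ 2)))//;
      apply/funext => y; rewrite mulNr mulrC mulNr.
  rewrite [X in is_derive _ _ X _](_ : _ = normal_peak s *:
     (fun x : R => expR (- (x ^+ 2) / (s ^+ 2 *+ 2)))); last first.
    by apply/funext => y; rewrite pE.
  apply: is_derive_eq; rewrite pE /GRing.scale/=; ring.
pose f (x : R) := x ^+ 2 * normal_pdf 0 s x.
have cf : continuous f.
  by move=> x; apply: cvgM; [exact: exprn_continuous|exact: cp].
have f0 x : 0 <= f x by rewrite mulr_ge0 ?sqr_ge0 ?normal_pdf_ge0.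
have mp : measurable_fun [set: R] (normal_pdf 0 s) by exact: measurable_normal_pdf.
have mf : measurable_fun [set: R] f by exact: continuous_measurable_fun.
have half : (\int[@lebesgue_measure R]_(x in `[0%R, +oo[) (normal_pdf 0 s x)%:E = (2^-1)%:E)%E.
  have := ge0_symfun_integralT (normal_pdf_ge0 0 s) cp (fun x => esym (sym x)).
  rewrite integral_normal_pdf -set_itvcy => h.
  have : ((2^-1)%:E * 1 = (2^-1)%:E * (2%:E *
     \int[@lebesgue_measure R]_(x in `[0%R, +oo[) (normal_pdf 0 s x)%:E))%E by rewrite -h.
  by rewrite mule1 muleA -EFinM mulVf// mul1e => <-.
have E (n : nat) : (\int[@lebesgue_measure R]_(x in `[0%R, n.+1%:R]) (f x)%:E =
  (- (s ^+ 2 * n.+1%:R * normal_pdf 0 s n.+1%:R))%:E +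
  (s ^+ 2)%:E * \int[@lebesgue_measure R]_(x in `[0%R, n.+1%:R]) (normal_pdf 0 s x)%:E)%E.
  have dq (x : R) : is_derive x 1 (fun x => - (s ^+ 2) * normal_pdf 0 s x) (x * normal_pdf 0 s x).
    apply: (is_derive_eq (is_deriveZ (- (s ^+ 2)) (dp x))).
    rewrite /GRing.scale/=; move: (normal_pdf 0 s x) => p; by field.
  have cq : continuous (fun x => - (s ^+ 2) * normal_pdf 0 s x).
    by move=> x; apply: cvgM; [exact: cvg_cst|exact: cp].
  have := @integration_by_parts R id (fun x => - (s ^+ 2) * normal_pdf 0 s x) (cst 1)
    (fun x => x * normal_pdf 0 s x) 0 n.+1%:R.
  rewrite (_ : (fun x => (id x * (x * normal_pdf 0 s x))%:E) = (fun x => (f x)%:E)); last first.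
    by apply/funext => x; rewrite /f expr2 mulrA.
  move=> -> //.
  - rewrite mul0r subr0 mulrCA mulNr -mulrA; congr (_ + _)%E.
    rewrite -ge0_integralZl_EFinM//.
    + rewrite [X in (- X)%E](_ : _ = - \int[@lebesgue_measure R]_(x in `[0%R, n.+1%:R])
          (s ^+ 2 * normal_pdf 0 s x)%:E)%E ?oppeK//.
      rewrite -integral_ge0N; last first.
        by move=> x _; rewrite lee_fin mulr_ge0 ?sqr_ge0 ?normal_pdf_ge0.
      by apply: eq_integral => x _; rewrite mul1r mulNr EFinN.
    + exact: measurable_funTS.
    + by move=> x _; exact: normal_pdf_ge0.
    + exact: sqr_ge0.
  - exact/continuous_subspaceT/cst_continuous.
  - split=> //; [exact: cvg_at_right_filter|exact: cvg_at_left_filter].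
  - by move=> x _; rewrite derive1E derive_id.
  - apply: continuous_subspaceT => x; apply: cvgM; [exact: cvg_id|exact: cp].
  - split.
    + by move=> x _; exact: ex_derive.
    + by apply: cvg_at_right_filter; exact: cq.
    + by apply: cvg_at_left_filter; exact: cq.
  - by move=> x _; rewrite derive1E; exact: derive_val.
rewrite (ge0_symfun_integralT f0 cf); last by move=> x; rewrite /f/= sqrrN sym.
rewrite -set_itvcy.
have c1 := @ge0_cvgn_integral R (@lebesgue_measure R) f f0 mf.
have c2 := @ge0_cvgn_integral R (@lebesgue_measure R) _ (normal_pdf_ge0 0 s) mp.
rewrite half in c2.
have c3 : (n.+1%:R * normal_pdf 0 s n.+1%:R) @[n --> \oo] --> (0 : R).
  apply: (@squeeze_cvgr _ _ _ _ (fun=> 0)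
      (fun n => normal_peak s * (s ^+ 2 *+ 2) * harmonic n)).
  - near=> n; apply/andP; split; first by rewrite mulr_ge0// normal_pdf_ge0.
    rewrite pE mulrCA -mulrA ler_wpM2l ?normal_peak_ge0//.
    have n0 : (0 : R) < n.+1%:R by [].
    have y0 : 0 < n.+1%:R ^+ 2 / (s ^+ 2 *+ 2) by rewrite divr_gt0 ?exprn_gt0// mulrn_wgt0// exprn_gt0.
    (* From exp(-y) <= 1 / y the boundary term is at most a multiple of 1 / (n + 1). *)
    have : expR (- (n.+1%:R ^+ 2) / (s ^+ 2 *+ 2)) <= (n.+1%:R ^+ 2 / (s ^+ 2 *+ 2))^-1.
      rewrite mulNr expRN lef_pV2 ?posrE ?expR_gt0//.
      by rewrite (le_trans _ (expR_ge1Dx _))// lerDr.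
    rewrite -(ler_pM2l n0) => /le_trans; apply.
    rewrite invf_div /harmonic/= expr2 invfM mulrCA mulrA mulrA mulfK ?gt_eqF// mulrC.
  - exact: cvg_cst.
  - rewrite -(mulr0 (normal_peak s * (s ^+ 2 *+ 2))); apply: cvgM; first exact: cvg_cst.
    exact: cvg_harmonic.
have c4 : (\int[@lebesgue_measure R]_(x in `[0%R, n.+1%:R]) (f x)%:E @[n --> \oo] -->
   (- (s ^+ 2 * 0))%:E + (s ^+ 2)%:E * (2^-1)%:E)%E.
  under eq_fun do rewrite E.
  apply: cvgeD => //.
  - apply: cvg_EFin; first by near=> n.
    apply: cvgN; under eq_fun do rewrite -mulrA.
    by apply: cvgM => //; exact: cvg_cst.
  - apply: cvgeM => //; first by apply: cvg_cst.
    by rewrite (cvg_shiftS (fun n : nat => \int[@lebesgue_measure R]_(x in `[0%R, n%:R]) (normal_pdf 0 s x)%:E)%E).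
move: c1; rewrite -cvg_shiftS => c1.
rewrite -(cvg_lim _ c1)// (cvg_lim _ c4)// mulr0 oppr0 add0e -!EFinM.
by congr EFin; field.
Unshelve. all: by end_near.
Qed.

(** The Radon-Nikodym derivative of the normal law and its density have the same integral over every
    measurable set, hence agree almost everywhere. *)
Lemma ge0_integral_normal_prob (R : realType) (s : R) (f : R -> \bar R) :
  measurable_fun [set: R] f -> (forall x, (0 <= f x)%E) ->
  (\int[normal_prob 0%R s]_x f x =
   \int[@lebesgue_measure R]_x (f x * (normal_pdf 0 s x)%:E))%E.
Proof.
move=> mf f0.
have dom := @normal_prob_dominates R 0 s.
rewrite -(Radon_Nikodym_SigmaFinite.change_of_variables dom)//.
apply: ae_eq_integral => //.
- apply: emeasurable_funM => //; apply: (measurable_int (@lebesgue_measure R)).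
  exact: Radon_Nikodym_SigmaFinite.f_integrable.
- apply: emeasurable_funM => //; apply/measurable_EFinP; exact: measurable_normal_pdf.
- apply: ae_eqe_mul2l => /=.
  apply: integral_ae_eq => //=.
  + exact: Radon_Nikodym_SigmaFinite.f_integrable.
  + by apply/measurable_EFinP; exact: measurable_normal_pdf.
  + by move=> E _ mE; rewrite -Radon_Nikodym_SigmaFinite.f_integral.
Qed.

Lemma normal_prob_opp (R : realType) (s : R) (A : set R) : s != 0 -> measurable A ->
  normal_prob 0 s (-%R @^-1` A) = normal_prob 0 s A.
Proof.
move=> s0 mA; rewrite /normal_prob.
rewrite integral_mkcond [RHS]integral_mkcond.
have sym x : normal_pdf 0 s (- x) = normal_pdf 0 s x.
  by rewrite !normal_pdfE// /normal_fun !subr0 sqrrN.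
transitivity (\int[@lebesgue_measure R]_x
    ((fun x => (normal_pdf 0 s x)%:E) \_ A) ((-1) * x + 0)%R)%E.
  apply: eq_integral => x _; rewrite mulN1r addr0 !patchE.
  have -> : (x \in -%R @^-1` A) = (- x \in A) by apply/idP/idP => /set_mem h; exact/mem_set.
  by rewrite sym.
rewrite ge0_integral_affine ?normrN1 ?invr1 ?mul1e//.
- apply/(measurable_restrictT _ mA).
  apply/measurable_EFinP; apply: measurable_funTS; exact: measurable_normal_pdf.
- by move=> x; rewrite patchE; case: ifP => // _; rewrite lee_fin normal_pdf_ge0.
Qed.

(* A symmetric law for [Y] gives [(X, Y)] and [(X, - Y)] the same law. *)
Lemma integral_indep_sym d (T : measurableType d) (R : realType)
    (P : probability T R) (X Y : T -> R) :
  measurable_fun setT X -> measurable_fun setT Y ->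
  (forall A B : set R, measurable A -> measurable B ->
    P (X @^-1` A `&` Y @^-1` B) = (P (X @^-1` A) * P (Y @^-1` B))%E) ->
  (forall B : set R, measurable B -> P ((fun w => - Y w) @^-1` B) = P (Y @^-1` B)) ->
  P.-integrable setT (EFin \o (X \* Y)) ->
  (\int[P]_w (X w * Y w)%:E = 0)%E.
Proof.
move=> mX mY ind sym int.
have mXY : measurable_fun setT (fun w => (X w, Y w)) by exact/measurable_fun_pair.
have mY' : measurable_fun setT (fun w => - Y w) by exact: measurableT_comp.
have mXY' : measurable_fun setT (fun w => (X w, - Y w)) by exact/measurable_fun_pair.
pose f (z : R * R) : \bar R := (z.1 * z.2)%:E.
have mf : measurable_fun setT f.
  by apply/measurable_EFinP; apply: measurable_funM.
pose hX := isMeasurableFun.Build _ _ _ _ _ mX.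
pose hY := isMeasurableFun.Build _ _ _ _ _ mY.
pose X' : {RV P >-> R} := HB.pack X hX.
pose Y' : {RV P >-> R} := HB.pack Y hY.
have E (A : set (R * R)) : measurable A ->
    pushforward P (fun w => (X w, Y w)) A = pushforward P (fun w => (X w, - Y w)) A.
  move=> mA.
  rewrite -(@product_measure_unique _ _ _ _ _ (distribution P X') (distribution P Y')
     (measure_function_pushforward__canonical__measure_function_Measure P mXY))//.
  apply: (@product_measure_unique _ _ _ _ _ (distribution P X') (distribution P Y')
     (measure_function_pushforward__canonical__measure_function_Measure P mXY')) => //.
  move=> A1 A2 mA1 mA2.
  have mN : measurable ((fun x : R => - x) @^-1` A2).
    by rewrite -[X in measurable X]setTI; apply: measurable_funN.
  rewrite [LHS](_ : _ = P (X @^-1` A1 `&` Y @^-1` ((fun x : R => - x) @^-1` A2)))//.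
  by rewrite ind//; congr (_ * _)%E; exact: sym.
have int' : P.-integrable setT (f \o (fun w => (X w, - Y w))).
  have := integrableN int; apply: eq_integrable => // w _ /=.
  by rewrite /f/= mulrN EFinN.
have := integral_pushforward mXY (mu := P) (D := setT) mf int measurableT.
rewrite (eq_measure_integral (pushforward P (fun w => (X w, - Y w)))); last first.
  by move=> A mA _; exact: E.
rewrite (integral_pushforward mXY' (mu := P) (D := setT) mf int' measurableT).
rewrite !preimage_setT /= /f /=.
have -> : (\int[P]_x (X x * - Y x)%:E = - \int[P]_x (X x * Y x)%:E)%E.
  rewrite -integralN; last first.
    by apply: integrable_add_def.
  by apply: eq_integral => w _; rewrite mulrN EFinN.
have : (\int[P]_x (X x * Y x)%:E)%E \is a fin_num by apply: integrable_fin_num.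
case: (\int[P]_x (X x * Y x)%:E)%E => // r _ [rr]; congr EFin; lra.
Qed.

(** All other variables get the full line, whose probability 1 drops out of the product. *)
Lemma independent_rvs_pair d (Om : measurableType d) (R : realType)
    (P : probability Om R) (I : finType) (Z : I -> Om -> R) (a b : I) (A C : set R) :
  independent_rvs P Z -> a != b -> measurable A -> measurable C ->
  (P (Z a @^-1` A `&` Z b @^-1` C) = P (Z a @^-1` A) * P (Z b @^-1` C))%E.
Proof.
move=> ind ab mA mC.
pose F (i : I) : set R := if i == a then A else if i == b then C else setT.
have mF i : measurable (F i) by rewrite /F; case: ifP => // _; case: ifP.
have := ind F mF.
rewrite (bigD1 a)//= (bigD1 b)/=; last by rewrite eq_sym.
rewrite big1 ?mule1; last first.
  by move=> i /andP[ia ib]; rewrite /F (negbTE ia) (negbTE ib) preimage_setT probability_setT.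
rewrite /F eqxx eq_sym (negbTE ab) eqxx => <-; congr (P _).
apply/seteqP; split => [w [wa wb] i _ /=|w h].
  by have [->//|_] := eqVneq i a; have [->//|_] := eqVneq i b.
split; first by have := h a Logic.I; rewrite /F /= eqxx.
by have := h b Logic.I; rewrite /F /= eq_sym (negbTE ab) eqxx.
Qed.

Lemma integrable_mul_sqr d (T : measurableType d) (R : realType)
    (mu : {measure set T -> \bar R}) (D : set T) (X Y : T -> R) :
  measurable D -> measurable_fun D X -> measurable_fun D Y ->
  (\int[mu]_(w in D) (X w ^+ 2)%:E < +oo)%E -> (\int[mu]_(w in D) (Y w ^+ 2)%:E < +oo)%E ->
  mu.-integrable D (fun w => (X w * Y w)%:E).
Proof.
move=> mD mX mY iX iY.
apply: (@le_integrable _ _ _ _ _ mD _ (fun w => (X w ^+ 2 + Y w ^+ 2)%:E)).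
- by apply/measurable_EFinP; exact: measurable_funM.
- move=> w Dw /=; rewrite lee_fin normrM [leRHS]ger0_norm ?addr_ge0 ?sqr_ge0//.
  rewrite -(real_normK (num_real (X w))) -(real_normK (num_real (Y w))).
  have := sqr_ge0 (`|X w| - `|Y w|); have := normr_ge0 (X w); have := normr_ge0 (Y w).
  nra.
- apply/integrableP; split.
    by apply/measurable_EFinP; apply: measurable_funD; exact: measurable_funX.
  under eq_integral do rewrite gee0_abs ?lee_fin ?addr_ge0 ?sqr_ge0//.
  rewrite ge0_integralD_EFinD//; [|exact: measurable_funX|exact: measurable_funX|..].
  + by rewrite lte_add_pinfty.
  + by move=> w _; exact: sqr_ge0.
  + by move=> w _; exact: sqr_ge0.
Qed.

Lemma integral_mul_sums d (T : measurableType d) (R : realType)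
    (mu : {measure set T -> \bar R}) (D : set T) (I : finType)
    (X : I -> T -> R) (c : I -> R) (K : I -> I -> R) :
  measurable D ->
  (forall p q, mu.-integrable D (fun w => (X p w * X q w)%:E)) ->
  (forall p q, \int[mu]_(w in D) (X p w * X q w)%:E = (K p q)%:E)%E ->
  (\int[mu]_(w in D) ((\sum_p c p * X p w) ^+ 2)%:E =
   (\sum_p \sum_q c p * c q * K p q)%:E)%E.
Proof.
move=> mD iX iK.
have E w : ((\sum_p c p * X p w) ^+ 2)%:E =
    (\sum_(z <- index_enum (prod I I)) (c z.1 * c z.2)%:E * (X z.1 w * X z.2 w)%:E)%E.
  rewrite expr2 big_distrlr /= pair_bigA /= -sumEFin; apply: eq_bigr => z _.
  by rewrite -EFinM; congr EFin; ring.
under eq_integral do rewrite E.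
rewrite integral_sum//; last by move=> z; apply: integrableZl => //; exact: iX.
rewrite pair_bigA /= -sumEFin; apply: eq_bigr => z _.
by rewrite integralZl// iK -EFinM.
Qed.

Section Brownian.
Context d (Om : measurableType d) (R : realType) (P : probability Om R).
Context (D : nat) (B : R -> Om -> 'cV[R]_D) (bmB : brownian_motion P B).

Lemma measurable_increment s t (i : 'I_D) : 0 <= s -> 0 <= t ->
  measurable_fun setT (fun w => (B t w - B s w) i 0).
Proof.
move=> s0 t0; have [mB _ _ _ _] := bmB.
under eq_fun do rewrite !mxE.
by apply: measurable_funB; apply: mB.
Qed.

Lemma integral_increment_sqr s t (i : 'I_D) : 0 <= s -> s <= t ->
  (\int[P]_w (((B t w - B s w) i 0) ^+ 2)%:E = (t - s)%:E)%E.
Proof.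
move=> s0; rewrite le_eqVlt => /predU1P[->|st].
  rewrite subrr integral0_eq// => w _.
  by rewrite subrr mxE expr0n.
have [_ _ _ law _] := bmB.
have mZ : measurable_fun setT (fun w => (B t w - B s w) i 0 : measurableTypeR R).
  exact: (measurable_increment i s0 (le_trans s0 (ltW st))).
have mf : measurable_fun [set: R] (fun x : R => (x ^+ 2)%:E).
  by apply/measurable_EFinP; exact: measurable_funX.
have := ge0_integral_pushforward mZ P (D := setT) (f := fun x : R => (x ^+ 2)%:E)
  measurableT mf (fun x _ => sqr_ge0 x).
rewrite preimage_setT /= => <-.
transitivity (\int[normal_prob 0 (Num.sqrt (t - s))]_y (y ^+ 2)%:E)%E.
  by apply: eq_measure_integral => A mA _; exact: (law s t i s0 st A mA).
rewrite ge0_integral_normal_prob//; last by move=> x; rewrite lee_fin sqr_ge0.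
under eq_integral do rewrite -EFinM.
rewrite integral_normal_pdf_sqr ?sqrtr_gt0 ?subr_gt0//.
by rewrite sqr_sqrtr// subr_ge0 ltW.
Qed.

Lemma increment_symmetric s t (i : 'I_D) (A : set R) : 0 <= s -> s <= t -> measurable A ->
  P ((fun w => - (B t w - B s w) i 0) @^-1` A) = P ((fun w => (B t w - B s w) i 0) @^-1` A).
Proof.
move=> s0 + mA; rewrite le_eqVlt => /predU1P[->|st].
  by congr (P _); apply/seteqP; split => w /=; rewrite subrr mxE oppr0.
have [_ _ _ law _] := bmB.
have mN : measurable ((fun x : R => - x) @^-1` A).
  by rewrite -[X in measurable X]setTI; apply: measurable_funN.
rewrite law// -(normal_prob_opp _ mA) ?gt_eqF ?sqrtr_gt0 ?subr_gt0//.
by rewrite -(law s t i s0 st _ mN).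
Qed.

Lemma integrable_increment_mul s t s' t' (i j : 'I_D) :
  0 <= s -> s <= t -> 0 <= s' -> s' <= t' ->
  P.-integrable setT (fun w => ((B t w - B s w) i 0 * (B t' w - B s' w) j 0)%:E).
Proof.
move=> s0 st s0' st'; apply: integrable_mul_sqr => //.
- by apply: measurable_increment => //; exact: le_trans st.
- by apply: measurable_increment => //; exact: le_trans st'.
- by rewrite integral_increment_sqr// ltry.
- by rewrite integral_increment_sqr// ltry.
Qed.

(** Independence is available for successive increments along one partition, so both increments are
    placed on 0 <= s <= t, encoded by [u] (constantly [t] from index 2 on). The product integrates
    to 0 by symmetry of the law of the second factor. *)
Lemma integral_increment_cross s t (k l : 'I_2) (i j : 'I_D) : 0 <= s -> s <= t ->
  (k, i) != (l, j) ->
  let u (k : nat) : R := if k == 0%N then 0 else if k == 1%N then s else t in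
  (\int[P]_w ((B (u k.+1) w - B (u k) w) i 0 * (B (u l.+1) w - B (u l) w) j 0)%:E = 0)%E.
Proof.
move=> s0 st kl u.
have [_ _ ind _ _] := bmB.
have u0 n : 0 <= u n by case: n => [|[|n]] //=; exact: le_trans st.
have um n : u n <= u n.+1 by case: n => [|[|n]] //=.
have {}ind := ind 2%N u (u0 0%N) (fun n _ => um n).
apply: integral_indep_sym.
- exact: measurable_increment.
- exact: measurable_increment.
- move=> A C mA mC.
  exact: (independent_rvs_pair ind kl).
- by move=> A mA; apply: increment_symmetric.
- exact: integrable_increment_mul.
Qed.

(** The later position is [B s - B 0] plus an increment over [s, t]; the cross term vanishes, and
    for i = j only the variance of the first part remains. *)
Lemma brownian_covariance_le s t (i j : 'I_D) : 0 <= s -> s <= t ->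
  (\int[P]_w ((B s w - B 0 w) i 0 * (B t w - B 0 w) j 0)%:E = ((i == j)%:R * s)%:E)%E.
Proof.
move=> s0 st.
have E w : ((B s w - B 0 w) i 0 * (B t w - B 0 w) j 0)%:E =
  (((B s w - B 0 w) i 0 * (B s w - B 0 w) j 0)%:E +
   ((B s w - B 0 w) i 0 * (B t w - B s w) j 0)%:E)%E.
  by rewrite -EFinD !mxE; congr EFin; ring.
under eq_integral do rewrite E.
rewrite integralD//; [|exact: integrable_increment_mul..].
have ne : ((0 : 'I_2), i) != (1, j) by rewrite xpair_eqE.
rewrite (integral_increment_cross s0 st ne) /= adde0.
have [->|ij] := eqVneq i j.
  rewrite mul1r -[in RHS](subr0 s) -(@integral_increment_sqr 0 s j)//.
have ne' : ((0 : 'I_2), i) != (0, j) by rewrite xpair_eqE/=.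
by rewrite (integral_increment_cross s0 st ne') mul0r.
Qed.

Lemma brownian_covariance s t (i j : 'I_D) : 0 <= s -> 0 <= t ->
  (\int[P]_w ((B s w - B 0 w) i 0 * (B t w - B 0 w) j 0)%:E =
   ((i == j)%:R * Num.min s t)%:E)%E.
Proof.
move=> s0 t0; have [st|ts] := leP s t; first exact: brownian_covariance_le.
rewrite eq_sym -(brownian_covariance_le j i t0 (ltW ts)).
by apply: eq_integral => w _; rewrite mulrC.
Qed.

Lemma sqr_frobnorm (p q : nat) (A : 'M[R]_(p, q)) :
  frobnorm A ^+ 2 = \sum_i \sum_j A i j ^+ 2.
Proof.
rewrite /frobnorm sqr_sqrtr//; apply: sumr_ge0 => i _; apply: sumr_ge0 => j _.
exact: sqr_ge0.
Qed.

Lemma integral_indic_itv_mul (T s t : R) : 0 <= s <= T -> 0 <= t <= T ->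
  (@lebesgue_measure R).-integrable `[0, T] (fun x => (\1_(`]0, s]) x * \1_(`]0, t]) x)%:E) /\
  (\int[@lebesgue_measure R]_(x in `[0%R, T]) (\1_(`]0%R, s]) x * \1_(`]0%R, t]) x)%:E =
   (Num.min s t)%:E)%E.
Proof.
move=> /andP[s0 sT] /andP[t0 tT].
have m0 : 0 <= Num.min s t by rewrite le_min s0.
have E x : (\1_(`]0, s]) x * \1_(`]0, t]) x)%:E =
    (\1_(`]0, Num.min s t]%classic) x)%:E :> \bar R.
  rewrite !indicE -natrM mulnb; congr (_%:R%:E).
  congr (nat_of_bool _); apply/andP/idP.
    move=> [] /set_mem /=; rewrite in_itv/= => /andP[x0 xs] /set_mem/=.
    rewrite in_itv/= => /andP[_ xt]; apply/mem_set => /=; rewrite in_itv/= x0 le_min xs.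
    by [].
  move=> /set_mem/=; rewrite in_itv/= le_min => /andP[x0 /andP[xs xt]].
  by split; apply/mem_set => /=; rewrite in_itv/= x0.
split.
  rewrite (_ : (fun x => _) = EFin \o (\1_(`]0, Num.min s t]%classic) : R -> R)); last first.
    by apply/funext => x; exact: E.
  by apply: (integrableS measurableT) => //; exact: integrable_indic_itv.
under eq_integral do rewrite E.
rewrite integral_indic// setIidl.
  transitivity (@lebesgue_measure R `]0, Num.min s t]) => //.
  by rewrite lebesgue_measure_itv/= lte_fin; case: ltgtP m0 => // [_ _|<- _]; rewrite ?oppr0 ?adde0.
move=> x /=; rewrite !in_itv/= => /andP[x0 xm]; rewrite (ltW x0)/=.
by rewrite (le_trans xm)// ge_min sT.
Qed.

(** Both sides expand into the same quadratic form in the entries of [V]: the Gram matrix of the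
    Brownian positions and that of the indicators of ]0, tau p] are both min(tau p, tau q), and
    distinct coordinates of [B] are uncorrelated. The times may come in any order and may repeat. *)
Lemma brownian_isometry (T : R) (I : finType) (V : I -> 'M[R]_D) (tau : I -> R) :
  (forall p, 0 <= tau p <= T) ->
  (\int[P]_w (frobnorm (\sum_p V p *m (B (tau p) w - B 0%R w)) ^+ 2)%:E =
   \int[@lebesgue_measure R]_(s in `[0%R, T])
     (frobnorm (\sum_p (\1_(`]0%R, tau p]) s : R) *: V p) ^+ 2)%:E)%E.
Proof.
move=> tauT.
have tau0 p : 0 <= tau p by have /andP[] := tauT p.
transitivity (\sum_i \sum_j \sum_p \sum_q V p i j * V q i j * Num.min (tau p) (tau q))%:E.
  under eq_integral => w _.
    rewrite sqr_frobnorm -sumEFin.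
    under eq_bigr => i _.
      rewrite big_ord1 summxE.
      under eq_bigr do rewrite mxE.
      rewrite pair_bigA/=.
      over.
    over.
  rewrite ge0_integral_sum//; last 2 first.
    move=> i; apply/measurable_EFinP; apply: measurable_funX.
    apply: measurable_sum => x; apply: measurable_funM => //.
    exact: measurable_increment.
    by move=> i w _; rewrite lee_fin sqr_ge0.
  rewrite -sumEFin; apply: eq_bigr => i _.
  rewrite (integral_mul_sums (X := fun x w => (B (tau x.1) w - B 0 w) x.2 0)
    (K := fun x y => (x.2 == y.2)%:R * Num.min (tau x.1) (tau y.1))
    (fun x => V x.1 i x.2))//; last 2 first.
  - by move=> x y; exact: integrable_increment_mul.
  - by move=> x y; exact: brownian_covariance.
  congr EFin; rewrite -(pair_bigA _ (fun p j => \sum_q V p i j * V q.1 i q.2 *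
    ((j == q.2)%:R * Num.min (tau p) (tau q.1))))/= exchange_big/=.
  apply: eq_bigr => j _; apply: eq_bigr => p _.
  rewrite -(pair_bigA _ (fun q k => V p i j * V q i k *
    ((j == k)%:R * Num.min (tau p) (tau q))))/=.
  apply: eq_bigr => q _.
  rewrite (bigD1 j)//= eqxx mul1r big1 ?addr0// => k kj.
  by rewrite eq_sym (negbTE kj) mul0r mulr0.
apply/esym.
have E s : (frobnorm (\sum_p (\1_(`]0%R, tau p]) s : R) *: V p) ^+ 2)%:E =
    (\sum_(x <- index_enum (prod 'I_D 'I_D))
      ((\sum_p V p x.1 x.2 * \1_(`]0%R, tau p]) s) ^+ 2)%:E)%E.
  rewrite sqr_frobnorm pair_bigA/= -sumEFin; apply: eq_bigr => x _.
  by rewrite summxE; congr ((_ ^+ 2)%:E); apply: eq_bigr => p _; rewrite mxE mulrC.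
under eq_integral do rewrite E.
rewrite ge0_integral_sum//; last 2 first.
  move=> x; apply/measurable_EFinP; apply: measurable_funX.
  apply: measurable_sum => p; apply: measurable_funM => //.
  by move=> x s _; rewrite lee_fin sqr_ge0.
rewrite pair_bigA/= -sumEFin; apply: eq_bigr => x _.
have := @integral_mul_sums _ _ R (@lebesgue_measure R) `[0, T] I
  (fun p (s : R) => \1_(`]0, tau p]) s : R) (fun p => V p x.1 x.2)
  (fun p q => Num.min (tau p) (tau q)).
apply => //.
- by move=> p q; have [] := integral_indic_itv_mul (tauT p) (tauT q).
- by move=> p q; have [] := integral_indic_itv_mul (tauT p) (tauT q).
Qed.

End Brownian.

(** The weight [e] stays free: a small [e] keeps the factor of the main term near 1, at the price of
    a large factor on a term that will tend to 0. *)
Lemma sqr_frobnormD (R : realType) (p q : nat) (e : R) (A C : 'M[R]_(p, q)) : 0 < e ->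
  frobnorm (A + C) ^+ 2 <= (1 + e) * frobnorm A ^+ 2 + (1 + e^-1) * frobnorm C ^+ 2.
Proof.
move=> e0; rewrite !sqr_frobnorm !mulr_sumr -big_split /=; apply: ler_sum => i _.
rewrite !mulr_sumr -big_split /=; apply: ler_sum => j _; rewrite mxE.
have := sqr_ge0 (e * A i j - C i j); rewrite -(@pmulr_rge0 _ e^-1) ?invr_gt0//.
have -> : e^-1 * (e * A i j - C i j) ^+ 2 =
    e * A i j ^+ 2 + e^-1 * C i j ^+ 2 - 2 * (A i j * C i j).
  by field; rewrite gt_eqF.
by move: (A i j) (C i j) => x y; nra.
Qed.

Lemma frobnormN (R : realType) (p q : nat) (A : 'M[R]_(p, q)) : frobnorm (- A) = frobnorm A.
Proof.
by rewrite /frobnorm; congr Num.sqrt; apply: eq_bigr => i _; apply: eq_bigr => j _;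
  rewrite mxE sqrrN.
Qed.

Lemma frobnormZ (R : realType) (p q : nat) (c : R) (A : 'M[R]_(p, q)) :
  frobnorm (c *: A) ^+ 2 = c ^+ 2 * frobnorm A ^+ 2.
Proof.
rewrite !sqr_frobnorm mulr_sumr; apply: eq_bigr => i _.
by rewrite mulr_sumr; apply: eq_bigr => j _; rewrite mxE exprMn.
Qed.

Lemma measurable_sqr_frobnorm d (T : measurableType d) (R : realType) (D : set T)
    (p q : nat) (F : T -> 'M[R]_(p, q)) :
  (forall i j, measurable_fun D (fun x => F x i j)) ->
  measurable_fun D (fun x => frobnorm (F x) ^+ 2).
Proof.
move=> mF; under eq_fun do rewrite sqr_frobnorm.
by apply: measurable_sum => i; apply: measurable_sum => j; exact: measurable_funX.
Qed.

Lemma step_time_le (R : realType) (D : nat) (t : R) (phi : step_integrand D t) (k l : nat) :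
  (k <= l)%N -> (l <= step_size phi)%N -> step_time phi k <= step_time phi l.
Proof.
move=> kl; rewrite -(subnK kl) addnC; elim: (l - k)%N => [|i IH]; first by rewrite addn0.
rewrite addnS => h; apply: (le_trans (IH (ltnW h))); exact: step_time_mono.
Qed.

Lemma step_time_itv (R : realType) (D : nat) (t : R) (phi : step_integrand D t) (k : nat) :
  (k <= step_size phi)%N -> 0 <= step_time phi k <= t.
Proof.
move=> h; have := step_time_le h (leqnn _); have := step_time_le (leq0n k) h.
by rewrite step_time0 step_time_size => -> ->.
Qed.

Section ItoIsometry.
Context d (Om : measurableType d) (R : realType) (P : probability Om R).
Context (D : nat) (B : R -> Om -> 'cV[R]_D) (bmB : brownian_motion P B).
Context (T : R).

(** A difference of two step integrands becomes one family over intervals ]0, tau]: each step enters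
    through its right endpoint ([true]) and, with opposite sign, its left endpoint ([false]), and
    all signs are reversed for [psi]. *)
Let idx (phi psi : step_integrand D T) : finType :=
  (('I_(step_size phi) * bool) + ('I_(step_size psi) * bool))%type.

Let coef (phi psi : step_integrand D T) (x : idx phi psi) : 'M[R]_D :=
  match x with
  | inl (k, c) => (-1) ^+ (~~ c) *: step_value phi k
  | inr (k, c) => (-1) ^+ c *: step_value psi k
  end.

Let time (phi psi : step_integrand D T) (x : idx phi psi) : R :=
  match x with
  | inl (k, c) => step_time phi (k + c)
  | inr (k, c) => step_time psi (k + c)
  end.

Let sum_idx (V : nmodType) (phi psi : step_integrand D T) (F : idx phi psi -> V) :
  \sum_x F x = \sum_(k < step_size phi) (F (inl (k, true)) + F (inl (k, false))) +
               \sum_(k < step_size psi) (F (inr (k, true)) + F (inr (k, false))).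
Proof.
rewrite big_sumType/=; congr (_ + _).
  transitivity (\sum_(p : 'I_(step_size phi) * bool) F (inl (p.1, p.2))).
    by apply: eq_bigr => -[].
  rewrite -(pair_bigA _ (fun k c => F (inl (k, c))))/=.
  by apply: eq_bigr => k _; rewrite big_bool.
transitivity (\sum_(p : 'I_(step_size psi) * bool) F (inr (p.1, p.2))).
    by apply: eq_bigr => -[].
  rewrite -(pair_bigA _ (fun k c => F (inr (k, c))))/=.
by apply: eq_bigr => k _; rewrite big_bool.
Qed.

Lemma indic_itv_oc (a b s : R) : 0 <= a -> a <= b ->
  (\1_(`]a, b]) s : R) = \1_(`]0, b]) s - \1_(`]0, a]) s.
Proof.
move=> a0 ab; rewrite !indicE.
have E (u v : R) : (s \in `]u, v]%classic) = (u < s <= v).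
  by apply/idP/idP => [/set_mem|h]; rewrite ?mem_set//= in_itv.
rewrite !E; case: (ltP 0 s) => s0 /=.
  case: (ltP a s) => sa; last by rewrite (le_trans sa ab) subrr.
  by rewrite subr0.
by rewrite ltNge (le_trans s0 a0) subrr.
Qed.

Lemma ito_isometry_step (phi psi : step_integrand D T) :
  (\int[P]_w (frobnorm (step_integral phi B w - step_integral psi B w) ^+ 2)%:E =
   \int[@lebesgue_measure R]_(s in `[0%R, T])
     (frobnorm (step_fun phi s - step_fun psi s) ^+ 2)%:E)%E.
Proof.
have tT (x : idx phi psi) : 0 <= time x <= T.
  case: x => [[k c]|[k c]] /=; apply: step_time_itv; case: c;
    rewrite ?addn1 ?addn0 ?ltn_ord//; exact: ltnW (ltn_ord k).
have := brownian_isometry bmB (@coef phi psi) tT.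
have -> : (fun w => (frobnorm (\sum_p coef p *m (B (@time phi psi p) w - B 0 w)) ^+ 2)%:E) =
  (fun w => (frobnorm (step_integral phi B w - step_integral psi B w) ^+ 2)%:E).
  apply/funext => w; congr ((frobnorm _ ^+ 2)%:E); rewrite sum_idx /step_integral -sumrN.
  congr (_ + _); apply: eq_bigr => k _ /=.
    rewrite addn1 addn0 expr0 expr1 scale1r scaleN1r mulNmx -mulmxN -mulmxDr.
    by congr (_ *m _); rewrite opprB addrA subrK.
  rewrite addn1 addn0 expr0 expr1 scale1r scaleN1r mulNmx -mulmxN -mulmxDr -mulmxN.
  by congr (_ *m _); rewrite !opprB addrC addrA subrK.
move=> ->.
have -> : (fun s => (frobnorm (\sum_p (\1_(`]0%R, @time phi psi p]) s : R) *: coef p) ^+ 2)%:E) =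
  (fun s => (frobnorm (step_fun phi s - step_fun psi s) ^+ 2)%:E).
  apply/funext => s; congr ((frobnorm _ ^+ 2)%:E); rewrite sum_idx /step_fun -sumrN.
  have t0 (f : step_integrand D T) (k : 'I_(step_size f)) : 0 <= step_time f k.
    by have /andP[] := step_time_itv (ltnW (ltn_ord k)).
  congr (_ + _); apply: eq_bigr => k _ /=.
    rewrite addn1 addn0 expr0 expr1 scale1r scaleN1r scalerN -scalerBl.
    by rewrite -indic_itv_oc//; exact: step_time_mono.
  rewrite addn1 addn0 expr0 expr1 scale1r scaleN1r scalerN.
  have tk : step_time psi k <= step_time psi k.+1 by exact: step_time_mono.
  by rewrite (indic_itv_oc s (t0 psi k) tk) scalerBl opprB addrC.
by [].
Qed.

Lemma measurable_step_fun (phi : step_integrand D T) (E : set R) i j :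
  measurable_fun E (fun s => step_fun phi s i j).
Proof.
under eq_fun do rewrite summxE.
apply: measurable_sum => k; under eq_fun do rewrite mxE.
by apply: measurable_funM => //; apply: measurable_funTS; exact: measurable_indic.
Qed.

Lemma measurable_step_integral (phi : step_integrand D T) :
  random_vector (step_integral phi B).
Proof.
have [mB _ _ _ _] := bmB.
move=> i; under eq_fun do rewrite summxE.
apply: measurable_sum => k; under eq_fun do rewrite mxE.
apply: measurable_sum => j; apply: measurable_funM => //.
apply: (measurable_increment bmB).
  by have /andP[] := step_time_itv (ltnW (ltn_ord k)).
by have /andP[] := step_time_itv (ltn_ord k).
Qed.

End ItoIsometry.

Lemma ge0_integral_sqr_frobnormD d (T : measurableType d) (R : realType)
    (mu : {measure set T -> \bar R}) (D : set T) (p q : nat) (e : R)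
    (F G : T -> 'M[R]_(p, q)) :
  measurable D -> 0 < e ->
  (forall i j, measurable_fun D (fun x => F x i j)) ->
  (forall i j, measurable_fun D (fun x => G x i j)) ->
  (\int[mu]_(x in D) (frobnorm (F x + G x) ^+ 2)%:E <=
   (1 + e)%:E * \int[mu]_(x in D) (frobnorm (F x) ^+ 2)%:E +
   (1 + e^-1)%:E * \int[mu]_(x in D) (frobnorm (G x) ^+ 2)%:E)%E.
Proof.
move=> mD e0 mF mG.
have mF2 := measurable_sqr_frobnorm mF.
have mG2 := measurable_sqr_frobnorm mG.
have e1 : 0 <= 1 + e by rewrite addr_ge0// ltW.
have e2 : 0 <= 1 + e^-1 by rewrite addr_ge0// invr_ge0 ltW.
rewrite -!ge0_integralZl_EFinM//; [|by move=> x _; exact: sqr_ge0..].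
rewrite -ge0_integralD_EFinD//; last 4 first.
- exact: measurable_funM.
- exact: measurable_funM.
- by move=> x _; rewrite mulr_ge0// sqr_ge0.
- by move=> x _; rewrite mulr_ge0// sqr_ge0.
apply: ge0_le_integral => //.
- by move=> x _; rewrite lee_fin sqr_ge0.
- apply/measurable_EFinP; apply: measurable_sqr_frobnorm => i j.
  by under eq_fun do rewrite mxE; exact: measurable_funD.
- by apply/measurable_EFinP; apply: measurable_funD; exact: measurable_funM.
- by move=> x _; rewrite lee_fin; exact: sqr_frobnormD.
Qed.

(** Limit of the upper bound that arises when the isometry is carried to Ito integrals, with k = 1 +
    e and l = 1 + 1/e: the approximation errors vanish, and [C] keeps the factor of two weighted
    inequalities. *)
Lemma cvge_nested_sum (R : realType) (k l C : R) (u v u' v' : nat -> \bar R) :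
  (u q @[q --> \oo] --> 0)%E -> (v q @[q --> \oo] --> 0)%E ->
  (u' q @[q --> \oo] --> 0)%E -> (v' q @[q --> \oo] --> 0)%E ->
  (k%:E * (k%:E * C%:E + l%:E * (2%:E * u q + 2%:E * v q)) +
      l%:E * (2%:E * u' q + 2%:E * v' q) @[q --> \oo] --> (k ^+ 2 * C)%:E)%E.
Proof.
have c1 (s t : nat -> \bar R) : (s q @[q --> \oo] --> 0)%E -> (t q @[q --> \oo] --> 0)%E ->
    (l%:E * (2%:E * s q + 2%:E * t q) @[q --> \oo] --> 0)%E.
  move=> hs ht; rewrite -(mule0 l%:E) -[X in (_ * X)%E]adde0 -{1 2}(mule0 2%:E).
  have c2 (w : nat -> \bar R) : (w q @[q --> \oo] --> 0)%E ->
      (2%:E * w q @[q --> \oo] --> 2%:E * 0)%E by move=> hw; apply: cvgeZl.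
  by apply: cvgeZl => //; apply: cvgeD; [rewrite mule0|exact: c2|exact: c2].
move=> hu hv hu' hv'; have h1 := c1 _ _ hu hv; have h2 := c1 _ _ hu' hv'.
rewrite (_ : (k ^+ 2 * C)%:E = (k%:E * (k%:E * C%:E + 0) + 0)%E); last first.
  by rewrite !adde0 -!EFinM mulrA -expr2.
apply: cvgeD => //; apply: cvgeZl => //; apply: cvgeD => //; exact: cvg_cst.
Qed.

(** The exact isometry is used only for the difference of two step integrals. From there U - V is
    reached on the probability side and f - g on the time side, with errors controlled by the two
    approximating sequences; each passage costs a factor 1 + e. *)
Lemma ito_isometry_le d (Om : measurableType d) (R : realType) (P : probability Om R)
    (D : nat) (B : R -> Om -> 'cV[R]_D) (T : R) (f g : R -> 'M[R]_D)
    (U V : Om -> 'cV[R]_D) (C : R) :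
  brownian_motion P B ->
  (forall i j, measurable_fun `[0, T] (fun s => f s i j)) ->
  (forall i j, measurable_fun `[0, T] (fun s => g s i j)) ->
  is_ito_integral P B T f U -> is_ito_integral P B T g V ->
  (\int[@lebesgue_measure R]_(s in `[0%R, T]) (frobnorm (f s - g s) ^+ 2)%:E <= C%:E)%E ->
  (\int[P]_w (frobnorm (U w - V w) ^+ 2)%:E <= C%:E)%E.
Proof.
move=> bmB mf mg [mU [phi [phif phiU]]] [mV [psi [psig psiV]]] fgC.
have mcol (Z : Om -> 'cV[R]_D) : random_vector Z ->
    forall i j, measurable_fun setT (fun w => Z w i j).
  by move=> mZ i j; rewrite ord1; exact: mZ.
have msub d' (T' : measurableType d') (E : set T') p q (F G : T' -> 'M[R]_(p, q)) :
    (forall i j, measurable_fun E (fun x => F x i j)) ->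
    (forall i j, measurable_fun E (fun x => G x i j)) ->
    forall i j, measurable_fun E (fun x => (F x - G x) i j).
  by move=> mF mG i j; under eq_fun do rewrite !mxE; exact: measurable_funB.
have mS := fun q => mcol _ (measurable_step_integral bmB (phi q)).
have mS' := fun q => mcol _ (measurable_step_integral bmB (psi q)).
have mU' := mcol _ mU; have mV' := mcol _ mV.
pose nP (F : Om -> 'cV[R]_D) := (\int[P]_w (frobnorm (F w) ^+ 2)%:E)%E.
pose nL (F : R -> 'M[R]_D) :=
  (\int[@lebesgue_measure R]_(s in `[0%R, T]) (frobnorm (F s) ^+ 2)%:E)%E.
pose UV w := U w - V w.
pose a q := nP (fun w => U w - step_integral (phi q) B w).
pose b q := nP (fun w => V w - step_integral (psi q) B w).
pose a' q := nL (fun s => f s - step_fun (phi q) s).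
pose b' q := nL (fun s => g s - step_fun (psi q) s).
have a0 : (a q @[q --> \oo] --> 0)%E by move: phiU; rewrite unlock.
have b0 : (b q @[q --> \oo] --> 0)%E by move: psiV; rewrite unlock.
have a0' : (a' q @[q --> \oo] --> 0)%E := phif.
have b0' : (b' q @[q --> \oo] --> 0)%E := psig.
have LD (F G : R -> 'M[R]_D) (e : R) : 0 < e ->
    (forall i j, measurable_fun `[0, T] (fun s => F s i j)) ->
    (forall i j, measurable_fun `[0, T] (fun s => G s i j)) ->
    (nL (fun s => (F s + G s)%R) <= (1 + e)%:E * nL F + (1 + e^-1)%:E * nL G)%E.
  by move=> e0 mF mG; apply: ge0_integral_sqr_frobnormD.
have LN (F : R -> 'M[R]_D) : nL (fun s => (- F s)%R) = nL F.
  by apply: eq_integral => s _; rewrite frobnormN.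
have PN (F : Om -> 'cV[R]_D) : nP (fun s => (- F s)%R) = nP F.
  by apply: eq_integral => s _; rewrite frobnormN.
have C0 : 0 <= C.
  by rewrite -lee_fin (le_trans _ fgC)// integral_ge0// => x _; rewrite lee_fin sqr_ge0.
have key (e : R) : 0 < e -> (nP UV <= ((1 + e) ^+ 2 * C)%:E)%E.
  move=> e0.
  pose k := 1 + e; pose l := 1 + e^-1.
  have k0 : 0 <= k by rewrite addr_ge0// ltW.
  have l0 : 0 <= l by rewrite addr_ge0// invr_ge0 ltW.
  have nge0 F : (0 <= nP F)%E by apply: integral_ge0 => x _; rewrite lee_fin sqr_ge0.
  have lge0 F : (0 <= nL F)%E by apply: integral_ge0 => x _; rewrite lee_fin sqr_ge0.
  have bound q : (nP UV <=
      k%:E * (k%:E * C%:E + l%:E * (2%:E * a' q + 2%:E * b' q)) +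
      l%:E * (2%:E * a q + 2%:E * b q))%E.
    pose S w := step_integral (phi q) B w; pose S' w := step_integral (psi q) B w.
    have -> : nP UV =
        nP (fun w => (S w - S' w) + ((U w - S w) + (- (V w - S' w)))).
      by congr nP; apply/funext => w; rewrite /UV;
        move: (U w) (V w) (S w) (S' w) => *; apply/matrixP => i j; rewrite !mxE; ring.
    have mneg d' (T' : measurableType d') (E : set T') p' q' (F : T' -> 'M[R]_(p', q')) :
        (forall i j, measurable_fun E (fun x => F x i j)) ->
        forall i j, measurable_fun E (fun x => (- F x) i j).
      by move=> mF i j; under eq_fun do rewrite mxE; exact: measurable_funN.
    have madd d' (T' : measurableType d') (E : set T') p' q' (F G : T' -> 'M[R]_(p', q')) :
        (forall i j, measurable_fun E (fun x => F x i j)) ->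
        (forall i j, measurable_fun E (fun x => G x i j)) ->
        forall i j, measurable_fun E (fun x => (F x + G x) i j).
      by move=> mF mG i j; under eq_fun do rewrite mxE; exact: measurable_funD.
    have mSS := msub _ _ _ _ _ _ _ (mS q) (mS' q).
    have mUS := msub _ _ _ _ _ _ _ mU' (mS q).
    have mVS := mneg _ _ _ _ _ _ (msub _ _ _ _ _ _ _ mV' (mS' q)).
    have mfg := msub _ _ _ _ _ _ _ mf mg.
    have mfs := mneg _ _ _ _ _ _
      (msub _ _ _ _ _ _ _ mf (@measurable_step_fun _ _ _ (phi q) `[0, T]%classic)).
    have mgs := msub _ _ _ _ _ _ _ mg (@measurable_step_fun _ _ _ (psi q) `[0, T]%classic).
    apply: (le_trans (ge0_integral_sqr_frobnormD _ measurableT e0 mSS (madd _ _ _ _ _ _ _ mUS mVS))).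
    apply: leeD.
      rewrite lee_wpmul2l ?lee_fin//.
      rewrite (ito_isometry_step bmB (phi q) (psi q)).
      have -> : (fun s => (frobnorm (step_fun (phi q) s - step_fun (psi q) s) ^+ 2)%:E) =
        (fun s => (frobnorm ((f s - g s) + ((g s - step_fun (psi q) s) +
            (- (f s - step_fun (phi q) s)))) ^+ 2)%:E).
        apply/funext => s; congr ((frobnorm _ ^+ 2)%:E).
        move: (f s) (g s) (step_fun (phi q) s) (step_fun (psi q) s) => *.
        by apply/matrixP => i j; rewrite !mxE; ring.
      apply: (le_trans (LD _ _ _ e0 mfg (madd _ _ _ _ _ _ _ mgs mfs))).
      apply: leeD; first by rewrite lee_wpmul2l ?lee_fin.
      rewrite lee_wpmul2l ?lee_fin// addeC.
      apply: (le_trans (LD _ _ _ ltr01 mgs mfs)).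
      by rewrite invr1 (LN (fun s => f s - step_fun (phi q) s)%R) addeC.
    rewrite lee_wpmul2l ?lee_fin//.
    apply: (le_trans (ge0_integral_sqr_frobnormD _ measurableT ltr01 mUS mVS)).
    by rewrite invr1 [X in (_ + _ * X <= _)%E](PN (fun w => V w - S' w)%R).
  have lim0 := @cvge_nested_sum R k l C _ _ _ _ a0' b0' a0 b0.
  rewrite -(cvg_lim _ lim0)//; apply: lime_ge; first by apply/cvg_ex; eexists; exact: lim0.
  by near=> q; exact: bound.
apply/lee_addgt0Pr => e e0.
have [C00|Cn] := eqVneq C 0.
  have := key 1 ltr01; rewrite C00 mulr0 add0e => /le_trans; apply.
  by rewrite lee_fin ltW.
have Cp : 0 < C by rewrite lt_neqAle eq_sym Cn.
(* The cut at 1 gives (1 + u)^2 <= 1 + 3 u, and the other bound gives 3 u C <= e. *)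
pose u := Num.min 1 (e / (3 * C)).
have u0 : 0 < u by rewrite lt_min ltr01 divr_gt0// mulr_gt0.
apply: (le_trans (key _ u0)); rewrite -EFinD lee_fin.
have u1 : u <= 1 by rewrite ge_min lexx.
have u2 : u * (3 * C) <= e by rewrite -ler_pdivlMr ?mulr_gt0// ge_min lexx orbT.
nra.
Unshelve. all: by end_near.
Qed.

(** * The kernel as a Laplace transform *)

Lemma expRN_le_sqr (R : realType) (y : R) : 0 < y -> expR (- y) <= 2 / y ^+ 2.
Proof.
move=> y0; rewrite expRN -invf_div lef_pV2 ?posrE ?expR_gt0 ?divr_gt0 ?exprn_gt0//.
by have := expR_ge1Dxn 1 (ltW y0); rewrite /= => h; apply: le_trans h; rewrite lerDr.
Qed.

(** Below 1 the power alone is integrable since p > 0; above 1 it is at most 1 since p <= 1, and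
    exp(-x t) <= 2 / (x t)^2. This range of [p] covers both H + 1/2 and 1/2 - H. *)
Lemma integral_gamma_lty (R : realType) (p t : R) : 0 < p <= 1 -> 0 < t ->
  (\int[@lebesgue_measure R]_(x in `]0%R, +oo[) (x `^ (p - 1) * expR (- (x * t)))%:E < +oo)%E.
Proof.
move=> /andP[p0 p1] t0.
pose f (x : R) := x `^ (p - 1) * expR (- (x * t)).
have f0 x : 0 <= f x by rewrite mulr_ge0 ?powR_ge0 ?expR_ge0.
have mf : measurable_fun setT f.
  apply: measurable_funM; first exact: measurable_powR.
  by apply: measurableT_comp => //; apply: measurableT_comp => //; exact: measurable_funM.
have mf' D : measurable_fun D (EFin \o f) by apply/measurable_EFinP; exact: measurable_funTS.
have -> : `]0, +oo[%classic = `]0, 1]%classic `|` `]1, +oo[%classic :> set R.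
  by rewrite -itv_bndbnd_setU// bnd_simp.
rewrite ge0_integral_setU//=; last 2 first.
- by move=> x _; rewrite lee_fin f0.
- apply/disj_setPS => x [] /=; rewrite !in_itv/= andbT => /andP[_ x1].
  by rewrite ltNge x1.
rewrite lte_add_pinfty//.
  apply: (@le_lt_trans _ _ (\int[@lebesgue_measure R]_(x in `]0%R, 1%R]) (x `^ (p - 1))%:E)%E).
    apply: ge0_le_integral => //=.
    - by move=> x _; rewrite lee_fin f0.
    - exact: mf'.
    - by apply/measurable_EFinP; apply: measurable_funTS; exact: measurable_powR.
    - move=> x; rewrite in_itv/= => /andP[x0 _]; rewrite lee_fin.
      rewrite ler_piMr ?powR_ge0// -expR0 ler_expR oppr_le0 mulr_ge0// ltW//.
  by rewrite integral_powR_0r// ltry.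
apply: (@le_lt_trans _ _ (\int[@lebesgue_measure R]_(x in `[1%R, +oo[) ((2 / t ^+ 2) * (x `^ (- 1 - 1)))%:E)%E).
  rewrite -integral_itv_obnd_cbnd; last first.
    apply/measurable_EFinP; apply: measurable_funM => //.
    by apply: measurable_funTS; exact: measurable_powR.
  apply: ge0_le_integral => //=.
  - by move=> x _; rewrite lee_fin f0.
  - exact: mf'.
  - apply/measurable_EFinP; apply: measurable_funM => //.
    by apply: measurable_funTS; exact: measurable_powR.
  - move=> x; rewrite in_itv/= andbT => x1; rewrite lee_fin.
    have x0 : 0 < x by rewrite (lt_trans ltr01).
    apply: (@le_trans _ _ (expR (- (x * t)))).
      rewrite ler_piMl ?expR_ge0// -[leRHS](powRr0 x) ler_powR ?(ltW x1)//.
      by rewrite subr_le0.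
    apply: (le_trans (expRN_le_sqr _)); first by rewrite mulr_gt0.
    rewrite -opprD -[1 + 1]/(2%:R) powR_invn ?(ltW x0)// exprMn invfM.
    by rewrite -!mulrA [x ^- 2 * _]mulrC.
rewrite ge0_integralZl_EFinM//.
- by rewrite integral_powR_ry// lte_mul_pinfty// ?lee_fin ?ltry// divr_ge0// sqr_ge0.
- by apply: measurable_funTS; exact: measurable_powR.
- by move=> x _; exact: powR_ge0.
- by rewrite divr_ge0// sqr_ge0.
exact: mf'.
Qed.

(** Substitution x -> t x. The half-line is carried by the restriction [gr], so that the affine
    change of variables on the whole line applies. *)
Lemma integral_gamma_scale (R : realType) (p t : R) : 0 < t ->
  (\int[@lebesgue_measure R]_(x in `]0%R, +oo[) (x `^ (p - 1) * expR (- (x * t)))%:E =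
   (t `^ (- p))%:E *
   \int[@lebesgue_measure R]_(x in `]0%R, +oo[) (x `^ (p - 1) * expR (- x))%:E)%E.
Proof.
move=> t0.
pose g (x : R) := (x `^ (p - 1) * expR (- x))%:E.
have mg : measurable_fun setT g.
  apply/measurable_EFinP; apply: measurable_funM; first exact: measurable_powR.
  by apply: measurableT_comp => //; exact: measurableT_comp.
have g0 x : (0 <= g x)%E by rewrite lee_fin mulr_ge0 ?powR_ge0 ?expR_ge0.
rewrite [in RHS]integral_mkcond.
pose gr : R -> \bar R := g \_ `]0, +oo[%classic.
have mgr : measurable_fun setT gr.
  apply/(measurable_restrictT _ (measurable_itv _)); exact: measurable_funTS.
have gr0 (x : R) : (0 <= gr x)%E by rewrite /gr patchE; case: ifP.
have := @ge0_integral_affine R t 0 gr.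
rewrite gt_eqF// gtr0_norm// => /(_ isT mgr gr0) h.
have -> : (t `^ (- p) = t `^ (- (p - 1)) * t^-1).
  rewrite -powR_inv1 ?(ltW t0)// -powRD; first by congr powR; ring.
  by rewrite (gt_eqF t0) implybT.
rewrite EFinM -muleA -h -ge0_integralZl//; last 2 first.
- apply: (measurableT_comp mgr).
  by apply: measurable_funD => //; exact: measurable_funM.
- by rewrite lee_fin powR_ge0.
rewrite [LHS]integral_mkcond; apply: eq_integral => x _; rewrite /gr !patchE addr0.
have -> : (t * x \in `]0, +oo[%classic) = (x \in `]0, +oo[%classic).
  by apply/idP/idP => /set_mem/=; rewrite in_itv/= andbT ?pmulr_rgt0// => x0;
    apply/mem_set => /=; rewrite in_itv/= andbT// mulr_gt0.
case: ifPn => [/set_mem/=|_]; last by rewrite mule0.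
rewrite in_itv/= andbT => x0; rewrite /g -EFinM; congr EFin.
rewrite powRM ?(ltW x0) ?(ltW t0)// mulrA mulrA powRN mulVf ?mul1r ?gt_eqF ?powR_gt0//.
by rewrite mulrC [t * x]mulrC mulrC.
Qed.

(** [Gamma] is a real-valued integral, hence read off through [fine], which sends an infinite value
    to a default one; finiteness is the content here. *)
Lemma Gamma_fin (R : realType) (p : R) : 0 < p <= 1 ->
  (\int[@lebesgue_measure R]_(x in `]0%R, +oo[) (x `^ (p - 1) * expR (- x))%:E = (Gamma p)%:E)%E.
Proof.
move=> p01; rewrite /Gamma /Rintegral fineK// ge0_fin_numE.
  have -> : (\int[@lebesgue_measure R]_(x in `]0%R, +oo[) (x `^ (p - 1) * expR (- x))%:E =
      \int[@lebesgue_measure R]_(x in `]0%R, +oo[) (x `^ (p - 1) * expR (- (x * 1)))%:E)%E.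
    by apply: eq_integral => x _; rewrite mulr1.
  exact: integral_gamma_lty.
by apply: integral_ge0 => x _; rewrite lee_fin mulr_ge0 ?powR_ge0 ?expR_ge0.
Qed.

Lemma Gamma_ge0 (R : realType) (p : R) : 0 <= Gamma p.
Proof. by apply: Rintegral_ge0 => x _; rewrite mulr_ge0 ?powR_ge0 ?expR_ge0. Qed.

Lemma Gamma_gt0 (R : realType) (p : R) : 0 < p <= 1 -> 0 < Gamma p.
Proof.
move=> /andP[p0 p1]; rewrite -lte_fin -Gamma_fin ?p0//.
pose f (x : R) := x `^ (p - 1) * expR (- x).
have mf : measurable_fun setT f.
  apply: measurable_funM; first exact: measurable_powR.
  by apply: measurableT_comp => //; exact: measurableT_comp.
have f0 x : 0 <= f x by rewrite mulr_ge0 ?powR_ge0 ?expR_ge0.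
apply: (@lt_le_trans _ _ (\int[@lebesgue_measure R]_(x in `]0%R, 1%R]) (f x)%:E)%E); last first.
  apply: ge0_subset_integral => //.
  - by apply/measurable_EFinP; exact: measurable_funTS.
  - by move=> x _; rewrite lee_fin f0.
  - by move=> x /=; rewrite !in_itv/= andbT => /andP[].
apply: (@lt_le_trans _ _ (\int[@lebesgue_measure R]_(x in `]0%R, 1%R]) (expR (- 1) * x `^ (p - 1))%:E)%E).
  rewrite ge0_integralZl_EFinM ?expR_ge0//.
  - by rewrite integral_powR_0r// -EFinM lte_fin mulr_gt0 ?expR_gt0// divr_gt0// powR1.
  - by apply: measurable_funTS; exact: measurable_powR.
  - by move=> x _; exact: powR_ge0.
apply: ge0_le_integral => //.
- by move=> x _; rewrite lee_fin mulr_ge0 ?powR_ge0 ?expR_ge0.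
- apply/measurable_EFinP; apply: measurable_funM => //.
  by apply: measurable_funTS; exact: measurable_powR.
- by apply/measurable_EFinP; exact: measurable_funTS.
- move=> x /=; rewrite in_itv/= => /andP[_ x1]; rewrite lee_fin /f mulrC.
  by rewrite ler_wpM2l ?powR_ge0// ler_expR lerN2.
Qed.

Lemma cH_ge0 (R : realType) (H : R) : 0 <= cH H.
Proof. by rewrite invr_ge0 mulr_ge0// Gamma_ge0. Qed.

Lemma wH_ge0 (R : realType) (H x : R) : 0 <= wH H x.
Proof. by rewrite mulr_ge0 ?cH_ge0 ?powR_ge0. Qed.

Lemma measurable_wH (R : realType) (H : R) : measurable_fun setT (wH H).
Proof. by apply: measurable_funM => //; exact: measurable_powR. Qed.

Lemma measurable_expR_mulr (R : realType) (t : R) :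
  measurable_fun setT (fun x : R => expR (- (x * t))).
Proof.
by apply: measurableT_comp => //; apply: measurableT_comp => //; exact: measurable_funM.
Qed.

Lemma integrable_kernel (R : realType) (H t : R) : 0 < H < 2^-1 -> 0 < t ->
  (@lebesgue_measure R).-integrable `]0, +oo[ (fun x => (expR (- (x * t)) * wH H x)%:E).
Proof.
move=> /andP[H0 H1] t0.
have p01 : 0 < 2^-1 - H <= 1 by apply/andP; split; lra.
have E x : expR (- (x * t)) * wH H x = cH H * (x `^ (2^-1 - H - 1) * expR (- (x * t))).
  by rewrite /wH (_ : - H - 2^-1 = 2^-1 - H - 1); [ring|field].
apply/integrableP; split.
  apply/measurable_EFinP; apply: measurable_funTS.
  by apply: measurable_funM; [exact: measurable_expR_mulr|exact: measurable_wH].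
have -> : (\int[@lebesgue_measure R]_(x in `]0%R, +oo[) `|(expR (- (x * t)) * wH H x)%:E| =
   \int[@lebesgue_measure R]_(x in `]0%R, +oo[)
     (cH H * (x `^ (2^-1 - H - 1) * expR (- (x * t))))%:E)%E.
  by apply: eq_integral => x _; rewrite -E gee0_abs// lee_fin mulr_ge0 ?expR_ge0 ?wH_ge0.
rewrite ge0_integralZl_EFinM ?cH_ge0//.
- by rewrite lte_mul_pinfty ?lee_fin ?cH_ge0//; exact: integral_gamma_lty.
- apply: measurable_funTS; apply: measurable_funM; last exact: measurable_expR_mulr.
  exact: measurable_powR.
- by move=> x _; rewrite mulr_ge0 ?powR_ge0 ?expR_ge0.
Qed.

(** The Gamma integral at p = 1/2 - H, rescaled by t, produces Gamma(1/2 - H) t^(H - 1/2); [cH]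
    cancels the first factor and leaves 1 / Gamma(H + 1/2). *)
Lemma kernelG_integral (R : realType) (H t : R) : 0 < H < 2^-1 -> 0 < t ->
  kernelG H t = \int[@lebesgue_measure R]_(x in `]0, +oo[) (expR (- (x * t)) * wH H x).
Proof.
move=> H01 t0; have /andP[H0 H1] := H01.
have p01 : 0 < 2^-1 - H <= 1 by apply/andP; split; lra.
have E x : expR (- (x * t)) * wH H x = cH H * (x `^ (2^-1 - H - 1) * expR (- (x * t))).
  by rewrite /wH (_ : - H - 2^-1 = 2^-1 - H - 1); [ring|field].
rewrite /Rintegral; under eq_integral do rewrite E.
rewrite ge0_integralZl_EFinM ?cH_ge0//; last 2 first.
- apply: measurable_funTS; apply: measurable_funM; last exact: measurable_expR_mulr.
  exact: measurable_powR.
- by move=> x _; rewrite mulr_ge0 ?powR_ge0 ?expR_ge0.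
rewrite integral_gamma_scale// Gamma_fin//= opprB /kernelG /cH invfM.
have G0 := Gamma_gt0 p01.
move: (Gamma (H + 2^-1))^-1 => a; by field; rewrite gt_eqF.
Qed.

(** * Gaussian quadrature error *)

(** The weight is nonincreasing on the positive axis because H + 1/2 >= 0, so its value at the left
    end times the length dominates its mass. *)
Lemma integral_wH_le (R : realType) (H u v : R) : - 2^-1 <= H -> 0 < u -> u < v ->
  (@lebesgue_measure R).-integrable `[u, v] (EFin \o wH H) /\
  \int[@lebesgue_measure R]_(y in `[u, v]) wH H y <= cH H * u `^ (- H - 2^-1) * (v - u).
Proof.
move=> H0 u0 uv.
have le y : u <= y -> wH H y <= cH H * u `^ (- H - 2^-1).
  move=> uy; rewrite ler_wpM2l ?cH_ge0// -opprD !powRN.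
  rewrite lef_pV2 ?posrE ?powR_gt0//; last exact: lt_le_trans uy.
  have H1 : 0 <= H + 2^-1 by lra.
  by rewrite ge0_ler_powR// nnegrE ?(ltW u0)// (le_trans (ltW u0)).
have ic : (@lebesgue_measure R).-integrable `[u, v]
    (EFin \o (cst (cH H * u `^ (- H - 2^-1)) : R -> R)).
  apply: continuous_compact_integrable; first exact: segment_compact.
  by apply: continuous_subspaceT; exact: cst_continuous.
have iw : (@lebesgue_measure R).-integrable `[u, v] (EFin \o wH H).
  apply: le_integrable ic => //.
    by apply/measurable_EFinP; apply: measurable_funTS; exact: measurable_wH.
  move=> y /=; rewrite in_itv/= => /andP[uy _]; rewrite lee_fin ger0_norm ?wH_ge0//.
  by rewrite ger0_norm ?le// mulr_ge0 ?cH_ge0 ?powR_ge0.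
split => //.
apply: (@le_trans _ _ (\int[@lebesgue_measure R]_(y in `[u, v]) (cH H * u `^ (- H - 2^-1)))).
  by apply: le_Rintegral => // y /=; rewrite in_itv/= => /andP[uy _]; exact: le.
have h : @lebesgue_measure R `[u, v] = (v - u)%:E.
  by rewrite lebesgue_measure_itv/= lte_fin uv.
rewrite Rintegral_cst// (_ : fine _ = v - u)//; exact: (congr1 fine h).
Qed.

(** The Taylor polynomial at [c], with [n] terms, of y -> exp(-y t). As a composition with an affine
    polynomial it inherits its size bound from the truncated exponential. *)
Definition taylor_poly (R : realType) (n : nat) (c t : R) : {poly R} :=
  expR (- (c * t)) *: ((\poly_(k < n) (k`!%:R^-1)) \Po ((c * t)%:P - t *: 'X)).

Lemma horner_taylor_poly (R : realType) (n : nat) (c t y : R) :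
  (taylor_poly n c t).[y] = expR (- (c * t)) * exp_taylor n ((c - y) * t).
Proof.
rewrite /taylor_poly hornerZ horner_comp horner_poly /exp_taylor.
rewrite !hornerE; congr (_ * _); apply: eq_bigr => k _; rewrite mulrC; congr (_ ^+ _ * _).
by ring.
Qed.

Lemma size_taylor_poly (R : realType) (n : nat) (c t : R) : (0 < n)%N ->
  (size (taylor_poly n c t) <= n)%N.
Proof.
move=> n0; apply: (leq_trans (size_scale_leq _ _)); apply: (leq_trans (size_comp_poly_leq _ _)).
have h1 := size_poly n (fun k => k`!%:R^-1 : R).
have h2 : (size ((c * t)%:P - t *: 'X)%R <= 2)%N.
  rewrite (leq_trans (size_polyD _ _))// geq_max size_polyC size_polyN.
  by rewrite (leq_trans (leq_b1 _))//= (leq_trans (size_scale_leq _ _))// size_polyX.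
by move: h1 h2; set s1 := size _; set s2 := size _ => h1 h2; nia.
Qed.

(** Factoring out exp(-c t) at the midpoint leaves exp((c - y) t) with |c - y| at most the
    half-length h; the crude factor exp(h t) of the Taylor estimate recombines with exp(-c t) into
    the decaying exp(-u t). *)
Lemma taylor_poly_error (R : realType) (m : nat) (u v t y : R) : u <= y <= v -> 0 <= t ->
  0 <= expR (- (y * t)) - (taylor_poly (2 * m) ((u + v) / 2) t).[y] <=
  expR (- (u * t)) * (((v - u) / 2 * t) ^+ (2 * m) / (2 * m)`!%:R).
Proof.
move=> /andP[uy yv] t0; rewrite horner_taylor_poly.
set c := (u + v) / 2; set h := (v - u) / 2.
have yc : `|c - y| <= h by rewrite ler_norml /c /h; lra.
have yt : `|(c - y) * t| <= h * t by rewrite normrM (ger0_norm t0) ler_wpM2r.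
have /andP[h1 h2] := expR_taylor_even m yt.
have -> : expR (- (y * t)) - expR (- (c * t)) * exp_taylor (2 * m) ((c - y) * t) =
    expR (- (c * t)) * (expR ((c - y) * t) - exp_taylor (2 * m) ((c - y) * t)).
  by rewrite mulrBr -expRD; congr (expR _ - _); ring.
rewrite mulr_ge0 ?expR_ge0//=.
apply: (@le_trans _ _ (expR (- (c * t)) * (expR (h * t) *
    (((c - y) * t) ^+ (2 * m) / (2 * m)`!%:R)))).
  by rewrite ler_wpM2l ?expR_ge0.
rewrite mulrA -expRD (_ : - (c * t) + h * t = - (u * t)); last by rewrite /c /h; field.
rewrite ler_wpM2l ?expR_ge0// ler_wpM2r ?invr_ge0//.
rewrite exprM [leRHS]exprM lerXn2r ?nnegrE ?sqr_ge0//.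
by rewrite -real_normK ?num_real// lerXn2r ?nnegrE// (le_trans _ yt).
Qed.

Lemma ler_dist_ge0 (R : realDomainType) (p q r : R) :
  0 <= p -> p <= r -> 0 <= q -> q <= r -> `|p - q| <= r.
Proof. by move=> p0 pr q0 qr; rewrite ler_norml; apply/andP; split; lra. Qed.

(** Exactness on [Q] cancels the polynomial part. What is left is the integral and the quadrature
    sum of the same [delta], each between 0 and [M * W]; since both are nonnegative, their
    difference is bounded by [M * W] and not by twice that. *)
Lemma gauss_rule_error (R : realType) (H t u v : R) (m : nat) (x eta : 'I_m -> R) :
  - 2^-1 <= H -> 0 < u -> u < v -> 0 <= t -> (0 < m)%N ->
  is_gauss_rule u v (wH H) x eta ->
  `|\int[@lebesgue_measure R]_(y in `[u, v]) (expR (- (y * t)) * wH H y) -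
    \sum_(k < m) eta k * expR (- (x k * t))| <=
  expR (- (u * t)) * (((v - u) / 2 * t) ^+ (2 * m) / (2 * m)`!%:R) *
  (cH H * u `^ (- H - 2^-1) * (v - u)).
Proof.
move=> H0 u0 uv t0 m0 [_ xuv eta0 quad].
have [iw iwle] := integral_wH_le H0 u0 uv.
pose W := \int[@lebesgue_measure R]_(y in `[u, v]) wH H y; rewrite -/W in iwle.
set M := expR (- (u * t)) * (((v - u) / 2 * t) ^+ (2 * m) / (2 * m)`!%:R).
pose Q := taylor_poly (2 * m) ((u + v) / 2) t.
have m20 : (0 < 2 * m)%N by rewrite muln_gt0.
have QE := quad Q (size_taylor_poly _ _ m20).
(* Exactness on the constant 1: the weights of the rule add up to the mass of [wH]. *)
have WE : W = \sum_(k < m) eta k.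
  have := quad 1; rewrite size_poly1 => /(_ m20).
  have -> : \int[@lebesgue_measure R]_(y in `[u, v]) ((1 : {poly R}).[y] * wH H y) = W.
    by rewrite /W; apply: eq_Rintegral => y _; rewrite hornerC mul1r.
  by move=> ->; apply: eq_bigr => k _; rewrite hornerE mulr1.
pose delta (y : R) := expR (- (y * t)) - Q.[y].
have dM y : u <= y <= v -> 0 <= delta y <= M by move=> uyv; exact: taylor_poly_error.
have mQ : measurable_fun setT (fun y : R => Q.[y]).
  under eq_fun do rewrite horner_taylor_poly.
  apply: measurable_funM => //; apply: measurable_sum => k; apply: measurable_funM => //.
  by apply: measurable_funX; apply: measurable_funM => //; exact: measurable_funB.
have iB (f : R -> R) (K : R) : measurable_fun setT f ->
    (forall y, u <= y <= v -> `|f y| <= K) ->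
    (@lebesgue_measure R).-integrable `[u, v] (EFin \o (fun y => f y * wH H y)).
  move=> mf fK.
  have iK : (@lebesgue_measure R).-integrable `[u, v] (fun y => K%:E * (EFin \o wH H) y)%E.
    exact: integrableZl.
  apply: le_integrable iK => //.
  - apply/measurable_EFinP; apply: measurable_funTS; apply: measurable_funM => //.
    exact: measurable_wH.
  - move=> y /=; rewrite in_itv/= => yuv; rewrite lee_fin normrM [in leRHS]normrM.
    by rewrite ler_wpM2r ?normr_ge0// (le_trans (fK y yuv))// ler_norm.
have uu : u <= u <= v by rewrite lexx ltW.
have M0 : 0 <= M by have /andP[h1 h2] := dM u uu; exact: le_trans h1 h2.
have id : (@lebesgue_measure R).-integrable `[u, v] (EFin \o (fun y => delta y * wH H y)).
  apply: (iB _ M).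
    by apply: measurable_funB => //; exact: measurable_expR_mulr.
  by move=> y /dM /andP[d0 d1]; rewrite ger0_norm.
have ie : (@lebesgue_measure R).-integrable `[u, v]
    (EFin \o (fun y => expR (- (y * t)) * wH H y)).
  apply: (iB _ 1); first exact: measurable_expR_mulr.
  move=> y /andP[uy _]; rewrite ger0_norm ?expR_ge0// -expR0 ler_expR oppr_le0.
  by rewrite mulr_ge0// (le_trans (ltW u0)).
have iQ : (@lebesgue_measure R).-integrable `[u, v] (EFin \o (fun y => Q.[y] * wH H y)).
  apply: (iB _ (1 + M)) => // y yuv; have /andP[d0 d1] := dM y yuv.
  have -> : Q.[y] = expR (- (y * t)) - delta y by rewrite /delta; ring.
  rewrite (le_trans (ler_normB _ _))// lerD ?(ger0_norm d0)// ger0_norm ?expR_ge0//.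
  have /andP[uy _] := yuv.
  by rewrite -expR0 ler_expR oppr_le0 mulr_ge0// (le_trans (ltW u0)).
have -> : \int[@lebesgue_measure R]_(y in `[u, v]) (expR (- (y * t)) * wH H y) -
    \sum_(k < m) eta k * expR (- (x k * t)) =
    \int[@lebesgue_measure R]_(y in `[u, v]) (delta y * wH H y) -
    \sum_(k < m) eta k * delta (x k).
  have -> : \int[@lebesgue_measure R]_(y in `[u, v]) (expR (- (y * t)) * wH H y) =
      \int[@lebesgue_measure R]_(y in `[u, v]) (Q.[y] * wH H y + delta y * wH H y).
    by apply: eq_Rintegral => y _; rewrite /delta; ring.
  rewrite RintegralD// QE.
  have -> : \sum_(k < m) eta k * expR (- (x k * t)) =
      \sum_(k < m) eta k * Q.[x k] + \sum_(k < m) eta k * delta (x k).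
    by rewrite -big_split/=; apply: eq_bigr => k _; rewrite /delta; ring.
  by ring.
have xk k : u <= x k <= v by have /andP[h1 h2] := xuv k; rewrite !ltW.
have A0 : 0 <= \int[@lebesgue_measure R]_(y in `[u, v]) (delta y * wH H y).
  apply: Rintegral_ge0 => y /=; rewrite in_itv/= => /dM/andP[d0 _].
  by rewrite mulr_ge0 ?wH_ge0.
have A1 : \int[@lebesgue_measure R]_(y in `[u, v]) (delta y * wH H y) <= M * W.
  rewrite -RintegralZl//; apply: le_Rintegral => //.
    by apply: (iB (cst M) M) => // y _; rewrite /= ger0_norm.
  move=> y /=; rewrite in_itv/= => /dM/andP[_ d1]; by rewrite ler_wpM2r ?wH_ge0.
have B0 : 0 <= \sum_(k < m) eta k * delta (x k).
  apply: sumr_ge0 => k _; rewrite mulr_ge0 ?(ltW (eta0 k))//.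
  by have /andP[] := dM _ (xk k).
have B1 : \sum_(k < m) eta k * delta (x k) <= M * W.
  rewrite WE mulr_sumr; apply: ler_sum => k _; rewrite mulrC ler_wpM2r ?(ltW (eta0 k))//.
  by have /andP[] := dM _ (xk k).
apply: (@le_trans _ _ (M * W)); last by rewrite ler_wpM2l.
exact: ler_dist_ge0.
Qed.

Lemma powRV (R : realType) (x r : R) : 0 <= x -> x^-1 `^ r = (x `^ r)^-1.
Proof. by move=> x0; rewrite -powR_inv1// powRAC powR_inv1// powR_ge0. Qed.

(** The exponent lies between -1 and 0, so the power is at most 1 for y >= 1 and at most 1 / y below
    1. *)
Lemma powRN2H_le (R : realType) (H y : R) : 0 < H < 2^-1 -> 0 < y -> y `^ (- (2 * H)) <= 1 + y^-1.
Proof.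
move=> /andP[H0 H1] y0; have yi0 : 0 < y^-1 by rewrite invr_gt0.
rewrite powRN; have [y1|y1] := leP 1 y.
  rewrite (@le_trans _ _ 1) ?lerDl ?(ltW yi0)// invf_le1 ?powR_gt0//.
  by rewrite -[leLHS](powRr0 y) ler_powR// mulr_ge0// ltW.
apply: (@le_trans _ _ y^-1); last by rewrite lerDr.
rewrite lef_pV2 ?posrE ?powR_gt0// -[leLHS]powRr1 ?(ltW y0)//.
by rewrite ger_powR ?y0 ?(ltW y1)//; lra.
Qed.

(* The bound of [gauss_rule_error], squared, with [u `^ (- 2H)] replaced through
   [y `^ (- 2H) <= 1 + y^-1] at [y = u t / m] and with [t <= T], so that only
   integer powers of [t] and an exponential remain. *)
Definition gauss_bound (R : realType) (H T u rho : R) (m : nat) (t : R) : R :=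
  cH H ^+ 2 * 4 * rho ^+ (4 * m + 2) * (T `^ (2 * H) / m%:R `^ (2 * H)) / (2 * m)`!%:R ^+ 2 *
  (u ^+ (4 * m).+1 * (t ^+ (4 * m) * expR (- (2 * u * t))) +
   m%:R * u ^+ (4 * m) * (t ^+ (4 * m).-1 * expR (- (2 * u * t)))).

Lemma gauss_bound_ge (R : realType) (H T u rho t : R) (m : nat) :
  0 < H < 2^-1 -> 0 < u -> 0 < t <= T -> (0 < m)%N ->
  (expR (- (u * t)) * ((u * rho * t) ^+ (2 * m) / (2 * m)`!%:R) *
   (cH H * u `^ (- H - 2^-1) * (2 * (u * rho)))) ^+ 2 <= gauss_bound H T u rho m t.
Proof.
move=> H01 u0 /andP[t0 tT] m0; have /andP[H0 H1] := H01.
have m0' : (0 : R) < m%:R by rewrite ltr0n.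
have T0 : 0 < T by exact: lt_le_trans tT.
have f0 : (2 * m)`!%:R != 0 :> R by rewrite pnatr_eq0 -lt0n fact_gt0.
have k1 : u `^ (- (2 * H)) <= T `^ (2 * H) / m%:R `^ (2 * H) * (1 + m%:R / (u * t)).
  have h := @powRN2H_le R H (u * t / m%:R) H01.
  have y0 : 0 < u * t / m%:R by rewrite divr_gt0// mulr_gt0.
  have {}h := h y0; rewrite invf_div in h.
  have -> : u `^ (- (2 * H)) = t `^ (2 * H) / m%:R `^ (2 * H) * (u * t / m%:R) `^ (- (2 * H)).
    rewrite !powRN powRM ?mulr_ge0 ?invr_ge0 ?(ltW u0) ?(ltW t0) ?(ltW m0')//.
    rewrite powRM ?(ltW u0) ?(ltW t0)// powRV ?(ltW m0')//.
    have : t `^ (2 * H) != 0 by rewrite gt_eqF ?powR_gt0.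
    have : u `^ (2 * H) != 0 by rewrite gt_eqF ?powR_gt0.
    have : m%:R `^ (2 * H) != 0 :> R by rewrite gt_eqF ?powR_gt0.
    move: (t `^ _) (u `^ _) (m%:R `^ _) => a b c c0 b0 a0.
    by field; rewrite a0 b0 c0.
  apply: ler_pM; rewrite ?mulr_ge0 ?powR_ge0 ?invr_ge0 ?powR_ge0//.
  rewrite ler_wpM2r ?invr_ge0 ?powR_ge0//.
  by apply: ge0_ler_powR; rewrite ?nnegrE ?(ltW t0) ?(ltW T0)// mulr_ge0// ltW.
have k2 : (u `^ (- H - 2^-1)) ^+ 2 = u `^ (- (2 * H)) / u.
  rewrite expr2 -powRD; last by rewrite (gt_eqF u0) implybT.
  rewrite -[in X in _ / X](powRr1 (ltW u0)) -powRB ?(gt_eqF u0) ?implybT//.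
  by congr powR; field.
have k3 : expR (- (u * t)) ^+ 2 = expR (- (2 * u * t)).
  by rewrite expr2 -expRD; congr expR; ring.
have m4 : (4 * m = (4 * m).-1.+1)%N by rewrite prednK// muln_gt0.
have e1 : forall a b c d f : R, (a * (b / f) * (c * d * (2 * (u * rho)))) ^+ 2 =
    c ^+ 2 * 4 * (u * rho) ^+ 2 * b ^+ 2 / f ^+ 2 * a ^+ 2 * d ^+ 2.
  move=> a' b' c' d' f'; rewrite !exprMn exprVn; ring.
rewrite e1 k2 k3 -exprM.
have -> : (u * rho * t) ^+ (2 * m * 2) = u ^+ (4 * m) * rho ^+ (4 * m) * t ^+ (4 * m).
  by rewrite !exprMn (_ : 2 * m * 2 = 4 * m)%N//; lia.
rewrite /gauss_bound exprD.
apply: (@le_trans _ _ (cH H ^+ 2 * 4 * (rho ^+ (4 * m) * rho ^+ 2) / (2 * m)`!%:R ^+ 2 *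
   (u ^+ (4 * m) * t ^+ (4 * m) * expR (- (2 * u * t)) * u) * u `^ (- (2 * H)))).
  rewrite le_eqVlt; apply/orP; left; apply/eqP.
  move: (u ^+ (4 * m)) (rho ^+ (4 * m)) (t ^+ (4 * m)) (u `^ _) (expR _) (cH H) f0 => a1 a2 a3 a4 a5 a6.
  move: (_`!%:R) => a7 a70.
  by field; rewrite a70 gt_eqF.
apply: (@le_trans _ _ (cH H ^+ 2 * 4 * (rho ^+ (4 * m) * rho ^+ 2) / (2 * m)`!%:R ^+ 2 *
   (u ^+ (4 * m) * t ^+ (4 * m) * expR (- (2 * u * t)) * u) *
   (T `^ (2 * H) / m%:R `^ (2 * H) * (1 + m%:R / (u * t))))).
  rewrite ler_wpM2l// mulr_ge0//.
    rewrite divr_ge0 ?sqr_ge0// mulr_ge0//; first by rewrite mulr_ge0 ?sqr_ge0.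
    by rewrite mulr_ge0 ?sqr_ge0// mulnC exprM (_ : 4 = 2 * 2)%N// exprM sqr_ge0.
  by rewrite !mulr_ge0 ?exprn_ge0 ?expR_ge0// ?(ltW u0) ?(ltW t0).
rewrite le_eqVlt; apply/orP; left; apply/eqP.
(* The summand m / (u t) lowers the power of [t] by one; 4m > 0 makes the predecessor genuine. *)
have tp : t ^+ (4 * m) = t * t ^+ (4 * m).-1 by rewrite -exprS -m4.
rewrite [u ^+ (4 * m).+1]exprS !tp.
move: (u ^+ (4 * m)) (rho ^+ (4 * m)) (t ^+ (4 * m).-1) (T `^ _) (m%:R `^ _) => a1 a2 a3 a4 a5.
move: (expR _) (cH H) (a5^-1) f0 => a6 a7 a8; move: (_`!%:R) (m%:R) => a9 a10 a90.
by field; rewrite a90 !gt_eqF.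
Qed.

Lemma measurable_powX_expR (R : realType) (k : nat) (s : R) (D : set R) :
  measurable_fun D (fun t : R => t ^+ k * expR (- (s * t))).
Proof.
apply: measurable_funTS; apply: measurable_funM; first exact: measurable_funX.
by apply: measurableT_comp => //; apply: measurableT_comp => //; exact: measurable_funM.
Qed.

Lemma measurable_gauss_bound (R : realType) (H T u rho : R) (m : nat) (D : set R) :
  measurable_fun D (gauss_bound H T u rho m).
Proof.
apply: measurable_funM => //; apply: measurable_funD; apply: measurable_funM => //;
exact: measurable_powX_expR.
Qed.

Lemma gauss_const_ge0 (R : realType) (H T c rho : R) (k m : nat) : 0 <= c -> 0 <= rho ->
  0 <= cH H ^+ 2 * c * rho ^+ k * (T `^ (2 * H) / m%:R `^ (2 * H)).
Proof.
move=> c0 rho0; rewrite mulr_ge0 ?divr_ge0 ?powR_ge0// mulr_ge0 ?exprn_ge0//.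
by rewrite mulr_ge0 ?exprn_ge0 ?cH_ge0.
Qed.

Lemma gauss_bound_ge0 (R : realType) (H T u rho t : R) (m : nat) :
  0 <= u -> 0 <= rho -> 0 <= t -> 0 <= gauss_bound H T u rho m t.
Proof.
move=> u0 rho0 t0; rewrite /gauss_bound mulr_ge0//.
  by rewrite divr_ge0 ?gauss_const_ge0 ?exprn_ge0.
by rewrite addr_ge0// !mulr_ge0 ?exprn_ge0 ?expR_ge0.
Qed.

(** Both time integrals are bounded by factorials over powers of 2u, so every power of u cancels and
    the bound is the same on each cell. The two summands give 1/2 + 1/4 of (4m)! / 2^(4m); the
    prefactor 4 and the central binomial bound turn this into 4 times 3/4 times 1/2, that is 3/2. *)
Lemma integral_gauss_bound (R : realType) (H T u rho : R) (m : nat) :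
  0 < u -> 0 <= rho -> 0 < T -> (0 < m)%N ->
  (\int[@lebesgue_measure R]_(t in `[0%R, T]) (gauss_bound H T u rho m t)%:E <=
   (cH H ^+ 2 * (3 / 2) * rho ^+ (4 * m + 2) * (T `^ (2 * H) / m%:R `^ (2 * H)))%:E)%E.
Proof.
move=> u0 rho0 T0 m0.
have m0' : (0 : R) < m%:R by rewrite ltr0n.
have s0 : 0 < 2 * u by rewrite mulr_gt0.
rewrite /gauss_bound; set L := leRHS.
pose K := cH H ^+ 2 * 4 * rho ^+ (4 * m + 2) * (T `^ (2 * H) / m%:R `^ (2 * H)) / (2 * m)`!%:R ^+ 2.
rewrite -/K.
have K0 : 0 <= K.
  by rewrite divr_ge0 ?gauss_const_ge0 ?exprn_ge0.
pose p k (t : R) := t ^+ k * expR (- (2 * u * t)).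
have mp k : measurable_fun `[0, T] (p k) by exact: measurable_powX_expR.
have p0 k (t : R) : `[0, T]%classic t -> 0 <= p k t.
  by rewrite /= in_itv/= => /andP[t0 _]; rewrite mulr_ge0 ?exprn_ge0 ?expR_ge0.
have un k : 0 <= u ^+ k by rewrite exprn_ge0 ?ltW.
have mpM k c : measurable_fun `[0, T] (fun t => c * p k t) by exact: measurable_funM.
have -> : (\int[@lebesgue_measure R]_(t in `[0%R, T])
    (K * (u ^+ (4 * m).+1 * p (4 * m)%N t + m%:R * u ^+ (4 * m) * p (4 * m).-1 t))%:E =
    K%:E * ((u ^+ (4 * m).+1)%:E *
       \int[@lebesgue_measure R]_(t in `[0%R, T]) (p (4 * m)%N t)%:E +
     (m%:R * u ^+ (4 * m))%:E *
       \int[@lebesgue_measure R]_(t in `[0%R, T]) (p (4 * m).-1 t)%:E))%E.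
  have c0 : 0 <= m%:R * u ^+ (4 * m) by rewrite mulr_ge0// ltW.
  rewrite -!ge0_integralZl_EFinM//; try exact: p0; try exact: mp.
  rewrite -ge0_integralD_EFinD//; try exact: mpM.
  - rewrite -ge0_integralZl_EFinM//; first by apply: measurable_funD; exact: mpM.
    by move=> t tT; rewrite addr_ge0// mulr_ge0 ?p0.
  - by move=> t tT; rewrite mulr_ge0 ?p0.
  - by move=> t tT; rewrite mulr_ge0 ?p0.
have i1 := integral_pow_expR (4 * m) s0 T0.
have i2 := integral_pow_expR (4 * m).-1 s0 T0.
have m4 : ((4 * m).-1.+1 = 4 * m)%N by rewrite prednK// muln_gt0.
apply: (@le_trans _ _ (K%:E * ((u ^+ (4 * m).+1)%:E * ((4 * m)`!%:R / (2 * u) ^+ (4 * m).+1)%:E +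
   (m%:R * u ^+ (4 * m))%:E * ((4 * m).-1`!%:R / (2 * u) ^+ (4 * m).-1.+1)%:E))%E).
  rewrite lee_wpmul2l ?lee_fin//; apply: leeD; rewrite lee_wpmul2l ?lee_fin//.
  by rewrite mulr_ge0// ltW.
rewrite [leLHS](_ : _ = (K * (u ^+ (4 * m).+1 * ((4 * m)`!%:R / (2 * u) ^+ (4 * m).+1) +
   m%:R * u ^+ (4 * m) * ((4 * m).-1`!%:R / (2 * u) ^+ (4 * m).-1.+1)))%:E)// lee_fin m4.
have fE : (4 * m)`!%:R = 4 * m%:R * (4 * m).-1`!%:R :> R.
  by rewrite -[in LHS]m4 factS natrM m4 natrM.
have -> : u ^+ (4 * m).+1 * ((4 * m)`!%:R / (2 * u) ^+ (4 * m).+1) +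
    m%:R * u ^+ (4 * m) * ((4 * m).-1`!%:R / (2 * u) ^+ (4 * m)) =
    3 / 4 * ((4 * m)`!%:R / 2 ^+ (4 * m)).
  rewrite fE !exprS !exprMn.
  have : (2 : R) ^+ (4 * m) != 0 by rewrite expf_neq0.
  have : u ^+ (4 * m) != 0 by rewrite expf_neq0// gt_eqF.
  move: (u ^+ _) (2 ^+ _) (_`!%:R) => a b c a0 b0.
  by field; rewrite a0 b0 gt_eqF.
have bin : 2 * ((4 * m)`!%:R / (2 * m)`!%:R ^+ 2) <= 2 ^+ (4 * m) :> R.
  have e4 : (2 * (2 * m) = 4 * m)%N by lia.
  have := @central_bin_le (2 * m); rewrite muln_gt0 m0 => /(_ isT).
  rewrite e4 -(ler_nat R) natrM natrX => h; apply: le_trans h.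
  have := @bin_fact (4 * m) (2 * m); rewrite leq_mul2r orbT => /(_ isT).
  rewrite (_ : 4 * m - 2 * m = 2 * m)%N; last by lia.
  move=> <-; rewrite natrM natrM -expr2 mulfK//.
have b0 : (0 : R) < 2 ^+ (4 * m) by rewrite exprn_gt0.
have {}bin : 2 * ((4 * m)`!%:R / (2 * m)`!%:R ^+ 2) / 2 ^+ (4 * m) <= 1 :> R.
  by rewrite ler_pdivrMr// mul1r.
rewrite /L /K.
have Q0 : 0 <= cH H ^+ 2 * (3 / 2) * rho ^+ (4 * m + 2) * (T `^ (2 * H) / m%:R `^ (2 * H)).
  by apply: gauss_const_ge0; rewrite ?divr_ge0.
apply: le_trans (_ : _ * 1 <= _); last by rewrite mulr1.
apply: le_trans (ler_wpM2l Q0 bin).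
rewrite le_eqVlt; apply/orP; left; apply/eqP; 
have f0 : (2 * m)`!%:R != 0 :> R by rewrite pnatr_eq0 -lt0n fact_gt0.
move: f0 (lt0r_neq0 b0); move: ((2 * m)`!%:R) (2 ^+ (4 * m)) (T `^ _ / _) ((4 * m)`!%:R : R).
by move=> f w q k f0 w0; field; rewrite w0 f0.
Qed.

Lemma integrable_wH_0r (R : realType) (H b : R) : H < 2^-1 -> 0 < b ->
  (@lebesgue_measure R).-integrable `]0, b] (EFin \o wH H).
Proof.
move=> H1 b0; apply/integrableP; split.
  by apply/measurable_EFinP; apply: measurable_funTS; exact: measurable_wH.
have -> : (\int[@lebesgue_measure R]_(x in `]0%R, b]) `|(EFin \o wH H) x| =
    \int[@lebesgue_measure R]_(x in `]0%R, b]) (cH H * (x : R) `^ (2^-1 - H - 1))%:E)%E.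
  apply: eq_integral => x _; rewrite /= ger0_norm ?wH_ge0// /wH; congr (_ * _ `^ _)%:E.
  by field.
rewrite ge0_integralZl_EFinM ?cH_ge0//; last 2 first.
- by apply: measurable_funTS; exact: measurable_powR.
- by move=> x _; exact: powR_ge0.
by rewrite integral_powR_0r ?subr_gt0// ltry.
Qed.

Lemma head_error_le (R : realType) (H t b : R) : H < 2^-1 -> 0 < b -> 0 < t ->
  `|\int[@lebesgue_measure R]_(x in `[0, b]) wH H x -
    \int[@lebesgue_measure R]_(x in `]0, b]) (expR (- (x * t)) * wH H x)| <=
  cH H * (t * (b `^ (3 / 2 - H) / (3 / 2 - H))).
Proof.
move=> H1 b0 t0; have iw := integrable_wH_0r H1 b0.
have e01 (x : R) : `]0, b]%classic x -> 0 <= expR (- (x * t)) <= 1.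
  rewrite /= in_itv/= => /andP[x0 _]; rewrite expR_ge0 -expR0 ler_expR oppr_le0.
  by rewrite mulr_ge0// ltW.
have ie : (@lebesgue_measure R).-integrable `]0, b]
    (EFin \o (fun x : R => expR (- (x * t)) * wH H x)).
  apply: le_integrable iw => //.
    apply/measurable_EFinP; apply: measurable_funTS; apply: measurable_funM.
      exact: measurable_expR_mulr.
    exact: measurable_wH.
  move=> x /e01/andP[h1 h2]; rewrite lee_fin normrM ler_piMl// ger0_norm//.
(* The endpoint 0, where the negative power in [wH] has only a default value, is a null set;
   afterwards both integrals run over x > 0 and can be compared pointwise. *)
rewrite -Rintegral_itv_obnd_cbnd// -RintegralB//.
rewrite ger0_norm; last first.
  apply: Rintegral_ge0 => x /e01/andP[h1 h2]; by rewrite -{1}[wH H x]mul1r -mulrBl mulr_ge0 ?wH_ge0// subr_ge0.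
have le2 (x : R) : `]0, b]%classic x ->
    wH H x - expR (- (x * t)) * wH H x <= cH H * (t * x `^ (3 / 2 - H - 1)).
  move=> xb; have /andP[x0 _] : 0 < x <= b by move: xb; rewrite /= in_itv.
  have -> : x `^ (3 / 2 - H - 1) = x * x `^ (- H - 2^-1).
    transitivity (x `^ (1 + (- H - 2^-1))); first by congr powR; field.
    by rewrite powRD ?powRr1 ?(ltW x0)// (gt_eqF x0) implybT.
  rewrite -{1}[wH H x]mul1r -mulrBl /wH.
  have -> : cH H * (t * (x * x `^ (- H - 2^-1))) = (x * t) * (cH H * x `^ (- H - 2^-1)) by ring.
  rewrite ler_wpM2r ?mulr_ge0 ?cH_ge0 ?powR_ge0//.
  by have := expR_ge1Dx (- (x * t)); lra.
rewrite -lee_fin fineK; last by apply: integrable_fin_num => //; exact: (integrableB _ iw ie).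
apply: (@le_trans _ _ (\int[@lebesgue_measure R]_(x in `]0%R, b]) (cH H * (t * (x : R) `^ (3 / 2 - H - 1)))%:E)%E).
  apply: ge0_le_integral => //.
  - by move=> x /e01/andP[h1 h2]; rewrite lee_fin -{1}[wH H x]mul1r -mulrBl mulr_ge0 ?wH_ge0// subr_ge0.
  - apply/measurable_EFinP; apply: measurable_funB; apply: measurable_funTS; [exact: measurable_wH|].
    by apply: measurable_funM; [exact: measurable_expR_mulr|exact: measurable_wH].
  - apply/measurable_EFinP; apply: measurable_funTS; apply: measurable_funM => //.
    by apply: measurable_funM => //; exact: measurable_powR.
have mp : measurable_fun `]0, b] (fun x : R => x `^ (3 / 2 - H - 1)).
  by apply: measurable_funTS; exact: measurable_powR.
rewrite ge0_integralZl_EFinM ?cH_ge0//; last 2 first.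
- exact: measurable_funM.
- by move=> x _; rewrite mulr_ge0 ?powR_ge0// ltW.
rewrite ge0_integralZl_EFinM ?(ltW t0)//; last by move=> x _; exact: powR_ge0.
by rewrite integral_powR_0r// -?EFinM//; lra.
Qed.

(** Induction on [n] cuts one cell at a time off the unbounded tail; closed cells share endpoints,
    which are null sets. *)
Lemma Rintegral_grid (R : realType) (f : R -> R) (g : nat -> R) (n : nat) :
  0 < g 0%N -> (forall j, g j <= g j.+1) ->
  (@lebesgue_measure R).-integrable `]0, +oo[ (EFin \o f) ->
  \int[@lebesgue_measure R]_(x in `]0, +oo[) f x =
  \int[@lebesgue_measure R]_(x in `]0, g 0%N]) f x +
  \sum_(j < n) \int[@lebesgue_measure R]_(x in `[g j, g j.+1]) f x +
  \int[@lebesgue_measure R]_(x in `[g n, +oo[) f x.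
Proof.
move=> g0 gS fi.
have gpos j : 0 < g j by elim: j => // j IH; exact: lt_le_trans (gS j).
have sub (i : interval R) : (i <= `]0%R, +oo[)%O ->
    (@lebesgue_measure R).-integrable [set` i] (EFin \o f).
  by move=> hi; apply: integrableS fi => //; exact: subitvP.
elim: n => [|n IH].
  rewrite big_ord0 addr0 -Rintegral_itv_obnd_cbnd; last first.
    by apply: sub; rewrite subitvE !bnd_simp/= ltW.
  by rewrite -(@Rintegral_itvB _ f (BRight 0) +oo%O (g 0%N))// ?bnd_simp ?ltW//; ring.
rewrite IH big_ord_recr/= -!addrA; congr (_ + (_ + _)).
rewrite -[X in _ + X]Rintegral_itv_obnd_cbnd; last first.
  by apply: sub; rewrite subitvE !bnd_simp/= ltW.
rewrite -(@Rintegral_itvB _ f (BLeft (g n)) +oo%O (g n.+1))// ?bnd_simp//; first by ring.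
by apply: sub; rewrite subitvE !bnd_simp/= gpos.
Qed.

(** * Tail and kernel error in mean square *)

Lemma eq_imp_le d (T : porderType d) (x y : T) : x = y -> (x <= y)%O.
Proof. by move->. Qed.

Lemma cH_gt0 (R : realType) (H : R) : 0 < H < 2^-1 -> 0 < cH H.
Proof.
by move=> /andP[H0 H1]; rewrite invr_gt0 mulr_gt0// Gamma_gt0//; apply/andP; split; lra.
Qed.

Lemma integral_indicr d (S : measurableType d) (R : realType)
    (mu : {measure set S -> \bar R}) (E : set S) (g : S -> R) :
  (\int[mu]_(x in E) (g x)%:E = \int[mu]_x (g x * \1_E x)%:E)%E.
Proof. by rewrite integral_mkcond epatch_indic. Qed.

(** The rectangle is encoded by indicators inside the integrand, so that Tonelli on the whole plane
    applies. The first component records the measurability of the inner integral, which the later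
    comparison of integrals requires. *)
Lemma ge0_fubini_rect (R : realType) (f : R * R -> R) (D E : set R) :
  measurable D -> measurable E ->
  measurable_fun [set: R * R] f -> (forall z, 0 <= f z) ->
  measurable_fun [set: R] (fun t => \int[@lebesgue_measure R]_(x in E) (f (t, x))%:E)%E /\
  (\int[@lebesgue_measure R]_(t in D) \int[@lebesgue_measure R]_(x in E) (f (t, x))%:E =
   \int[@lebesgue_measure R]_(x in E) \int[@lebesgue_measure R]_(t in D) (f (t, x))%:E)%E.
Proof.
move=> mD mE mf f0.
pose h (A B : set R) (z : R * R) := (f z * \1_B z.2 * \1_A z.1)%:E.
have mh A B : measurable A -> measurable B -> measurable_fun [set: R * R] (h A B).
  move=> mA mB; apply/measurable_EFinP; apply: measurable_funM.
    apply: measurable_funM => //.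
    exact: (measurableT_comp (measurable_indic mB) measurable_snd).
  exact: (measurableT_comp (measurable_indic mA) measurable_fst).
have h0 A B z : (0 <= h A B z)%E by rewrite lee_fin !mulr_ge0.
have swap (g : R -> R) (A : set R) (a : R) (B : set R) :
    (\int[@lebesgue_measure R]_(x in A) (g x)%:E * (\1_B a)%:E =
     \int[@lebesgue_measure R]_x (g x * \1_A x * \1_B a)%:E)%E.
  rewrite integral_indicr indicE; case: (a \in B).
    by rewrite mule1; apply: eq_integral => x _; rewrite mulr1.
  by rewrite mule0 integral0_eq// => x _; rewrite mulr0.
split.
  have := measurable_fun_fubini_tonelli_F (m2 := @lebesgue_measure R) _ (mh _ _ measurableT mE) (h0 _ _).
  apply: eq_measurable_fun => t _; rewrite /fubini_F [RHS]integral_indicr.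
  by apply: eq_integral => x _; rewrite /h/= indicT mulr1.
rewrite integral_mkcond epatch_indic [RHS]integral_mkcond epatch_indic.
transitivity (\int[@lebesgue_measure R]_t \int[@lebesgue_measure R]_x h D E (t, x))%E.
  by apply: eq_integral => t _; rewrite /= swap.
rewrite (@fubini_tonelli _ _ _ _ _ (@lebesgue_measure R) (@lebesgue_measure R))//; last exact: mh.
apply: eq_integral => x _; rewrite /= (swap (fun t => f (t, x))).
by apply: eq_integral => t _; rewrite /h/= mulrAC.
Qed.

(** Integral of the square of x^(-H/2) exp(-x t), the second Cauchy-Schwarz factor of the tail. It
    is extended-valued because for the exponents in use it is infinite at t = 0, although its
    integral over [0, T] is finite. *)
Definition tail_energy (R : realType) (H z t : R) : \bar R :=
  \int[@lebesgue_measure R]_(x in `[z, +oo[) (x `^ (- H) * expR (- (2 * x * t)))%:E.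

(** The exponent is divided so that the square of the first factor is x^(-H - 1), integrable at
    infinity, while the second keeps x^(-H), which integration in time will turn into a multiple of
    x^(-H - 1) as well. *)
Lemma tail_sqr_le (R : realType) (H z t : R) : 0 < H < 2^-1 -> 0 < z -> 0 < t ->
  (((\int[@lebesgue_measure R]_(x in `[z, +oo[) (expR (- (x * t)) * wH H x)) ^+ 2)%:E <=
   (cH H ^+ 2 * (z `^ (- H) / H))%:E * tail_energy H z t)%E.
Proof.
move=> H01 z0 t0; have /andP[H0 H1] := H01.
have A0 : (0 <= tail_energy H z t)%E.
  by apply: integral_ge0 => x _; rewrite lee_fin mulr_ge0 ?powR_ge0 ?expR_ge0.
have k0 : 0 < cH H ^+ 2 * (z `^ (- H) / H).
  by rewrite mulr_gt0 ?exprn_gt0 ?cH_gt0// divr_gt0 ?powR_gt0.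
(* If the energy is infinite, so is the right-hand side, because its prefactor is strictly
   positive. *)
case AE : (tail_energy H z t) A0 => [r| |]// A0; last by rewrite gt0_muley// leey.
pose f (x : R) := x `^ (- H / 2 - 2^-1).
pose g (x : R) := x `^ (- H / 2) * expR (- (x * t)).
have x0 (x : R) : `[z, +oo[%classic x -> 0 < x.
  by rewrite /= in_itv/= andbT; exact: lt_le_trans.
have mf (p : R) : measurable_fun `[z, +oo[ (fun x : R => x `^ p).
  by apply: measurable_funTS; exact: measurable_powR.
have me : measurable_fun `[z, +oo[ (fun x : R => expR (- (x * t))).
  by apply: measurable_funTS; exact: measurable_expR_mulr.
have fg : (\int[@lebesgue_measure R]_(x in `[z, +oo[) (f x * g x)%:E <=
    (Num.sqrt (z `^ (- H) / H * r))%:E)%E.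
  apply: ge0_cauchy_schwarz => //.
  - exact: mf.
  - by apply: measurable_funM; [exact: mf|exact: me].
  - by move=> x _; exact: powR_ge0.
  - by move=> x _; rewrite mulr_ge0 ?powR_ge0 ?expR_ge0.
  - rewrite -(integral_powR_ry H0 z0); apply: eq_imp_le; apply: eq_integral => x /set_mem /x0 xp.
    congr EFin; rewrite /f expr2 -powRD; last by rewrite (gt_eqF xp) implybT.
    by congr powR; field.
  - rewrite -AE; apply: eq_imp_le; apply: eq_integral => x /set_mem /x0 xp.
    congr EFin; rewrite /g exprMn !expr2 -powRD; last by rewrite (gt_eqF xp) implybT.
    rewrite -expRD; congr (_ `^ _ * expR _); first by field.
    by ring.
have fE : (\int[@lebesgue_measure R]_(x in `[z, +oo[) (expR (- (x * t)) * wH H x)%:E =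
    (cH H)%:E * \int[@lebesgue_measure R]_(x in `[z, +oo[) (f x * g x)%:E)%E.
  rewrite -ge0_integralZl_EFinM ?cH_ge0//; last 2 first.
  - by apply: measurable_funM; [exact: mf|apply: measurable_funM; [exact: mf|exact: me]].
  - by move=> x _; rewrite !mulr_ge0 ?powR_ge0 ?expR_ge0.
  apply: eq_integral => x /set_mem /x0 xp; congr EFin.
  rewrite /f /g /wH [X in _ = _ * X]mulrA -powRD; last by rewrite (gt_eqF xp) implybT.
  by rewrite (_ : - H / 2 - 2^-1 + - H / 2 = - H - 2^-1); [ring|field].
have I0 : (0 <= \int[@lebesgue_measure R]_(x in `[z, +oo[) (f x * g x)%:E)%E.
  by apply: integral_ge0 => x _; rewrite lee_fin !mulr_ge0 ?powR_ge0 ?expR_ge0.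
rewrite /Rintegral fE -EFinM lee_fin.
move: fg I0; case: (\int[_]_(x in _) _)%E => [s| |]//=; rewrite !lee_fin => sr s0.
rewrite -mulrA exprMn ler_wpM2l ?sqr_ge0// -[leRHS]sqr_sqrtr; last first.
  by rewrite mulr_ge0// divr_ge0 ?powR_ge0// ltW.
by rewrite lerXn2r// nnegrE sqrtr_ge0.
Qed.

(** After Tonelli the inner integral of exp(-2 x t) in time is at most 1 / (2 x), uniformly in [T].
    This supplies the missing decay at infinity. *)
Lemma integral_tail_energy (R : realType) (H z T : R) : 0 < H -> 0 < z -> 0 < T ->
  measurable_fun [set: R] (tail_energy H z) /\
  (\int[@lebesgue_measure R]_(t in `[0%R, T]) tail_energy H z t <=
   (z `^ (- H) / (2 * H))%:E)%E.
Proof.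
move=> H0 z0 T0.
have me (x : R) : measurable_fun `[0, T] (fun t : R => expR (- (2 * x * t))).
  apply: measurable_funTS; apply: measurableT_comp => //; exact: measurableT_comp.
have FE1 (x : R) : (\int[@lebesgue_measure R]_(t in `[0%R, T])
    (x `^ (- H) * expR (- (2 * x * t)))%:E = (x `^ (- H))%:E *
    \int[@lebesgue_measure R]_(t in `[0%R, T]) (expR (- (2 * x * t)))%:E)%E.
  apply: ge0_integralZl_EFinM; [exact: measurable_itv|exact: me| |exact: powR_ge0].
  by move=> t _; exact: expR_ge0.
have inner (x : R) : 0 < x -> (\int[@lebesgue_measure R]_(t in `[0%R, T])
    (x `^ (- H) * expR (- (2 * x * t)))%:E <= (2^-1 * x `^ (- H - 1))%:E)%E.
  move=> xp.
  have s0 : 0 < 2 * x by rewrite mulr_gt0.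
  have := @integral_pow_expR R 0 _ T s0 T0; rewrite fact0 expr1 => h.
  rewrite FE1.
  apply: (@le_trans _ _ ((x `^ (- H))%:E * (1 / (2 * x))%:E)%E).
    rewrite lee_wpmul2l ?lee_fin ?powR_ge0//; apply: le_trans h.
    by apply: eq_imp_le; apply: eq_integral => t _; rewrite expr0 mul1r.
  rewrite -EFinM lee_fin powRB; last by rewrite (gt_eqF xp) implybT.
  by rewrite powRr1 ?(ltW xp)// le_eqVlt; apply/orP; left; apply/eqP; field; rewrite gt_eqF.
have outer : (\int[@lebesgue_measure R]_(x in `[z, +oo[) (2^-1 * (x : R) `^ (- H - 1))%:E <=
    (z `^ (- H) / (2 * H))%:E)%E.
  rewrite ge0_integralZl_EFinM//; last 2 first.
  - by apply: measurable_funTS; exact: measurable_powR.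
  - by move=> x _; exact: powR_ge0.
  rewrite integral_powR_ry// -EFinM lee_fin le_eqVlt; apply/orP; left; apply/eqP.
  by field; rewrite gt_eqF.
pose f (p : R * R) := p.2 `^ (- H) * expR (- (2 * p.2 * p.1)).
have mf : measurable_fun [set: R * R] f.
  apply: measurable_funM.
    exact: (measurableT_comp (@measurable_powR R (- H)) measurable_snd).
  apply: measurableT_comp => //; apply: measurableT_comp => //; apply: measurable_funM => //.
  exact: measurable_funM.
have f0 p : 0 <= f p by rewrite mulr_ge0 ?powR_ge0 ?expR_ge0.
have [mF FE] := @ge0_fubini_rect R f `[0, T]%classic `[z, +oo[%classic
  (measurable_itv _) (measurable_itv _) mf f0.
split; first exact: mF.
rewrite [leLHS]FE.
have x0 (x : R) : `[z, +oo[%classic x -> 0 < x.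
  by rewrite /= in_itv/= andbT; exact: lt_le_trans.
apply: (@le_trans _ _ (\int[@lebesgue_measure R]_(x in `[z, +oo[) (2^-1 * (x : R) `^ (- H - 1))%:E)%E).
  pose F1 (x : R) := (\int[@lebesgue_measure R]_(t in `[0%R, T]) (f (t, x))%:E)%E.
  pose F2 (x : R) := (2^-1 * x `^ (- H - 1))%:E.
  have F10 x : (0 <= F1 x)%E by apply: integral_ge0 => t _; rewrite lee_fin f0.
  have mF1 : measurable_fun setT F1.
    have mf' : measurable_fun [set: R * R] (fun p => f (p.2, p.1)).
      by apply: measurableT_comp mf _; exact: measurable_fun_pair.
    (* Only the measurability half is used, for the integrand with its arguments exchanged; the
       first side of the rectangle is a placeholder. *)
    by have [] := @ge0_fubini_rect R _ `[0, T]%classic `[0, T]%classic (measurable_itv _) (measurable_itv _) mf' (fun p => f0 _).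
  have mF2 : measurable_fun setT F2.
    by apply/measurable_EFinP; apply: measurable_funM => //; exact: measurable_powR.
  have F12 (x : R) : `[z, +oo[%classic x -> (F1 x <= F2 x)%E.
    move=> /x0 xp; exact: inner.
  apply: (@ge0_le_integral _ _ _ (@lebesgue_measure R) _ (measurable_itv _) F1 F2).
  - by move=> x _; exact: F10.
  - exact: measurable_funTS.
  - exact: measurable_funTS.
  - exact: F12.
exact: outer.
Qed.

Lemma exp_kernel_quad_nodes (R : realType) (H xi0 t : R) (m n : nat) (x eta : 'I_n -> 'I_m -> R) :
  exp_kernel (quad_nodes H xi0 x eta) t =
  \int[@lebesgue_measure R]_(y in `[0, xi0]) wH H y +
  \sum_(j < n) \sum_(k < m) eta j k * expR (- (x j k * t)).
Proof.
rewrite /exp_kernel /quad_nodes big_cons /= mul0r oppr0 expR0 mulr1; congr (_ + _).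
rewrite big_allpairs_dep big_enum /=; apply: eq_bigr => j _.
by rewrite big_enum.
Qed.

Lemma grid_gt0 (R : realType) (xi0 xin : R) (n j : nat) : 0 < xi0 -> 0 < xin ->
  0 < grid xi0 xin n j.
Proof. by move=> h0 hn; rewrite mulr_gt0// powR_gt0// divr_gt0. Qed.

Lemma grid0 (R : realType) (xi0 xin : R) (n : nat) : grid xi0 xin n 0 = xi0.
Proof. by rewrite /grid mul0r powRr0 mulr1. Qed.

Lemma gridn (R : realType) (xi0 xin : R) (n : nat) : 0 < xi0 -> 0 < xin -> (0 < n)%N ->
  grid xi0 xin n n = xin.
Proof.
move=> h0 hn n0; rewrite /grid divff ?pnatr_eq0 -?lt0n// powRr1; last by rewrite divr_ge0// ltW.
by rewrite mulrC divfK// gt_eqF.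
Qed.

Lemma gridS (R : realType) (xi0 xin : R) (n j : nat) : 0 < xi0 -> 0 < xin -> (0 < n)%N ->
  grid xi0 xin n j.+1 = grid xi0 xin n j * grid_ratio xi0 xin n.
Proof.
move=> h0 hn n0; have q0 : 0 < xin / xi0 by rewrite divr_gt0.
rewrite /grid /grid_ratio -mulrA -powRD; last by rewrite (gt_eqF q0) implybT.
have n0' : n%:R != 0 :> R by rewrite pnatr_eq0 -lt0n.
by rewrite -natr1 mulrDl mul1r.
Qed.

Lemma grid_ratio_gt1 (R : realType) (xi0 xin : R) (n : nat) : 0 < xi0 -> xi0 < xin -> (0 < n)%N ->
  1 < grid_ratio xi0 xin n.
Proof.
move=> h0 hn n0; have q1 : 1 < xin / xi0 by rewrite ltr_pdivlMr// mul1r.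
rewrite /grid_ratio /powR gt_eqF ?(lt_trans _ q1)// -[ltLHS]expR0 ltr_expR mulr_gt0//.
  by rewrite invr_gt0 ltr0n.
exact: ln_gt0.
Qed.

(** Expand the square into a double sum and bound e_i e_j by (e_i^2 + e_j^2) / 2. This costs one
    factor n; summing n equal cell bounds later gives the other. *)
Lemma sqr_sum_le (R : realType) (n : nat) (e : 'I_n -> R) :
  (\sum_(j < n) e j) ^+ 2 <= n%:R * \sum_(j < n) e j ^+ 2.
Proof.
pose S := \sum_(j < n) e j ^+ 2.
have SE : \sum_(i < n) \sum_(j < n) (e i ^+ 2 / 2 + e j ^+ 2 / 2) = n%:R * S.
  under eq_bigr do rewrite big_split/= sumr_const card_ord -mulr_suml -/S.
  rewrite big_split/= sumr_const card_ord sumrMnl -mulr_suml -/S -mulrnDl -mulr_natl.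
  by rewrite -mulr_natl; field.
rewrite -/S -SE expr2 mulr_suml; apply: ler_sum => i _; rewrite mulr_sumr; apply: ler_sum => j _.
by have := sqr_ge0 (e i - e j); rewrite !expr2; lra.
Qed.

Lemma sqr_sum3_le (R : realDomainType) (x y z : R) :
  (x + y + z) ^+ 2 <= 3 * (x ^+ 2 + y ^+ 2 + z ^+ 2).
Proof.
have := sqr_ge0 (x - y); have := sqr_ge0 (y - z); have := sqr_ge0 (x - z).
rewrite !expr2; nra.
Qed.

Lemma measurable_kernelG (R : realType) (H : R) : measurable_fun setT (kernelG H).
Proof. by apply: measurable_funM => //; exact: measurable_powR. Qed.

Lemma measurable_exp_kernel (R : realType) (s : seq (R * R)) : measurable_fun setT (exp_kernel s).
Proof.
apply: measurable_sum => go; apply: measurable_funM => //.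
apply: measurableT_comp => //; exact: measurableT_comp.
Qed.

Lemma kernel_error_sqr_le (R : realType) (H T t xi0 xin : R) (m n : nat)
    (x eta : 'I_n -> 'I_m -> R) :
  0 < H < 2^-1 -> 0 < t <= T -> (0 < m)%N -> (0 < n)%N -> 0 < xi0 -> xi0 < xin ->
  (forall j : 'I_n, is_gauss_rule (grid xi0 xin n j) (grid xi0 xin n j.+1) (wH H)
       (x j) (eta j)) ->
  (((kernelG H t - exp_kernel (quad_nodes H xi0 x eta) t) ^+ 2)%:E <=
   (3 * (cH H * (xi0 `^ (3 / 2 - H) / (3 / 2 - H))) ^+ 2 * t ^+ 2)%:E +
   (3 * n%:R * \sum_(j < n)
      gauss_bound H T (grid xi0 xin n j) ((grid_ratio xi0 xin n - 1) / 2) m t)%:E +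
   (3 * (cH H ^+ 2 * (xin `^ (- H) / H)))%:E * tail_energy H xin t)%E.
Proof.
move=> H01 t0T m0 n0 h0 h0n gauss; have /andP[H0 H1] := H01; have /andP[t0 tT] := t0T.
have hn := lt_trans h0 h0n.
set g := grid xi0 xin n; set r := grid_ratio xi0 xin n.
have r1 : 1 < r by exact: grid_ratio_gt1.
have g0 j : 0 < g j by exact: grid_gt0.
have gS j : g j.+1 = g j * r by exact: gridS.
have gl j : g j < g j.+1 by rewrite gS ltr_pMr.
have tl := tail_sqr_le H01 hn t0.
pose I (j : nat) := \int[@lebesgue_measure R]_(y in `[g j, g j.+1]) (expR (- (y * t)) * wH H y).
pose e (j : 'I_n) := I j - \sum_(k < m) eta j k * expR (- (x j k * t)).
pose hd := \int[@lebesgue_measure R]_(y in `]0, xi0]) (expR (- (y * t)) * wH H y) -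
  \int[@lebesgue_measure R]_(y in `[0, xi0]) wH H y.
pose tlr := \int[@lebesgue_measure R]_(y in `[xin, +oo[) (expR (- (y * t)) * wH H y).
(* The weight of the zero node is compared with ]0, xi0] and the j-th rule with the j-th cell; the
   part beyond [xin] has no node and is all error. *)
have dec : kernelG H t - exp_kernel (quad_nodes H xi0 x eta) t = hd + \sum_(j < n) e j + tlr.
  rewrite exp_kernel_quad_nodes kernelG_integral//.
  rewrite (@Rintegral_grid _ _ g n)//; last first.
  - exact: integrable_kernel.
  - by move=> j; rewrite ltW.
  rewrite sumrB /g grid0 gridn// -/g /hd /tlr /I; ring.
rewrite dec; apply: (@le_trans _ _ ((3 * (hd ^+ 2 + (\sum_(j < n) e j) ^+ 2 + tlr ^+ 2))%:E)).
  by rewrite lee_fin sqr_sum3_le.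
rewrite !mulrDr !EFinD; apply: leeD; first apply: leeD.
- rewrite lee_fin -mulrA ler_wpM2l// -exprMn.
  rewrite -real_normK ?num_real// lerXn2r ?nnegrE//.
    by rewrite !mulr_ge0 ?cH_ge0 ?powR_ge0 ?(ltW t0)// invr_ge0; lra.
  have := head_error_le H1 h0 t0; rewrite distrC -/hd => /le_trans; apply.
  by apply: eq_imp_le; ring.
- rewrite lee_fin -mulrA ler_wpM2l//; apply: (le_trans (sqr_sum_le _)).
  rewrite ler_wpM2l//; apply: ler_sum => j _.
  have H2 : - 2^-1 <= H by lra.
  have := gauss_rule_error H2 (g0 j) (gl j) (ltW t0) m0 (gauss j); rewrite -/(I j) -/(e j).
  (* On the geometric grid half a cell is its left end times (r - 1) / 2. *)
  have -> : (g j.+1 - g j) / 2 = g j * ((r - 1) / 2) by rewrite gS; field.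
  have -> : g j.+1 - g j = 2 * (g j * ((r - 1) / 2)) by rewrite gS; field.
  move=> he; apply: le_trans (gauss_bound_ge _ H01 (g0 j) t0T m0).
  rewrite -real_normK ?num_real// lerXn2r ?nnegrE//; exact: le_trans he.
- by rewrite (EFinM 3 (tlr ^+ 2)) (EFinM 3 (cH H ^+ 2 * _)) -muleA lee_wpmul2l.
Qed.

Lemma integral_sqr_0r (R : realType) (T : R) : 0 < T ->
  (\int[@lebesgue_measure R]_(t in `]0%R, T]) (t ^+ 2)%:E = (T ^+ 3 / 3)%:E)%E.
Proof.
move=> T0; have := @integral_powR_0r R 3 T; rewrite ltr0n => /(_ isT T0).
rewrite powR_mulrn ?ltW// => <-; apply: eq_integral => t.
rewrite inE/= in_itv/= => /andP[t0 _].
by rewrite (_ : 3 - 1 = 2%:R :> R) ?powR_mulrn ?ltW//; ring.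
Qed.

Lemma integral_itv_obnd_le (R : realType) (T : R) (f : R -> R) (C : \bar R) :
  measurable_fun setT f ->
  (\int[@lebesgue_measure R]_(t in `[0%R, T]) (f t)%:E <= C)%E ->
  (\int[@lebesgue_measure R]_(t in `]0%R, T]) (f t)%:E <= C)%E.
Proof.
move=> mf; rewrite integral_itv_obnd_cbnd//.
by apply/measurable_EFinP; exact: measurable_funTS.
Qed.

Lemma integral_kernel_error_le (R : realType) (H T xi0 xin : R) (m n : nat)
    (x eta : 'I_n -> 'I_m -> R) :
  0 < H < 2^-1 -> 0 < T -> (0 < m)%N -> (0 < n)%N -> 0 < xi0 -> xi0 < xin ->
  (forall j : 'I_n, is_gauss_rule (grid xi0 xin n j) (grid xi0 xin n j.+1) (wH H)
       (x j) (eta j)) ->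
  (\int[@lebesgue_measure R]_(t in `[0%R, T])
     ((kernelG H t - exp_kernel (quad_nodes H xi0 x eta) t) ^+ 2)%:E <=
   (cH H ^+ 2 * (T ^+ 3 * (xi0 `^ (3 / 2 - H) / (3 / 2 - H)) ^+ 2 +
     3 / (2 * H ^+ 2) * (xin `^ (- H)) ^+ 2 +
     9 / 2 * (T `^ (2 * H) / m%:R `^ (2 * H)) *
       (n%:R ^+ 2 * ((grid_ratio xi0 xin n - 1) / 2) ^+ (4 * m + 2))))%:E)%E.
Proof.
move=> H01 T0 m0 n0 h0 h0n gauss; have /andP[H0 H1] := H01.
have hn := lt_trans h0 h0n.
have r0 : 0 <= (grid_ratio xi0 xin n - 1) / 2.
  by rewrite divr_ge0// subr_ge0 ltW// grid_ratio_gt1.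
set rho := (grid_ratio xi0 xin n - 1) / 2 in r0 *.
have [mtail itail] := integral_tail_energy H0 hn T0.
pose g := fun t => (kernelG H t - exp_kernel (quad_nodes H xi0 x eta) t) ^+ 2.
have mg : measurable_fun setT g.
  apply: measurable_funX; apply: measurable_funB; first exact: measurable_kernelG.
  exact: measurable_exp_kernel.
pose k1 := 3 * (cH H * (xi0 `^ (3 / 2 - H) / (3 / 2 - H))) ^+ 2.
pose k3 := 3 * (cH H ^+ 2 * (xin `^ (- H) / H)).
have k10 : 0 <= k1 by rewrite mulr_ge0// sqr_ge0.
have k30 : 0 <= k3 by rewrite mulr_ge0// mulr_ge0 ?sqr_ge0// divr_ge0 ?powR_ge0// ltW.
pose gb (j : 'I_n) := gauss_bound H T (grid xi0 xin n j) rho m.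
have mgb j : measurable_fun setT (gb j) by exact: measurable_gauss_bound.
have gb0 j t : 0 <= t -> 0 <= gb j t.
  by move=> t0; apply: gauss_bound_ge0 => //; rewrite ltW// grid_gt0.
have t0 t : `]0, T]%classic t -> 0 <= t by rewrite /= in_itv/= => /andP[/ltW].
have i1 : (\int[@lebesgue_measure R]_(t in `]0%R, T]) (k1 * t ^+ 2)%:E =
    (k1 * (T ^+ 3 / 3))%:E)%E.
  rewrite ge0_integralZl_EFinM//; last by move=> t _; exact: sqr_ge0.
  by rewrite integral_sqr_0r.
have i2 : (\int[@lebesgue_measure R]_(t in `]0%R, T]) (3 * n%:R * \sum_(j < n) gb j t)%:E <=
    (3 * n%:R * (n%:R * (cH H ^+ 2 * (3 / 2) * rho ^+ (4 * m + 2) *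
       (T `^ (2 * H) / m%:R `^ (2 * H)))))%:E)%E.
  have -> : (\int[@lebesgue_measure R]_(t in `]0%R, T]) (3 * n%:R * \sum_(j < n) gb j t)%:E =
      (3 * n%:R)%:E * \int[@lebesgue_measure R]_(t in `]0%R, T]) (\sum_(j < n) gb j t)%:E)%E.
    apply: ge0_integralZl_EFinM => //.
      by apply: measurable_funTS; apply: measurable_sum => j; exact: mgb.
    by move=> t /t0 h; apply: sumr_ge0 => j _; exact: gb0.
  rewrite (EFinM (3 * n%:R)) lee_wpmul2l//.
  under eq_integral do rewrite -sumEFin.
  rewrite ge0_integral_sum//; last 2 first.
  - by move=> j; apply/measurable_EFinP; apply: measurable_funTS; exact: mgb.
  - by move=> j t /t0 h; rewrite lee_fin gb0.
  apply: (@le_trans _ _ (\sum_(j < n) (cH H ^+ 2 * (3 / 2) * rho ^+ (4 * m + 2) *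
       (T `^ (2 * H) / m%:R `^ (2 * H)))%:E)%E).
    apply: lee_sum => j _; apply: integral_itv_obnd_le => //.
    by apply: integral_gauss_bound => //; exact: grid_gt0.
  by rewrite sumEFin lee_fin sumr_const card_ord -[leLHS]mulr_natl.
have i3 : (\int[@lebesgue_measure R]_(t in `]0%R, T]) (k3%:E * tail_energy H xin t) <=
    (k3 * (xin `^ (- H) / (2 * H)))%:E)%E.
  have te0 t : (0 <= tail_energy H xin t)%E.
    by apply: integral_ge0 => y _; rewrite lee_fin mulr_ge0 ?powR_ge0 ?expR_ge0.
  rewrite ge0_integralZl_EFin//; last exact: measurable_funTS.
  rewrite (EFinM k3) lee_wpmul2l// integral_itv_obnd_cbnd//.
  exact: measurable_funTS.
(* The pointwise estimate is available for t > 0 only, hence the half-open interval. *)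
rewrite -(@integral_itv_obnd_cbnd _ 0 (BRight T)); last first.
  by apply/measurable_EFinP; exact: measurable_funTS.
pose B (t : R) : \bar R := ((k1 * t ^+ 2)%:E + (3 * n%:R * \sum_(j < n) gb j t)%:E +
   k3%:E * tail_energy H xin t)%E.
have b1 (t : R) : `]0, T]%classic t -> (0 <= (k1 * t ^+ 2)%:E)%E.
  by move=> _; rewrite lee_fin mulr_ge0 ?sqr_ge0.
have b2 (t : R) : `]0, T]%classic t -> (0 <= (3 * n%:R * \sum_(j < n) gb j t)%:E)%E.
  by move=> /t0 h; rewrite lee_fin mulr_ge0//; apply: sumr_ge0 => j _; exact: gb0.
have b3 (t : R) : `]0, T]%classic t -> (0 <= k3%:E * tail_energy H xin t)%E.
  move=> _; rewrite mule_ge0//.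
  by apply: integral_ge0 => y _; rewrite lee_fin mulr_ge0 ?powR_ge0 ?expR_ge0.
have m1 : measurable_fun `]0, T] (fun t : R => (k1 * t ^+ 2)%:E).
  apply/measurable_EFinP; apply: measurable_funTS; apply: measurable_funM => //.
have m2 : measurable_fun `]0, T] (fun t : R => (3 * n%:R * \sum_(j < n) gb j t)%:E).
  apply/measurable_EFinP; apply: measurable_funTS; apply: measurable_funM => //.
  apply: measurable_sum => j; exact: mgb.
have m3 : measurable_fun `]0, T] (fun t : R => (k3%:E * tail_energy H xin t)%E).
  by apply: measurable_funTS; exact: measurable_funeM.
have m12 := emeasurable_funD m1 m2.
apply: (@le_trans _ _ (\int[@lebesgue_measure R]_(t in `]0%R, T]) B t)%E).
  apply: ge0_le_integral.
  - exact: measurable_itv.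
  - by move=> t _; rewrite lee_fin sqr_ge0.
  - by apply/measurable_EFinP; exact: measurable_funTS.
  - exact: emeasurable_funD m12 m3.
  - move=> t; rewrite /= in_itv/= => tT; exact: kernel_error_sqr_le.
have -> : (\int[@lebesgue_measure R]_(t in `]0%R, T]) B t =
    \int[@lebesgue_measure R]_(t in `]0%R, T]) (k1 * t ^+ 2)%:E +
    \int[@lebesgue_measure R]_(t in `]0%R, T]) (3 * n%:R * \sum_(j < n) gb j t)%:E +
    \int[@lebesgue_measure R]_(t in `]0%R, T]) (k3%:E * tail_energy H xin t))%E.
  transitivity (\int[@lebesgue_measure R]_(t in `]0%R, T])
      ((k1 * t ^+ 2)%:E + (3 * n%:R * \sum_(j < n) gb j t)%:E) +
      \int[@lebesgue_measure R]_(t in `]0%R, T]) (k3%:E * tail_energy H xin t))%E.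
    apply: ge0_integralD; [exact: measurable_itv| |exact: m12|exact: b3|exact: m3].
    by move=> t tT; apply: adde_ge0; [exact: b1|exact: b2].
  congr (_ + _)%E.
  by apply: ge0_integralD; [exact: measurable_itv|exact: b1|exact: m1|exact: b2|exact: m2].
rewrite i1; apply: (@le_trans _ _ ((k1 * (T ^+ 3 / 3))%:E +
  (3 * n%:R * (n%:R * (cH H ^+ 2 * (3 / 2) * rho ^+ (4 * m + 2) *
       (T `^ (2 * H) / m%:R `^ (2 * H)))))%:E + (k3 * (xin `^ (- H) / (2 * H)))%:E)%E).
  by apply: leeD => //; apply: leeD.
(* The common factor 3 meets T^3 / 3 from the head, 1 / (2 H^2) from the tail and n^2 times 3/2 from
   the cells, whence the coefficients T^3, 3 / (2 H^2) and 9/2. *)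
rewrite -!EFinD lee_fin; apply: eq_imp_le; rewrite /k1 /k3.
move: (T `^ _ / _) (xin `^ _) (xi0 `^ _ / _) (rho ^+ _) => q1 q2 q3 q4.
by field; rewrite gt_eqF.
Qed.

Lemma integral_reflect (R : realType) (T : R) (f : R -> R) :
  measurable_fun setT f -> (forall x, 0 <= f x) ->
  (\int[@lebesgue_measure R]_(s in `[0%R, T]) (f (T - s))%:E =
   \int[@lebesgue_measure R]_(t in `[0%R, T]) (f t)%:E)%E.
Proof.
move=> mf f0.
have inI (s : R) : (s \in `[0, T]%classic) = (0 <= s <= T).
  by apply/idP/idP => [/set_mem|h]; rewrite ?mem_set//= in_itv.
pose F (x : R) := (f x * \1_(`[0, T]%classic) x)%:E.
have mF : measurable_fun setT F.
  by apply/measurable_EFinP; apply: measurable_funM.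
have F0 x : (0 <= F x)%E by rewrite lee_fin mulr_ge0.
have n1 : (-1 : R) != 0 by rewrite oppr_eq0 oner_neq0.
have := ge0_integral_affine T n1 mF F0; rewrite normrN1 invr1 mul1e => h.
rewrite [RHS]integral_indicr -[RHS]h integral_indicr; apply: eq_integral => s _.
rewrite /F (_ : -1 * s + T = T - s); last by ring.
rewrite !indicE !inI; congr (_ * (_ : bool)%:R)%:E; apply/idP/idP => /andP[h1 h2]; apply/andP; split; lra.
Qed.

Lemma sqr_powR_expR (R : realType) (a y p : R) : 0 < a ->
  ((a * expR y) `^ p) ^+ 2 = a `^ (2 * p) * expR (2 * (y * p)).
Proof.
move=> a0; rewrite powRM ?expR_ge0 ?ltW// -expRM exprMn !expr2 -powRD; last first.
  by rewrite (gt_eqF a0) implybT.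
by rewrite -expRD; congr (_ `^ _ * expR _); ring.
Qed.

Lemma A_minus_gt0 (R : realType) (H : R) : 0 < H < 2^-1 -> 0 < A_minus H.
Proof.
move=> /andP[H0 H1]; rewrite sqrtr_gt0 addr_gt0 ?invr_gt0//; lra.
Qed.

(** The rate in [xi_first] carries 1 / (3/2 - H), which the power 3/2 - H cancels; [xi_last] is
    tuned likewise to H, so both truncation errors decay at the same rate. *)
Lemma xi_first_powR (R : realType) (H alpha a : R) (N : nat) : 0 < H < 2^-1 -> 0 < a ->
  (xi_first H alpha a N `^ (3 / 2 - H)) ^+ 2 =
  a `^ (3 - 2 * H) * expR (- (2 * alpha / A_minus H * Num.sqrt N%:R)).
Proof.
move=> H01 a0; have A0 := A_minus_gt0 H01; have /andP[H0 H1] := H01.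
rewrite /xi_first sqr_powR_expR//; congr (_ `^ _ * expR _); first by field.
by field; rewrite gt_eqF//=; apply/eqP; lra.
Qed.

Lemma xi_last_powR (R : realType) (H alpha b : R) (N : nat) : 0 < H < 2^-1 -> 0 < b ->
  (xi_last H alpha b N `^ (- H)) ^+ 2 =
  b `^ (- (2 * H)) * expR (- (2 * alpha / A_minus H * Num.sqrt N%:R)).
Proof.
move=> H01 b0; have A0 := A_minus_gt0 H01; have /andP[H0 H1] := H01.
rewrite /xi_last sqr_powR_expR//; congr (_ `^ _ * expR _); first by ring.
by field; rewrite !gt_eqF.
Qed.

(** Already pi >= 2 gives 5 pi^3 / 12 >= 10/3, while 9/2 times H stays below 9/4. *)
Lemma pi3_const_ge (R : realType) (H : R) : 0 < H < 2^-1 -> 9 / 2 <= 5 * pi ^+ 3 / 12 / H.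
Proof.
move=> /andP[H0 H1]; rewrite ler_pdivlMr//.
have p8 : (8 : R) <= pi ^+ 3.
  have -> : (8 : R) = 2 ^+ 3 by rewrite -natrX.
  by rewrite lerXn2r ?nnegrE ?pi_ge0 ?pi_ge2.
by lra.
Qed.

Lemma kernel_error_L2 (R : realType) (T H : R) (N : nat) (alpha a b : R)
  (m n : nat) (x eta : 'I_n -> 'I_m -> R) :
  0 < T -> 0 < H < 2^-1 -> 0 < a -> 0 < b -> (0 < m)%N -> (0 < n)%N ->
  let xi0 := xi_first H alpha a N in
  let xin := xi_last H alpha b N in
  let r := grid_ratio xi0 xin n in
  let Ghat := exp_kernel (quad_nodes H xi0 x eta) in
  xi0 < xin ->
  (forall j : 'I_n,
     is_gauss_rule (grid xi0 xin n j) (grid xi0 xin n j.+1) (wH H)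
       (x j) (eta j)) ->
  (\int[@lebesgue_measure R]_(s in `[0%R, T])
     ((kernelG H (T - s) - Ghat (T - s)) ^+ 2)%:E <=
   (cH H ^+ 2 *
     (T ^+ 3 / (3 / 2 - H) ^+ 2 * a `^ (3 - 2 * H)
        * expR (- (2 * alpha / A_minus H * Num.sqrt N%:R))
      + 3 / (2 * H ^+ 2) * b `^ (- (2 * H))
        * expR (- (2 * alpha / A_minus H * Num.sqrt N%:R))
      + 5 * pi ^+ 3 / 12 * (T `^ (2 * H) / H)
        * (n%:R ^+ 2 / m%:R `^ (2 * H))
        * ((r - 1) / 2) ^+ (4 * m + 2)))%:E)%E.
Proof.
move=> T0 H01 a0 b0 m0 n0 xi0 xin r Ghat xi0n gauss; have /andP[H0 H1] := H01.
have h0 : 0 < xi0 by rewrite mulr_gt0 ?expR_gt0.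
have mg : measurable_fun setT (fun t => (kernelG H t - Ghat t) ^+ 2).
  apply: measurable_funX; apply: measurable_funB; first exact: measurable_kernelG.
  exact: measurable_exp_kernel.
rewrite (integral_reflect T mg); last by move=> t; exact: sqr_ge0.
apply: (le_trans (integral_kernel_error_le H01 T0 m0 n0 h0 xi0n gauss)).
rewrite lee_fin ler_wpM2l ?sqr_ge0//; apply: lerD.
  rewrite exprMn xi_first_powR// xi_last_powR// exprVn; apply: eq_imp_le; ring.
have Q0 : 0 <= T `^ (2 * H) * (n%:R ^+ 2 / m%:R `^ (2 * H)) * ((r - 1) / 2) ^+ (4 * m + 2).
  rewrite mulr_ge0//; first by rewrite mulr_ge0 ?powR_ge0// divr_ge0 ?powR_ge0.
  by rewrite exprn_even_ge0// oddD oddM.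
have := ler_wpM2r Q0 (pi3_const_ge H01); rewrite -/r.
move: (_ ^+ (4 * m + 2)) (T `^ _) (m%:R `^ _) => k1 k2 k3.
by rewrite -!mulrA => h; apply: le_trans (le_trans _ h) _; apply: eq_imp_le; ring.
Qed.

(** * Drift term and conclusion *)

Lemma integral_cst_0r (R : realType) (c T : R) : 0 < T ->
  (\int[@lebesgue_measure R]_(s in `[0%R, T]) cst c%:E s = (c * T)%:E)%E.
Proof.
move=> T0; have h : @lebesgue_measure R `[0, T] = T%:E.
  by rewrite lebesgue_measure_itv/= lte_fin T0 sube0.
transitivity (c%:E * @lebesgue_measure R `[0%R, T]%classic)%E; last by rewrite h.
exact: integral_cst.
Qed.

Lemma frobnorm_ge0 (R : realType) (p q : nat) (A : 'M[R]_(p, q)) : 0 <= frobnorm A.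
Proof. exact: sqrtr_ge0. Qed.

Lemma sqr_frobnorm_cV (R : realType) (p : nat) (A : 'cV[R]_p) :
  frobnorm A ^+ 2 = \sum_(i < p) A i 0 ^+ 2.
Proof. by rewrite sqr_frobnorm; apply: eq_bigr => i _; rewrite big_ord1. Qed.

Lemma Linfty_norm_ae (R : realType) (p q : nat) (T : R) (f : R -> 'M[R]_(p, q)) :
  in_Linfty T f ->
  {ae @lebesgue_measure R, forall s, `[0, T]%classic s ->
     frobnorm (f s) ^+ 2 <= fine (Linfty_norm T f) ^+ 2}.
Proof.
move=> [_]; rewrite /Linfty_norm unlock.
(* The norm at exponent infinity branches on the total measure being positive. *)
have T0 : (0 < @lebesgue_measure R [set: R])%E.
  have := @lebesgue_measure_itv R `]-oo, +oo[; rewrite set_itvNyy/= => h.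
  by rewrite [ltRHS]h ltry.
rewrite T0; set F := (X in ess_sup _ X) => Flty.
have := ess_sup_ge (@lebesgue_measure R) F.
apply: filterS => s Fs sT.
have Fr : F s = (frobnorm (f s))%:E.
  by rewrite /F /= patchE mem_set// ger0_norm// frobnorm_ge0.
move: Fs Flty; rewrite Fr; case: (ess_sup _ F) => [r| |]//= h _.
by rewrite lerXn2r ?nnegrE ?frobnorm_ge0// (le_trans (frobnorm_ge0 (f s)) h).
Qed.

(** Serves twice: with [g] constantly 1 it bounds the energy of the drift coefficient, with [g] the
    kernel error it bounds the integrand of the noise term. *)
Lemma integral_sqr_frobnorm_le (R : realType) (p q : nat) (T C : R) (g : R -> R)
    (f : R -> 'M[R]_(p, q)) :
  in_Linfty T f -> measurable_fun setT g ->
  (\int[@lebesgue_measure R]_(s in `[0%R, T]) (g s ^+ 2)%:E <= C%:E)%E ->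
  (\int[@lebesgue_measure R]_(s in `[0%R, T]) (g s ^+ 2 * frobnorm (f s) ^+ 2)%:E <=
   (fine (Linfty_norm T f) ^+ 2 * C)%:E)%E.
Proof.
move=> Lf mg gC; have [mf _] := Lf; have ae := Linfty_norm_ae Lf.
set L := fine _ in ae *.
have mg2 : measurable_fun `[0, T] (fun s => g s ^+ 2).
  by apply: measurable_funTS; exact: measurable_funX.
have mF := measurable_sqr_frobnorm mf.
have ae2 : {ae @lebesgue_measure R, forall s, `[0, T]%classic s ->
    ((g s ^+ 2 * frobnorm (f s) ^+ 2)%:E <= (L ^+ 2 * g s ^+ 2)%:E)%E}.
  have [Z [mZ Z0 subZ]] := ae; exists Z; split=> // s ns; apply: subZ => h; apply: ns => sT.
  by rewrite lee_fin mulrC ler_wpM2r ?sqr_ge0//; exact: h.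
apply: (@le_trans _ _ (\int[@lebesgue_measure R]_(s in `[0%R, T]) (L ^+ 2 * g s ^+ 2)%:E)%E).
  apply: ae_ge0_le_integral.
  - exact: measurable_itv.
  - by move=> s _; rewrite lee_fin mulr_ge0 ?sqr_ge0.
  - by apply/measurable_EFinP; apply: measurable_funM.
  - by move=> s _; rewrite lee_fin mulr_ge0 ?sqr_ge0.
  - by apply/measurable_EFinP; apply: measurable_funM.
  - exact: ae2.
rewrite ge0_integralZl_EFinM ?sqr_ge0//; last by move=> s _; exact: sqr_ge0.
by rewrite (EFinM (L ^+ 2)) lee_wpmul2l// lee_fin sqr_ge0.
Qed.

(** Absolute values let the induction run over arbitrary lists of nodes. The bound makes [Ghat]
    times the drift coefficient integrable. *)
Lemma exp_kernel_bounded (R : realType) (T : R) (nodes : seq (R * R)) :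
  exists2 M, 0 <= M & forall t, 0 <= t <= T -> `|exp_kernel nodes t| <= M.
Proof.
elim: nodes => [|[g o] nodes [M M0 IH]].
  by exists 0 => // t _; rewrite /exp_kernel big_nil normr0.
exists (`|o| * expR (`|g| * T) + M); first by rewrite addr_ge0// mulr_ge0 ?expR_ge0.
move=> t tT; have := IH t tT; rewrite /exp_kernel big_cons /= => h.
rewrite (le_trans (ler_normD _ _))// lerD// normrM ler_wpM2l// ger0_norm ?expR_ge0//.
have /andP[t0 tT'] := tT.
rewrite ler_expR (le_trans (ler_norm _))// normrN normrM ler_wpM2l//.
by rewrite ger0_norm.
Qed.

Section Drift.
Context {R : realType} {T : R} {D : nat} {b : R -> 'cV[R]_D}.
Hypotheses (T0 : 0 < T) (Lb : in_Linfty T b).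

Let mb i : measurable_fun `[0, T] (fun s => b s i 0) := Lb.1 i 0.

Let L := fine (Linfty_norm T b).

(** Energy of one coordinate. Cauchy-Schwarz is applied coordinatewise with a common constant [C],
    and only the sum of these energies is compared with [T * L ^+ 2]. *)
Let Bi i := \int[@lebesgue_measure R]_(s in `[0, T]) (b s i 0 ^+ 2).

Lemma integral_sqr_frobnorm_drift :
  (\int[@lebesgue_measure R]_(s in `[0%R, T]) (frobnorm (b s) ^+ 2)%:E <= (T * L ^+ 2)%:E)%E.
Proof.
have m1 : measurable_fun setT (cst 1 : R -> R) by exact: measurable_cst.
have := @integral_sqr_frobnorm_le R D 1 T T (cst 1) b Lb m1; rewrite -/L [_ ^+ 2 * T]mulrC.
have -> : (\int[@lebesgue_measure R]_(s in `[0%R, T]) (cst 1 s ^+ 2 * frobnorm (b s) ^+ 2)%:E =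
    \int[@lebesgue_measure R]_(s in `[0%R, T]) (frobnorm (b s) ^+ 2)%:E)%E.
  by apply: eq_integral => s _; rewrite /= expr1n mul1r.
apply.
have -> : (\int[@lebesgue_measure R]_(s in `[0%R, T]) ((cst 1 : R -> R) s ^+ 2)%:E =
    \int[@lebesgue_measure R]_(s in `[0%R, T]) (cst 1%:E s))%E.
  by apply: eq_integral => s _; rewrite /= expr1n.
by rewrite [leLHS](integral_cst_0r _ T0) mul1r.
Qed.

Lemma drift_component_fin i :
  (\int[@lebesgue_measure R]_(s in `[0%R, T]) (b s i 0 ^+ 2)%:E = (Bi i)%:E)%E.
Proof.
rewrite /Bi /Rintegral fineK// ge0_fin_numE; last first.
  by apply: integral_ge0 => s _; rewrite lee_fin sqr_ge0.
apply: (@le_lt_trans _ _ (T * L ^+ 2)%:E); last by rewrite ltry.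
apply: le_trans integral_sqr_frobnorm_drift; apply: ge0_le_integral.
- exact: measurable_itv.
- by move=> s _; rewrite lee_fin sqr_ge0.
- by apply/measurable_EFinP; apply: measurable_funX; exact: mb.
- by apply/measurable_EFinP; apply: measurable_sqr_frobnorm => k l; exact: Lb.1.
- move=> s _; rewrite lee_fin sqr_frobnorm_cV (bigD1 i)//= lerDl.
  by apply: sumr_ge0 => k _; exact: sqr_ge0.
Qed.

Lemma drift_component_sum : \sum_(i < D) Bi i <= T * L ^+ 2.
Proof.
rewrite -lee_fin -sumEFin; apply: le_trans integral_sqr_frobnorm_drift.
under eq_bigr do rewrite -drift_component_fin.
rewrite -ge0_integral_sum//; last 2 first.
- by move=> i; apply/measurable_EFinP; apply: measurable_funX; exact: mb.
- by move=> i s _; rewrite lee_fin sqr_ge0.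
by apply: eq_imp_le; apply: eq_integral => s _; rewrite sumEFin sqr_frobnorm_cV.
Qed.

Lemma drift_cauchy_schwarz (h : R -> R) (C : R) (i : 'I_D) :
  measurable_fun setT h ->
  (\int[@lebesgue_measure R]_(s in `[0%R, T]) (h s ^+ 2)%:E <= C%:E)%E ->
  (@lebesgue_measure R).-integrable `[0, T] (EFin \o (fun s => h s * b s i 0)) /\
  (\int[@lebesgue_measure R]_(s in `[0, T]) (h s * b s i 0)) ^+ 2 <= C * Bi i.
Proof.
move=> mh hC.
have mh' : measurable_fun `[0, T] h by exact: measurable_funTS.
have C0 : 0 <= C.
  by rewrite -lee_fin (le_trans _ hC)// integral_ge0// => s _; rewrite lee_fin sqr_ge0.
have B0 : 0 <= Bi i by apply: Rintegral_ge0 => s _; exact: sqr_ge0.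
have cs : (\int[@lebesgue_measure R]_(s in `[0%R, T]) (`|h s| * `|b s i 0|)%:E <=
    (Num.sqrt (C * Bi i))%:E)%E.
  apply: ge0_cauchy_schwarz => //.
  - exact: measurableT_comp mh'.
  - exact: measurableT_comp (mb i).
  - apply: le_trans hC; apply: eq_imp_le; apply: eq_integral => s _.
    by rewrite real_normK ?num_real.
  - rewrite -drift_component_fin; apply: eq_imp_le; apply: eq_integral => s _.
    by rewrite real_normK ?num_real.
have hi : (@lebesgue_measure R).-integrable `[0, T] (EFin \o (fun s => h s * b s i 0)).
  apply/integrableP; split.
    by apply/measurable_EFinP; apply: measurable_funM => //; exact: mb.
  apply: le_lt_trans (ltry (Num.sqrt (C * Bi i))); apply: le_trans cs.
  by apply: eq_imp_le; apply: eq_integral => s _; rewrite /= normrM.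
split => //.
have h1 : `|\int[@lebesgue_measure R]_(s in `[0, T]) (h s * b s i 0)| <=
    \int[@lebesgue_measure R]_(s in `[0, T]) `|h s * b s i 0| by exact: le_normr_Rintegral.
have h2 : \int[@lebesgue_measure R]_(s in `[0, T]) `|h s * b s i 0| <= Num.sqrt (C * Bi i).
  rewrite -lee_fin fineK; last first.
    by apply: integrable_fin_num => //; exact: (integrable_norm hi).
  by apply: le_trans cs; apply: eq_imp_le; apply: eq_integral => s _; rewrite normrM.
rewrite -real_normK ?num_real// -[leRHS]sqr_sqrtr ?mulr_ge0//.
by rewrite lerXn2r ?nnegrE ?sqrtr_ge0// (le_trans h1).
Qed.

Lemma drift_error_le (G Gh : R -> R) (C : R) :
  measurable_fun setT G -> measurable_fun setT Gh ->
  (\int[@lebesgue_measure R]_(s in `[0%R, T]) ((G s - Gh s) ^+ 2)%:E <= C%:E)%E ->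
  (exists2 M, 0 <= M & forall s, 0 <= s <= T -> `|Gh s| <= M) ->
  frobnorm ((\col_i \int[@lebesgue_measure R]_(s in `[0, T]) (G s * b s i 0)) -
    \col_i \int[@lebesgue_measure R]_(s in `[0, T]) (Gh s * b s i 0)) ^+ 2 <=
  C * (T * L ^+ 2).
Proof.
move=> mG mGh GC [M M0 GhM].
have C0 : 0 <= C.
  by rewrite -lee_fin (le_trans _ GC)// integral_ge0// => s _; rewrite lee_fin sqr_ge0.
have mB : measurable_fun setT (fun s => G s - Gh s) by exact: measurable_funB.
have GhC : (\int[@lebesgue_measure R]_(s in `[0%R, T]) (Gh s ^+ 2)%:E <= (M ^+ 2 * T)%:E)%E.
  apply: (@le_trans _ _ (\int[@lebesgue_measure R]_(s in `[0%R, T]) (cst (M ^+ 2)%:E s))%E).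
    apply: ge0_le_integral.
    - exact: measurable_itv.
    - by move=> s _; rewrite lee_fin sqr_ge0.
    - by apply/measurable_EFinP; apply: measurable_funTS; exact: measurable_funX.
    - exact: measurable_cst.
    - move=> s; rewrite /= in_itv/= => /GhM h.
      by rewrite lee_fin -real_normK ?num_real// lerXn2r ?nnegrE.
  by rewrite [leLHS](integral_cst_0r _ T0).
rewrite sqr_frobnorm_cV; apply: le_trans (ler_wpM2l C0 drift_component_sum).
rewrite mulr_sumr; apply: ler_sum => i _; rewrite !mxE.
have [iB leB] := drift_cauchy_schwarz i mB GC.
have [ih _] := drift_cauchy_schwarz i mGh GhC.
apply: le_trans leB; apply: eq_imp_le; congr (_ ^+ 2).
(* Both parts are integrable: (G - Gh) b by the bound on the kernel error, Gh b by boundedness of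
   Gh. Splitting G b this way avoids a separate study of G. *)
have -> : \int[@lebesgue_measure R]_(s in `[0, T]) (G s * b s i 0) =
    \int[@lebesgue_measure R]_(s in `[0, T]) ((G s - Gh s) * b s i 0 + Gh s * b s i 0).
  by apply: eq_Rintegral => s _; ring.
by rewrite RintegralD//; ring.
Qed.

End Drift.

Theorem theorem3p2
  (R : realType) (d : measure_display) (Om : measurableType d)
  (P : probability Om R)
  (T : R) (D : nat) (H : R) (N : nat) (alpha beta a b : R)
  (m n : nat) (x eta : 'I_n -> 'I_m -> R)
  (B : R -> Om -> 'cV[R]_D) (X0 : Om -> 'cV[R]_D) (kappa : R)
  (bb : R -> 'cV[R]_D) (Sigma : R -> 'M[R]_D)
  (X Xhat : R -> Om -> 'cV[R]_D) :
  0 < T -> 0 < H < 2^-1 -> (1 <= N)%N ->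
  0 < alpha -> 0 < beta -> 0 < a -> 0 < b ->
  (0 < m)%N -> (0 < n)%N ->
  let xi0 := xi_first H alpha a N in
  let xin := xi_last H alpha b N in
  let r := grid_ratio xi0 xin n in
  let rho := fun t : R => expR (- (kappa * t)) in
  let Ghat := exp_kernel (quad_nodes H xi0 x eta) in
  xi0 < xin ->
  (forall j : 'I_n,
     is_gauss_rule (grid xi0 xin n j) (grid xi0 xin n j.+1) (wH H)
       (x j) (eta j)) ->
  brownian_motion P B ->
  random_vector X0 ->
  independent_of_process P X0 B ->
  0 < kappa ->
  in_Linfty T bb ->
  in_Linfty T Sigma ->
  is_volterra_process P T B X0 rho (kernelG H) bb Sigma X ->
  is_volterra_process P T B X0 rho Ghat bb Sigma Xhat ->
  ('E_P[(fun w => frobnorm (X T w - Xhat T w) ^+ 2)%R] <=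
   (C_const T bb Sigma * cH H ^+ 2 *
     (T ^+ 3 / (3 / 2 - H) ^+ 2 * a `^ (3 - 2 * H)
        * expR (- (2 * alpha / A_minus H * Num.sqrt N%:R))
      + 3 / (2 * H ^+ 2) * b `^ (- (2 * H))
        * expR (- (2 * alpha / A_minus H * Num.sqrt N%:R))
      + 5 * pi ^+ 3 / 12 * (T `^ (2 * H) / H)
        * (n%:R ^+ 2 / m%:R `^ (2 * H))
        * ((r - 1) / 2) ^+ (4 * m + 2)))%:E)%E.
Proof.
move=> T0 H01 N1 al0 be0 a0 b0 m0 n0 xi0 xin r rho Ghat xi0n gauss bmB rX0 indep k0 Lb LS vX vXh.
have kerr := kernel_error_L2 T0 H01 a0 b0 m0 n0 xi0n gauss.
have TT : 0 <= T <= T by rewrite lexx ltW.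
have [rX [W itoW aeX]] := vX T TT; have [rXh [Wh itoWh aeXh]] := vXh T TT.
rewrite -mulrA; move: kerr; rewrite -/xi0 -/xin -/r -/Ghat.
set C := cH H ^+ 2 * _ => kerr.
pose G s := kernelG H (T - s); pose Gh s := Ghat (T - s).
have mT : measurable_fun setT (fun s : R => T - s) by exact: measurable_funB.
have mG : measurable_fun setT G by exact: measurableT_comp (@measurable_kernelG R H) mT.
have mGh : measurable_fun setT Gh by exact: measurableT_comp (@measurable_exp_kernel R _) mT.
have mGG : measurable_fun setT (fun s => G s - Gh s) by exact: measurable_funB.
have Gbd : exists2 M, 0 <= M & forall s, 0 <= s <= T -> `|Gh s| <= M.
  have [M M0 hM] := exp_kernel_bounded T (quad_nodes H xi0 x eta).
  by exists M => // s /andP[s0 sT]; apply: hM; apply/andP; split; lra.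
have drift := drift_error_le T0 Lb mG mGh kerr Gbd.
have mSig (g : R -> R) : measurable_fun setT g ->
    forall i j, measurable_fun `[0, T] (fun s => (g s *: Sigma s) i j).
  move=> mg i j; rewrite (_ : (fun s => _) = (fun s => g s * Sigma s i j)); last first.
    by apply/funext => s; rewrite mxE.
  by apply: measurable_funM; [exact: measurable_funTS|exact: LS.1].
have noise0 : (\int[@lebesgue_measure R]_(s in `[0%R, T])
    (frobnorm (G s *: Sigma s - Gh s *: Sigma s) ^+ 2)%:E <=
    (fine (Linfty_norm T Sigma) ^+ 2 * C)%:E)%E.
  apply: le_trans (integral_sqr_frobnorm_le LS mGG kerr).
  by apply: eq_imp_le; apply: eq_integral => s _; rewrite -scalerBl frobnormZ.
have noise := ito_isometry_le bmB (mSig _ mG) (mSig _ mGh) itoW itoWh noise0.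
set b1 := \col_i _ in drift; set b2 := \col_i _ in drift; set u := b1 - b2 in drift.
have mW i j : measurable_fun setT (fun w => (W w - Wh w) i j).
  rewrite ord1; under eq_fun do rewrite !mxE; apply: measurable_funB; [exact: itoW.1|exact: itoWh.1].
have mX i j : measurable_fun setT (fun w => (X T w - Xhat T w) i j).
  by rewrite ord1; under eq_fun do rewrite !mxE; exact: measurable_funB.
have mWn := measurable_sqr_frobnorm mW; have mXn := measurable_sqr_frobnorm mX.
(* The common term [rho T *: X0 w] cancels, leaving the deterministic drift difference [u] plus a
   difference of two Ito integrals. *)
have aeXX : {ae P, forall w, X T w - Xhat T w = u + (W w - Wh w)}.
  move: aeX aeXh; apply: filterS2 => w -> ->; rewrite /u -/b1 -/b2.
  by move: (rho T *: X0 w) => c; apply/matrixP => i j; rewrite !mxE; ring.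
(* The square of the sum is split with e = 1, the origin of both factors 2 in [C_const]. *)
rewrite unlock; apply: (@le_trans _ _ (\int[P]_w
    (2 * frobnorm u ^+ 2 + 2 * frobnorm (W w - Wh w) ^+ 2)%:E)%E).
  apply: ae_ge0_le_integral.
  - exact: measurableT.
  - by move=> w _; rewrite lee_fin sqr_ge0.
  - exact/measurable_EFinP.
  - by move=> w _; rewrite lee_fin addr_ge0// mulr_ge0// sqr_ge0.
  - by apply/measurable_EFinP; apply: measurable_funD => //; exact: measurable_funM.
  - move: aeXX; apply: filterS => w -> _; rewrite lee_fin.
    by apply: (le_trans (sqr_frobnormD _ _ ltr01)); rewrite invr1.
rewrite ge0_integralD_EFinD//; last 3 first.
- exact: measurable_funM.
- by move=> w _; rewrite mulr_ge0// sqr_ge0.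
- by move=> w _; rewrite mulr_ge0// sqr_ge0.
rewrite [X in (X + _ <= _)%E](_ : _ = (2 * frobnorm u ^+ 2)%:E); last first.
  transitivity ((2 * frobnorm u ^+ 2)%:E * P setT)%E; last by rewrite probability_setT mule1.
  exact: integral_cst.
rewrite ge0_integralZl_EFinM//; last by move=> w _; exact: sqr_ge0.
apply: (@le_trans _ _ ((2 * (C * (T * fine (Linfty_norm T bb) ^+ 2)))%:E +
    (2 * (fine (Linfty_norm T Sigma) ^+ 2 * C))%:E)%E).
  apply: leeD; first by rewrite lee_fin ler_wpM2l.
  by rewrite (EFinM 2) lee_wpmul2l.
by rewrite -EFinD lee_fin /C_const; apply: eq_imp_le; ring.
Qed.
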